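(* Every compact Einstein almost Kähler manifold $(N,h,J,\Omega)$ which is not Kähler satisfies $$s<\frac1V\int_N s^*\leq \frac15 s<0,$$ where $V$ denotes the volume of $N$, $s$ its (constant) scalar curvature and $s^*$ its $*$-scalar curvature.
   Context: An almost Kähler manifold $(N,h,J,\Omega)$ is a manifold with a Riemannian metric $h$, an almost complex structure $J$ that is orthogonal for $h$, and a closed $2$-form $\Omega(X,Y)=h(JX,Y)$; it is Kähler if $\Omega$ is parallel for the Levi-Civita connection $\nabla$ of $h$. Einstein means that $\mathrm{Ric}=\lambda h$ with $\lambda$ constant. With $R(X,Y)Z=\nabla_X\nabla_YZ-\nabla_Y\nabla_XZ-\nabla_{[X,Y]}Z$ and a local orthonormal frame $\{e_i\}$ (with dual coframe $\{e^i\}$), the $*$-Ricci form is $\rho^{*h}(X,Y)=\sum_i h(R(X,e_i)(Je_i),Y)$, and the $*$-scalar curvature is the function $s^*=2\langle\rho^{*h},\Omega\rangle$, where the inner product on $2$-forms is the one for which the $e^i\wedge e^j$, $i<j$, are orthonormal. (With these conventions $s^*=s$ on a Kähler manifold.) *)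

(* Defs.v *)
From HB Require Import structures.
From mathcomp Require Import all_boot all_order all_algebra.
From mathcomp Require Import all_classical all_reals all_analysis.

Set Implicit Arguments.
Unset Strict Implicit.
Unset Printing Implicit Defensive.

Import Order.TTheory GRing.Theory Num.Theory.
Import numFieldNormedType.Exports.

Local Open Scope classical_set_scope.
Local Open Scope ring_scope.

(* Tangent vectors in a chart are row vectors; a linear map acts on them by
   right multiplication by its matrix, and a bilinear form is given by its Gram
   matrix. *)

Section Smooth.
Context {R : realType} {n : nat} {W : normedModType R}.
Implicit Types (U : set 'rV[R]_n) (f : 'rV[R]_n -> W).

Fixpoint Ck_on (k : nat) U f : Prop :=
  (forall x, U x -> {for x, continuous f}) /\
  match k with
  | 0 => True
  | k'.+1 => forall a : 'I_n,
      (forall x, U x -> derivable f x (delta_mx 0 a)) /\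
      Ck_on k' U ('D_(delta_mx 0 a) f)
  end.

Definition smooth_on U f : Prop := forall k, Ck_on k U f.

End Smooth.

(* The carrier is pointed (hence nonempty) because the library's measurable
   types are. The inverse of [chart i] is [param i], which is only meaningful on
   the image of [dom i]. *)
Record smooth_manifold (R : realType) (n : nat) (N : ptopologicalType) :=
  SmoothManifold {
    atlas : Type;
    dom : atlas -> set N;
    chart : atlas -> N -> 'rV[R]_n;
    param : atlas -> 'rV[R]_n -> N;
    chart_at : N -> atlas;
    manifold_hausdorff : hausdorff_space N;
    manifold_second_countable : @second_countable N;
    mem_chart_at : forall p, dom (chart_at p) p;
    dom_open : forall i, open (dom i);
    image_open : forall i, open (chart i @` dom i);
    chartK : forall i p, dom i p -> param i (chart i p) = p;
    chart_continuous : forall i p, dom i p -> {for p, continuous (chart i)};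
    param_continuous : forall i x, (chart i @` dom i) x ->
      {for x, continuous (param i)};
    transition_smooth : forall i j,
      smooth_on (chart i @` (dom i `&` dom j)) (chart j \o param i) }.

Definition chart_image {R : realType} {n : nat} {N : ptopologicalType}
    (M : smooth_manifold R n N) (i : atlas M) : set 'rV[R]_n :=
  chart i @` dom i.

Definition overlap {R : realType} {n : nat} {N : ptopologicalType}
    (M : smooth_manifold R n N) (i j : atlas M) : set 'rV[R]_n :=
  chart i @` (dom i `&` dom j).

Definition transition {R : realType} {n : nat} {N : ptopologicalType}
    (M : smooth_manifold R n N) (i j : atlas M) : 'rV[R]_n -> 'rV[R]_n :=
  chart j \o param i.

Definition bil {R : realType} {n : nat} (B : 'M[R]_n) (u v : 'rV[R]_n) : R :=
  (u *m B *m v^T) 0 0.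

Record riemannian_metric (R : realType) (n : nat) (N : ptopologicalType)
    (M : smooth_manifold R n N) := RiemannianMetric {
  metric :> atlas M -> 'rV[R]_n -> 'M[R]_n;
  metric_smooth : forall i, smooth_on (chart_image i) (metric i);
  metric_sym : forall i x, chart_image i x -> (metric i x)^T = metric i x;
  metric_pos : forall i x, chart_image i x ->
    forall u, u != 0 -> 0 < bil (metric i x) u u;
  metric_compat : forall i j x, overlap i j x ->
    let A := 'J (transition i j) x in
    metric i x = A *m metric j (transition i j x) *m A^T }.

Record almost_complex_structure (R : realType) (n : nat)
    (N : ptopologicalType) (M : smooth_manifold R n N) :=
  AlmostComplexStructure {
  acs :> atlas M -> 'rV[R]_n -> 'M[R]_n;
  acs_smooth : forall i, smooth_on (chart_image i) (acs i);
  acs_sqr : forall i x, chart_image i x -> acs i x *m acs i x = - 1%:M;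
  acs_compat : forall i j x, overlap i j x ->
    let A := 'J (transition i j) x in
    acs i x *m A = A *m acs j (transition i j x) }.

Section Local.
Context {R : realType} {n : nat}.
Local Notation vec := 'rV[R]_n.
Implicit Types (g J O : vec -> 'M[R]_n) (x u v w : vec).
Implicit Types (X Y Z : vec -> vec).

(* Koszul formula for constant vector fields u, v:
   2 h(christoffel u v, w) = D_u h(v, w) + D_v h(u, w) - D_w h(u, v). *)
Definition christoffel g x u v : vec :=
  2^-1 *: (\row_l (bil ('D_u g x) v (delta_mx 0 l)
                   + bil ('D_v g x) u (delta_mx 0 l)
                   - bil ('D_(delta_mx 0 l) g x) u v)) *m invmx (g x).

(* The Levi-Civita connection. *)
Definition nabla g X Y : vec -> vec :=
  fun x => 'D_(X x) Y x + christoffel g x (X x) (Y x).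

Definition lie_bracket X Y : vec -> vec :=
  fun x => 'D_(X x) Y x - 'D_(Y x) X x.

Definition curvature g X Y Z : vec -> vec :=
  fun x => nabla g X (nabla g Y Z) x - nabla g Y (nabla g X Z) x
           - nabla g (lie_bracket X Y) Z x.

(* The curvature is tensorial, so it is evaluated on tangent vectors through
   their constant extensions. *)
Definition curv g x u v w : vec := curvature g (cst u) (cst v) (cst w) x.

(* The rows of [frame B] form an orthonormal basis for B; the traces below do
   not depend on which one is picked. *)
Definition frame (B : 'M[R]_n) : 'M[R]_n :=
  xget 0 [set E : 'M[R]_n | E *m B *m E^T = 1%:M].

Definition ricci g x u v : R :=
  let e i := row i (frame (g x)) in
  \sum_(i < n) bil (g x) (curv g x u (e i) (e i)) v.

Definition scalar_curvature g x : R :=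
  let e i := row i (frame (g x)) in \sum_(i < n) ricci g x (e i) (e i).

Definition star_ricci g J x u v : R :=
  let e i := row i (frame (g x)) in
  \sum_(i < n) bil (g x) (curv g x u (e i) (e i *m J x)) v.

(* Gram matrix of Omega(u, v) = h(J u, v). *)
Definition fundamental_form g J : vec -> 'M[R]_n := fun x => J x *m g x.

Definition star_scalar_curvature g J x : R :=
  let e i := row i (frame (g x)) in
  2 * \sum_(i < n) \sum_(j < n | (i < j)%N)
        star_ricci g J x (e i) (e j)
        * bil (fundamental_form g J x) (e i) (e j).

(* Exterior derivative of the 2-form O and covariant derivative of O, evaluated
   on the constant extensions of u, v, w. *)
Definition ext_deriv O x u v w : R :=
  bil ('D_u O x) v w + bil ('D_v O x) w u + bil ('D_w O x) u v.

Definition nabla_form g O x u v w : R :=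
  bil ('D_u O x) v w - bil (O x) (nabla g (cst u) (cst v) x) w
  - bil (O x) v (nabla g (cst u) (cst w) x).

End Local.

(* The integral over R^m, as an iterated integral; it is only applied to
   nonnegative Borel functions, for which Tonelli's theorem holds. *)
Fixpoint integral_rV {R : realType} (m : nat) :
    ('rV[R]_m -> \bar R) -> \bar R :=
  match m with
  | 0 => fun f => f 0
  | m'.+1 => fun f =>
      (\int[lebesgue_measure]_(t in [set: R])
        integral_rV (fun x : 'rV[R]_m' =>
          f (row_mx (const_mx t : 'rV[R]_1) x)))%E
  end.

Section Global.
Context {R : realType} {n : nat} {N : ptopologicalType}
  {M : smooth_manifold R n N}.
Implicit Types (h : riemannian_metric M) (J : almost_complex_structure M).

Definition orthogonal_acs h J : Prop :=
  forall i x, chart_image i x -> forall u v,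
    bil (h i x) (u *m J i x) (v *m J i x) = bil (h i x) u v.

Definition closed_form (O : atlas M -> 'rV[R]_n -> 'M[R]_n) : Prop :=
  forall i x, chart_image i x -> forall u v w, ext_deriv (O i) x u v w = 0.

Definition parallel_form h (O : atlas M -> 'rV[R]_n -> 'M[R]_n) : Prop :=
  forall i x, chart_image i x -> forall u v w,
    nabla_form (h i) (O i) x u v w = 0.

Definition Omega h J : atlas M -> 'rV[R]_n -> 'M[R]_n :=
  fun i => fundamental_form (h i) (J i).

Definition almost_kahler h J : Prop :=
  orthogonal_acs h J /\ closed_form (Omega h J).

Definition kahler h J : Prop :=
  almost_kahler h J /\ parallel_form h (Omega h J).

Definition einstein h : Prop :=
  exists lambda : R, forall i x, chart_image i x -> forall u v,
    ricci (h i) x u v = lambda * bil (h i x) u v.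

Definition scal h (p : N) : R :=
  let i := chart_at M p in scalar_curvature (h i) (chart i p).

Definition star_scal h J (p : N) : R :=
  let i := chart_at M p in star_scalar_curvature (h i) (J i) (chart i p).

(* This determines mu, since N is covered by countably many charts. *)
Definition riemannian_volume h
    (mu : {measure set (g_sigma_algebraType (@open N)) -> \bar R}) : Prop :=
  forall (i : atlas M) (A : set (g_sigma_algebraType (@open N))),
    measurable A -> A `<=` dom i ->
    mu A = integral_rV (fun x =>
      (Num.sqrt (\det (h i x)) * \1_(chart i @` A) x)%:E).

End Global.

(* Main.v *)
(* Sekigawa's integral formula. On an Einstein almost Kaehler manifold a vector
   field xi, a contraction of the covariant derivative of J with its second
   covariant derivative, satisfies the pointwise identity
     div xi = |Y|^2 + |S|^2 + |P|^2 / 4 + 2 lambda |nabla J|^2,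
   where Y is an alternated component of nabla^2 J, S its trace, and P a
   symmetric tensor whose trace is t = |nabla J|^2. As |P|^2 >= t^2 / n and the
   integral of div xi vanishes, 5 int t^2 + 8 s int t <= 0. Since s^* = s + t/2,
   the Cauchy-Schwarz inequality gives the upper bound on the mean of s^*, and
   t > 0 somewhere, because the manifold is not Kaehler, gives the strict
   inequalities. *)
From HB Require Import structures.
From mathcomp Require Import all_boot all_order all_algebra.
From mathcomp Require Import ring lra.

Set Implicit Arguments.
Unset Strict Implicit.
Unset Printing Implicit Defensive.

Import Order.TTheory GRing.Theory Num.Theory.
Local Open Scope ring_scope.

(** * The pointwise inequality *)

(** The four terms of xi are weighted so that its divergence keeps no term without a sign: the
    weights 1, -2, 1 remove a curvature commutator, and the quartic traces produced by the J-twisted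
    term cancel those left by the terms quadratic in nabla^2 J. The term |S|^2 is not discarded:
    pairing S with J gives |S|^2 >= t^2 / n, so that, multiplied by 4 n, it contributes 4 to the
    coefficient 5 and |P|^2 / 4 contributes 1.

    Three obstacles shape the rest. Identities have to be differentiated before they are evaluated
    at a point, so they are proved in a commutative ring with commuting derivations, and
    orthonormality is imposed at one point only, by a constant change of basis. Smoothness is given
    by iterated partial derivatives, so differentiability and the symmetry of second derivatives
    must be derived from it. The volume is known only on sets inside a chart, as an iterated
    integral of an indicator, so integrals of continuous functions are recovered from their
    superlevel sets. *)

HB.lock Definition ip {K : realFieldType} {n : nat} (A B : 'M[K]_n) : K :=
  - \tr (A *m B).

Section Frobenius.
Context {K : realFieldType} {n : nat}.
Implicit Types A B C D : 'M[K]_n.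

Lemma ipE A B : ip A B = - \tr (A *m B). Proof. by rewrite ip.unlock. Qed.
Lemma ipC A B : ip A B = ip B A. Proof. by rewrite ip.unlock mxtrace_mulC. Qed.
Lemma ipDl A B C : ip (A + B) C = ip A C + ip B C.
Proof. by rewrite ip.unlock mulmxDl mxtraceD opprD. Qed.
Lemma ipDr A B C : ip A (B + C) = ip A B + ip A C.
Proof. by rewrite ipC ipDl !(ipC A). Qed.
Lemma ipZl c A B : ip (c *: A) B = c * ip A B.
Proof. by rewrite ip.unlock -scalemxAl mxtraceZ mulrN. Qed.
Lemma ipZr c A B : ip A (c *: B) = c * ip A B.
Proof. by rewrite ipC ipZl ipC. Qed.
Lemma ipNl A B : ip (- A) B = - ip A B.
Proof. by rewrite -scaleN1r ipZl mulN1r. Qed.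
Lemma ipNr A B : ip A (- B) = - ip A B.
Proof. by rewrite ipC ipNl ipC. Qed.
Lemma ip_sumr I r (P : pred I) A (f : I -> 'M[K]_n) :
  ip A (\sum_(i <- r | P i) f i) = \sum_(i <- r | P i) ip A (f i).
Proof. by rewrite ip.unlock mulmx_sumr (raddf_sum mxtrace) sumrN. Qed.
Lemma ip_suml I r (P : pred I) A (f : I -> 'M[K]_n) :
  ip (\sum_(i <- r | P i) f i) A = \sum_(i <- r | P i) ip (f i) A.
Proof. by rewrite ipC ip_sumr; apply: eq_bigr => i _; rewrite ipC. Qed.

(** On skew matrices the minus sign in [ip] compensates the missing transposition, and [ip] is the
    Frobenius inner product; elsewhere it is only a symmetric bilinear form. *)
Lemma ip_skew A : A^T = - A -> ip A A = \sum_i \sum_j A i j ^+ 2.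
Proof.
move=> sA; rewrite ip.unlock /mxtrace -sumrN; apply: eq_bigr => i _.
rewrite mxE -sumrN; apply: eq_bigr => j _.
have : A^T i j = (- A) i j by rewrite sA.
by rewrite !mxE => ->; ring.
Qed.

Lemma ip_ge0 A : A^T = - A -> 0 <= ip A A.
Proof.
move=> /ip_skew ->; apply: sumr_ge0 => i _.
by apply: sumr_ge0 => j _; exact: sqr_ge0.
Qed.

(** Conjugation by J preserves the trace but reverses the sign of a product of a commuting and an
    anticommuting matrix. *)
Lemma ip_comm_anti J A B : J *m J = - 1%:M -> J *m A = A *m J ->
  J *m B = - (B *m J) -> ip A B = 0.
Proof.
move=> JJ JA JB; suff : \tr (A *m B) = - \tr (A *m B) by rewrite ip.unlock; lra.
have e : \tr (A *m B) = - \tr (A *m B *m J *m J).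
  by rewrite -!mulmxA JJ !mulmxN mulmx1 linearN opprK.
rewrite {1}e mxtrace_mulC !mulmxA JA -(mulmxA A) JB.
by rewrite mulmxN mulNmx -!mulmxA JJ !mulmxN mulmx1 !linearN opprK.
Qed.

Lemma ip_anti_comm J A B : J *m J = - 1%:M -> J *m A = - (A *m J) ->
  J *m B = B *m J -> ip A B = 0.
Proof. by move=> JJ JA JB; rewrite ipC; exact: ip_comm_anti JB JA. Qed.

Lemma ipJJ J A B : J *m J = - 1%:M -> J *m A = - (A *m J) ->
  ip (J *m A) (J *m B) = ip A B.
Proof.
move=> JJ JA; rewrite ip.unlock JA mulNmx -mulmxA (mulmxA J J) JJ.
by rewrite mulNmx mul1mx mulmxN opprK.
Qed.

End Frobenius.

Lemma mx_expand {K : pzRingType} {n : nat} (A B : 'M[K]_n) i j :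
  (A *m B) i j = \sum_k A i k * B k j.
Proof. by rewrite mxE. Qed.

Lemma sum_pick {K : pzRingType} {V : lmodType K} {n : nat} (f : 'I_n -> V) i :
  \sum_j (i == j)%:R *: f j = f i.
Proof.
rewrite (bigD1 i) //= eqxx scale1r big1 ?addr0 // => j /negbTE.
by rewrite eq_sym => ->; rewrite scale0r.
Qed.

Lemma sum_pickM {K : pzRingType} {n : nat} (f : 'I_n -> K) i :
  \sum_j (i == j)%:R * f j = f i.
Proof. exact: (@sum_pick K K^o). Qed.

(** * Sekigawa's identity at a point, in an orthonormal frame *)

Section Pointwise.
Context {K : realFieldType} {n : nat}.
(** With matrices acting on row vectors from the right, [T a], [H a b] and [X c a b] stand for the
    first three covariant derivatives of J, [R a b] for the curvature endomorphism and [DR] for its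
    covariant derivative. Treating them as matrices related only by the identities below makes the
    pointwise formula finite linear algebra. *)
Variables (J : 'M[K]_n) (T : 'I_n -> 'M[K]_n) (H R : 'I_n -> 'I_n -> 'M[K]_n).
Variables (X DR : 'I_n -> 'I_n -> 'I_n -> 'M[K]_n) (lam : K).
Hypothesis JT : J^T = - J.
Hypothesis JJ : J *m J = - 1%:M.
Hypothesis TT : forall a, (T a)^T = - T a.
Hypothesis TJ : forall a, J *m T a = - (T a *m J).
(** [Tcyc] says that Omega is closed, and [Tq] that differentiating J along J e_b amounts to
    applying J and then [T b]. [Hcyc], [HJ], [Hq] and [Htr] are derivatives of first-order
    identities; [HR] and [XX] are Ricci identities, and [XH] is the derivative of [HR]. *)
Hypothesis Tcyc : forall a b c, T a b c + T b c a + T c a b = 0.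
Hypothesis Tq : forall b, \sum_c J b c *: T c = J *m T b.
Hypothesis HT : forall a b, (H a b)^T = - H a b.
Hypothesis Hcyc : forall a b c e, H a b c e + H a c e b + H a e b c = 0.
Hypothesis HJ : forall a b,
  J *m H a b + H a b *m J = - (T a *m T b + T b *m T a).
Hypothesis Hq : forall a b, \sum_c T a b c *: T c + \sum_c J b c *: H a c
  = T a *m T b + J *m H a b.
Hypothesis Htr : forall a k, \sum_i H a i k i = 0.
Hypothesis HR : forall a b, H a b - H b a = J *m R a b - R a b *m J.
Hypothesis RA : forall a b, R a b = - R b a.
Hypothesis RT : forall a b, (R a b)^T = - R a b.
Hypothesis Rbian : forall a b c e, R a b c e + R b c a e + R c a b e = 0.
Hypothesis Rpair : forall a b c e, R a b c e = R c e a b.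
Hypothesis Ein : forall u v, \sum_k R k u v k = (u == v)%:R * lam.
Hypothesis XH : forall c a b, X c a b - X c b a
  = J *m DR c a b - DR c a b *m J + (T c *m R a b - R a b *m T c).
Hypothesis XX : forall c a b, X c a b - X a c b
  = T b *m R c a - R c a *m T b - \sum_e R c a b e *: T e.
Hypothesis DRdiv : forall b, \sum_a DR a a b = 0.

Let skE (A : 'M[K]_n) i j : A^T = - A -> A i j = - A j i.
Proof. by move=> /matrixP/(_ j i); rewrite !mxE. Qed.

(** [S] is the rough Laplacian of J. [P] and [N] are the two quadratic contractions of T: over both
    endomorphism indices, and over the derivative index and one endomorphism index. *)
Let t := \sum_a ip (T a) (T a).
Let S := \sum_a H a a.
Let P := \matrix_(a, b) ip (T a) (T b).
Let N := - \sum_a T a *m T a.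

Let C := \sum_a \sum_b ip (T b) (T a *m R a b - R a b *m T a).

Let ric b e : \sum_a R a b a e = - ((b == e)%:R * lam).
Proof. by rewrite -Ein -sumrN; apply: eq_bigr => a _; rewrite skE // RT. Qed.

(** Exchanging the last two indices of X costs the commutator [C] and a divergence of the curvature,
    which vanishes; exchanging the first two costs [C] again and a Ricci term. The weights 1, -2, 1
    cancel [C] and leave the Ricci term. *)
Lemma third_order_sum :
  \sum_a \sum_b (ip (T b) (X a a b) - 2 * ip (T b) (X a b a)
                   + ip (T a) (X a b b)) = - lam * t.
Proof.
have e1 : \sum_a \sum_b ip (T b) (X a a b)
        = \sum_a \sum_b ip (T b) (X a b a) + C.
  rewrite /C exchange_big [X in _ = X + _]exchange_big.
  rewrite [X in _ = _ + X]exchange_big -big_split /=; apply: eq_bigr => b _.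
  rewrite -big_split /=.
  (* The vanishing divergence of the curvature is inserted so that [XH] can be applied term by
     term. *)
  have z : 0 = ip (T b) (J *m (\sum_a DR a a b) - (\sum_a DR a a b) *m J).
    by rewrite DRdiv mulmx0 mul0mx subr0 ip.unlock mulmx0 mxtrace0 oppr0.
  rewrite -[RHS]addr0 [X in _ = _ + X]z mulmx_sumr mulmx_suml -sumrB.
  rewrite ip_sumr -big_split /=.
  apply: eq_bigr => a _; rewrite -addrA -!ipDr; congr ip.
  by rewrite -[X a a b](subrK (X a b a)) XH addrC (addrC (_ - _)).
have e2 : \sum_a \sum_b ip (T b) (X a b a)
        = \sum_a \sum_b ip (T a) (X a b b) + C + lam * t.
  have -> : lam * t = - \sum_a \sum_b ip (T b) (\sum_e R a b a e *: T e).
    rewrite exchange_big /= -sumrN mulr_sumr; apply: eq_bigr => b _.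
    rewrite -ip_sumr exchange_big /=.
    have -> : \sum_e \sum_a R a b a e *: T e = - lam *: T b.
      under eq_bigr => e _ do rewrite -scaler_suml ric -mulrN -scalerA.
      exact: sum_pick.
    by rewrite ipZr mulNr opprK.
  rewrite [X in X + _ + _]exchange_big /= -sumrN -!big_split /=.
  apply: eq_bigr => a _; rewrite -sumrN -!big_split /=; apply: eq_bigr => b _.
  by rewrite -ipNr -!ipDr -addrA -XX addrC subrK.
rewrite (eq_bigr (fun a => \sum_b ip (T b) (X a a b)
    - 2 * (\sum_b ip (T b) (X a b a)) + \sum_b ip (T a) (X a b b))); last first.
  by move=> a _; rewrite mulr_sumr -sumrB -big_split.
rewrite big_split /= sumrB -mulr_sumr e1 e2; ring.
Qed.

(** The Weitzenboeck formula for the closed and coclosed form Omega. The cyclic identity of H writes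
    S through traces with exchanged indices, which [HR] turns into curvature; the first Bianchi
    identity and the pair symmetry then assemble the terms that are not Ricci contractions. *)
Lemma weitzenbock : \sum_a \sum_e J a e *: R a e = S - (2 * lam) *: J.
Proof.
(* Subtracting the vanishing trace [Htr] leaves the commutator of J with [R i j], one half of which
   is a Ricci contraction. *)
have e1 j k : \sum_i H i j k i = lam * J k j - \sum_i \sum_l R i j k l * J l i.
  transitivity (\sum_i (J *m R i j - R i j *m J) k i).
    rewrite -[LHS]subr0 -[X in _ - X](Htr j k) -sumrB; apply: eq_bigr => i _.
    by rewrite -HR !mxE.
  under eq_bigr do rewrite !mxE.
  rewrite sumrB; congr (_ - _); rewrite exchange_big /=.
  under eq_bigr do rewrite -mulr_sumr Ein.
  under eq_bigr => i _ do rewrite mulrCA.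
  by rewrite sum_pickM mulrC.
apply/matrixP => j k; rewrite !mxE !summxE.
have -> : \sum_a (H a a) j k = - (\sum_i H i j k i) + \sum_i H i k j i.
  rewrite -sumrN -big_split /=; apply: eq_bigr => i _.
  have := Hcyc i i j k; have := skE k j (HT i i); have := skE i j (HT i k).
  lra.
rewrite !e1 (skE k j JT).
under eq_bigr do rewrite summxE.
suff -> : \sum_i \sum_l (J i l *: R i l) j k =
  \sum_i \sum_l R i j k l * J l i - \sum_i \sum_l R i k j l * J l i by ring.
rewrite -sumrB; apply: eq_bigr => i _; rewrite -sumrB; apply: eq_bigr => l _.
rewrite !mxE (skE l i JT).
have -> : R i l j k = R j k i l by rewrite Rpair.
have := Rbian i j k l; rewrite (RA k i) mxE => h.
have -> : R i j k l = R i k j l - R j k i l by lra.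
ring.
Qed.

(** J is skew, so contracting it with the first two indices of X retains half of their commutator.
    [XX] makes this a J-contraction of the curvature, to which [weitzenbock] applies. *)
Lemma twist_sum : \sum_a \sum_b \sum_e J a e * ip (J *m T b) (X a e b)
  = 2^-1 * \sum_b ip (J *m T b) (T b *m (S - (2 * lam) *: J)
      - (S - (2 * lam) *: J) *m T b - \sum_e (S - (2 * lam) *: J) b e *: T e).
Proof.
rewrite exchange_big mulr_sumr /=; apply: eq_bigr => b _.
rewrite -weitzenbock.
have e1 : \sum_a \sum_e J a e * ip (J *m T b) (X a e b)
   = - \sum_a \sum_e J a e * ip (J *m T b) (X e a b).
  rewrite [in RHS]exchange_big -sumrN; apply: eq_bigr => a _; rewrite -sumrN.
  by apply: eq_bigr => e _; rewrite (skE a e JT) mulNr.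
set L := LHS.
have -> : L = 2^-1 * (L + - \sum_a \sum_e J a e * ip (J *m T b) (X e a b)).
  by rewrite -e1 -/L; lra.
congr (_ * _); rewrite /L -sumrB.
rewrite !mulmx_sumr !mulmx_suml.
transitivity (\sum_a \sum_e J a e * ip (J *m T b) (X a e b - X e a b)).
  by apply: eq_bigr => a _; rewrite -sumrB; apply: eq_bigr => e _; rewrite ipDr ipNr mulrBr.
rewrite !ipDr !ipNr !ip_sumr.
have -> : \sum_e ip (J *m T b) ((\sum_a \sum_i J a i *: R a i) b e *: T e) =
  \sum_a \sum_i J a i * ip (J *m T b) (\sum_e R a i b e *: T e).
  transitivity (\sum_e \sum_a \sum_i J a i * ip (J *m T b) (R a i b e *: T e)).
    apply: eq_bigr => e _; rewrite ipZr summxE mulr_suml.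
    apply: eq_bigr => a _; rewrite summxE mulr_suml; apply: eq_bigr => i _.
    by rewrite !mxE ipZr mulrA.
  rewrite exchange_big; apply: eq_bigr => a _ /=; rewrite exchange_big.
  by apply: eq_bigr => i _ /=; rewrite ip_sumr mulr_sumr.
rewrite -!sumrB; apply: eq_bigr => a _.
rewrite mulmx_sumr mulmx_suml !ip_sumr -!sumrB; apply: eq_bigr => i _.
by rewrite -scalemxAr -scalemxAl !ipZr -!mulrBr XX !ipDr !ipNr.
Qed.

(** J acting on the index of a family. It commutes with J acting on the matrices, and the relative
    sign of these two complex structures is used to split nabla^2 J. *)
Definition jf (A : 'I_n -> 'M[K]_n) a := \sum_c J a c *: A c.

Lemma jfD A B a : jf (fun c => A c + B c) a = jf A a + jf B a.
Proof. by rewrite -big_split; apply: eq_bigr => c _; rewrite scalerDr. Qed.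

Lemma jfZ k A a : jf (fun c => k *: A c) a = k *: jf A a.
Proof. by rewrite scaler_sumr; apply: eq_bigr => c _; rewrite !scalerA mulrC. Qed.

Lemma jfN A a : jf (fun c => - A c) a = - jf A a.
Proof. by rewrite -sumrN; apply: eq_bigr => c _; rewrite scalerN. Qed.

Lemma jfMl M A a : jf (fun c => M *m A c) a = M *m jf A a.
Proof. by rewrite mulmx_sumr; apply: eq_bigr => c _; rewrite scalemxAr. Qed.

Lemma eq_jf A B a : A =1 B -> jf A a = jf B a.
Proof. by move=> AB; apply: eq_bigr => c _; rewrite AB. Qed.

Lemma jfK A a : jf (jf A) a = - A a.
Proof.
rewrite /jf; under eq_bigr do rewrite scaler_sumr.
rewrite exchange_big /= -[A a in RHS](@sum_pick K _ n A a) -sumrN; apply: eq_bigr => c _.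
under eq_bigr do rewrite scalerA.
rewrite -scaler_suml -mx_expand JJ !mxE -scaleNr.
by rewrite (eq_sym a).
Qed.

Lemma ip_jf A B : \sum_a ip (jf A a) (B a) = - \sum_a ip (A a) (jf B a).
Proof.
under eq_bigr do rewrite ip_suml.
under [in RHS]eq_bigr do rewrite ip_sumr.
rewrite exchange_big -sumrN; apply: eq_bigr => a _ /=; rewrite -sumrN.
by apply: eq_bigr => c _; rewrite ipZl ipZr (skE a c JT) mulNr opprK.
Qed.

Lemma ip_jf_iso A B : \sum_a ip (jf A a) (jf B a) = \sum_a ip (A a) (B a).
Proof.
by rewrite ip_jf -sumrN; apply: eq_bigr => a _; rewrite jfK ipNr opprK.
Qed.

(** The part of H that commutes with J. By [HJ] it is determined by T, so that only the
    anticommuting part [Hs] involves genuine second derivatives. *)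
Definition Hp a b := 2^-1 *: (J *m (T a *m T b + T b *m T a)).
Definition Hs a b := H a b - Hp a b.
(** The derivative of J along the image of e_b under [T a]. It is the error by which [Hs] fails to
    inherit, in its second index, the identity [Tq]. *)
Definition Q a b := \sum_c T a b c *: T c.

Let JTT a b : J *m (T a *m T b) = T a *m T b *m J.
Proof. by rewrite mulmxA TJ mulNmx -(mulmxA _ J) TJ mulmxN opprK mulmxA. Qed.

Let half_half (M : 'M[K]_n) : 2^-1 *: M + 2^-1 *: M = M.
Proof. by rewrite -scalerDl (_ : _ + _ = 1) ?scale1r //; lra. Qed.

Lemma HpC a b : Hp a b = Hp b a.
Proof. by rewrite /Hp addrC. Qed.

Let JHpE a b : J *m Hp a b = - (2^-1 *: (T a *m T b + T b *m T a)).
Proof. by rewrite /Hp -scalemxAr mulmxA JJ mulNmx mul1mx scalerN. Qed.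

Lemma JHp a b : J *m Hp a b = Hp a b *m J.
Proof.
rewrite /Hp -scalemxAr -scalemxAl; congr (_ *: _).
by rewrite -[RHS]mulmxA mulmxDl -!JTT -mulmxDr.
Qed.

Lemma JHs a b : J *m Hs a b = - (Hs a b *m J).
Proof.
rewrite /Hs mulmxBr mulmxBl -JHp JHpE; apply/matrixP => i j.
by move/matrixP/(_ i j): (HJ a b); rewrite !(mxE, opprK); lra.
Qed.

Lemma HpT a b : (Hp a b)^T = - Hp a b.
Proof.
rewrite {1}/Hp linearZ /= trmx_mul linearD /= !trmx_mul !TT JT.
rewrite !(mulmxN, mulNmx, opprK) scalerN; congr (- (_ *: _)).
by rewrite addrC mulmxDl -!JTT -mulmxDr.
Qed.

Lemma HsT a b : (Hs a b)^T = - Hs a b.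
Proof. by rewrite /Hs linearB /= HpT HT opprB opprK addrC. Qed.

Let JJl (M : 'M[K]_n) : J *m (J *m M) = - M.
Proof. by rewrite mulmxA JJ mulNmx mul1mx. Qed.

Lemma jf_Hp a b : jf (Hp^~ b) a = - (2^-1 *: (T a *m T b - T b *m T a)).
Proof.
rewrite /Hp jfZ jfMl jfD -scalerN; congr (_ *: _).
have -> : jf (fun c => T c *m T b) a = J *m T a *m T b.
  by rewrite -Tq mulmx_suml; apply: eq_bigr => c _; rewrite scalemxAl.
rewrite jfMl [jf T a]Tq mulmxDr -(mulmxA J) JJl (mulmxA J (T b)) TJ mulNmx.
by rewrite -mulmxA JJl mulmxN opprK opprB addrC.
Qed.

(** In [Hq] the contributions of [Hp] cancel against [T a *m T b], leaving a relation between
    anticommuting matrices only. *)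
Lemma jf_Hs a b : jf (Hs a) b = J *m Hs a b - Q a b.
Proof.
have e : jf (Hp a) b = 2^-1 *: (T a *m T b - T b *m T a).
  rewrite (eq_jf (B := Hp^~ a)) => [|c]; last by rewrite HpC.
  by rewrite jf_Hp -scalerN opprB.
rewrite /Hs jfD jfN e; have := Hq a b; rewrite -/(jf (H a) b) -/(Q a b) => h.
rewrite mulmxBr JHpE; apply/matrixP => i j.
by move/matrixP/(_ i j): h; rewrite !mxE; lra.
Qed.

(** By [Tq], J on the index a becomes J on the matrix [T a]; anticommutation carries it to the
    contracted index, where [Tq] applies a second time to the last factor. The minus sign is that of
    the anticommutation. *)
Lemma jf_Q a b : jf (Q^~ b) a = - (J *m Q a b).
Proof.
transitivity (\sum_e (J *m T a) b e *: T e).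
  rewrite /jf /Q; under eq_bigr do rewrite scaler_sumr.
  rewrite exchange_big; apply: eq_bigr => e _ /=.
  rewrite -Tq summxE scaler_suml; apply: eq_bigr => c _.
  by rewrite scalerA !mxE.
rewrite TJ mulmx_sumr -sumrN.
transitivity (- \sum_e \sum_f (T a b f * J f e) *: T e).
  by rewrite -sumrN; apply: eq_bigr => e _; rewrite -scaler_suml !mxE scaleNr.
rewrite exchange_big -sumrN; apply: eq_bigr => f _ /=; congr (- _).
rewrite -scalemxAr -Tq scaler_sumr; apply: eq_bigr => e _; exact/esym/scalerA.
Qed.

Let HpE a b : Hp a b = 2^-1 *: (J *m (T a *m T b + T b *m T a)).
Proof. by []. Qed.

Let HsD a b : Hs a b = H a b - Hp a b.
Proof. by []. Qed.

Let QE a b : Q a b = \sum_c T a b c *: T c.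
Proof. by []. Qed.

Local Opaque Hp Hs Q.

(** [Y] and [B] are the components of [Hs] on which J acting on the first index agrees with,
    respectively is opposite to, J acting on the matrices. In the second index both follow the sign
    of [Y], up to the error [Q] for [B]. *)
Definition Y a b := 2^-1 *: (Hs a b - J *m jf (Hs^~ b) a).
Definition B a b := Hs a b - Y a b.

Let Jcl (A : 'I_n -> 'M[K]_n) a : (forall c, J *m A c = - (A c *m J)) ->
  J *m jf A a = - (jf A a *m J).
Proof.
move=> JA; rewrite -jfMl /jf mulmx_suml -sumrN; apply: eq_bigr => c _.
by rewrite JA scalerN scalemxAl.
Qed.

Lemma JY a b : J *m Y a b = - (Y a b *m J).
Proof.
rewrite /Y -scalemxAr -scalemxAl mulmxBr mulmxBl JHs.
rewrite {1}Jcl => [|c]; last exact: JHs.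
by rewrite mulmxN opprK mulmxA -scalerN opprB addrC.
Qed.

Lemma YT a b : (Y a b)^T = - Y a b.
Proof.
rewrite /Y linearZ linearB /= HsT trmx_mul JT mulmxN.
have -> : (jf (Hs^~ b) a)^T = - jf (Hs^~ b) a.
  by rewrite /jf linear_sum -sumrN; apply: eq_bigr => c _; rewrite linearZ /= HsT scalerN.
rewrite mulNmx !opprK Jcl => [|c]; last exact: JHs.
by rewrite opprK -[RHS]scalerN [X in _ = _ *: X]opprD.
Qed.

Lemma jf_Y1 a b : jf (Y^~ b) a = J *m Y a b.
Proof.
rewrite /Y jfZ -scalemxAr; congr (_ *: _); rewrite jfD jfN jfMl jfK mulmxBr JJl.
by rewrite mulmxN !opprK addrC.
Qed.

Lemma jf_B1 a b : jf (B^~ b) a = - (J *m B a b).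
Proof.
rewrite /B jfD jfN jf_Y1 mulmxBr opprB.
have e : J *m Y a b + J *m Y a b = J *m Hs a b + jf (Hs^~ b) a.
  by rewrite /Y -scalemxAr half_half mulmxBr JJl opprK.
by apply/eqP; rewrite -subr_eq0 opprB addrA; apply/eqP/matrixP=> i j; move/matrixP/(_ i j): e; rewrite !mxE; lra.
Qed.

Lemma jf_jf A a b : jf (fun c => jf (A^~ c) a) b = jf (fun c => jf (A c) b) a.
Proof.
rewrite /jf; under eq_bigr do rewrite scaler_sumr.
under [RHS]eq_bigr do rewrite scaler_sumr.
rewrite exchange_big; apply: eq_bigr => c _; apply: eq_bigr => e _ /=.
by rewrite !scalerA mulrC.
Qed.

Let HsE a b : Hs a b = Y a b + B a b.
Proof. by rewrite /B addrC subrK. Qed.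

(** The actions of J on the two indices commute, so [jf_Hs] applies inside; the two errors in [Q]
    cancel because of [jf_Q]. *)
Lemma jf_Y2 a b : jf (Y a) b = J *m Y a b.
Proof.
rewrite /Y jfZ -scalemxAr; congr (_ *: _); rewrite jfD jfN jfMl jf_Hs jf_jf.
rewrite (eq_jf (B := fun c => J *m Hs c b - Q c b)) => [|c]; last exact: jf_Hs.
rewrite jfD jfMl jfN jf_Q opprK [X in _ - X = _]mulmxDr !JJl [RHS]mulmxBr JJl !opprK.
by rewrite opprD !opprK addrACA addNr addr0.
Qed.

Lemma jf_B2 a b : jf (B a) b = J *m B a b - Q a b.
Proof. by rewrite /B jfD jfN jf_Y2 jf_Hs (mulmxBr J (Hs a b)) addrAC. Qed.

Lemma JB a b : J *m B a b = - (B a b *m J).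
Proof. by rewrite /B mulmxBr mulmxBl JY JHs opprB opprK addrC. Qed.

Lemma JQ a b : J *m Q a b = - (Q a b *m J).
Proof.
rewrite QE mulmx_sumr mulmx_suml -sumrN; apply: eq_bigr => c _.
by rewrite -scalemxAr -scalemxAl TJ scalerN.
Qed.

Local Opaque Y B.

(** The action of J on an index is an isometry. Comparing it with the action on the matrices shows
    that B is orthogonal to Y and to Y with exchanged indices, and that the pairing of B with its
    exchange is a quarter of that of Q; the factor -2 turns 1/4 into -1/2. The norm of B drops out,
    its first index having the opposite sign. *)
Lemma sum_ip_HsHs : \sum_a \sum_b (ip (Hs a b) (Hs a b)
    + ip (J *m Hs a b) (jf (Hs^~ b) a) - 2 * ip (Hs a b) (Hs b a))
  = \sum_a \sum_b ip (Y a b - Y b a) (Y a b - Y b a)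
    - 2^-1 * \sum_a \sum_b ip (Q a b) (Q b a).
Proof.
move: jf_Y1 jf_B1 jf_Y2 jf_B2 jf_Q JY JB JQ JHs HsE.
generalize Y B Q Hs => Y B Q Hs.
move=> jf_Y1 jf_B1 jf_Y2 jf_B2 jf_Q JY JB JQ JHs HsYB.
have BY b : \sum_a ip (B a b) (Y a b) = 0.
  have := ip_jf_iso (B^~ b) (Y^~ b).
  under eq_bigr do rewrite jf_B1 jf_Y1 ipNl ipJJ // ?JB //.
  by rewrite sumrN; lra.
have BYt b : \sum_a ip (B a b) (Y b a) = 0.
  have := ip_jf_iso (B^~ b) (Y b).
  under eq_bigr do rewrite jf_B1 jf_Y2 ipNl ipJJ // ?JB //.
  by rewrite sumrN; lra.
(* The isometry is applied to the index a, which is the first index of [B a b] and the second of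
   [B b a]: the two signs are opposite, and [Q] enters through the second. *)
have e1 : \sum_a \sum_b ip (B a b) (B b a)
    = - \sum_a \sum_b ip (B a b) (B b a) + \sum_a \sum_b ip (J *m B a b) (Q b a).
  rewrite exchange_big [X in _ + X]exchange_big -sumrN -big_split; apply: eq_bigr => b _ /=.
  have p a : ip (jf (B^~ b) a) (jf (B b) a)
      = - ip (B a b) (B b a) + ip (J *m B a b) (Q b a).
    by rewrite jf_B1 jf_B2 ipNl ipDr ipNr (ipJJ _ JJ (JB a b)); ring.
  have := ip_jf_iso (B^~ b) (B b); rewrite (eq_bigr _ (fun a _ => p a)).
  by rewrite big_split sumrN /= => ->.
have e2 : \sum_a \sum_b ip (J *m B a b) (Q b a)
    = - \sum_a \sum_b ip (J *m B a b) (Q b a) + \sum_a \sum_b ip (Q a b) (Q b a).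
  rewrite -sumrN -big_split; apply: eq_bigr => a _ /=.
  have p b : ip (jf (fun b => J *m B a b) b) (jf (Q^~ a) b)
      = - ip (J *m B a b) (Q b a) + ip (Q a b) (Q b a).
    rewrite jfMl jf_B2 jf_Q ipNr ipC (ipJJ _ JJ (JQ b a)) ipDr ipNr.
    by rewrite (ipC (Q b a)) (ipC (Q b a)); ring.
  have := ip_jf_iso (fun b => J *m B a b) (Q^~ a).
  rewrite (eq_bigr _ (fun b _ => p b)).
  by rewrite big_split sumrN /= => ->.
have e3 : \sum_a \sum_b ip (Hs a b) (Hs b a)
    = \sum_a \sum_b ip (Y a b) (Y b a) + \sum_a \sum_b ip (B a b) (B b a).
  transitivity (\sum_a \sum_b (ip (Y a b) (Y b a) + ip (B a b) (B b a)
     + (ip (B a b) (Y b a) + ip (B b a) (Y a b)))).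
    apply: eq_bigr => a _; apply: eq_bigr => b _.
    by rewrite !HsYB !ipDl !ipDr (ipC (Y a b) (B b a)); ring.
  under eq_bigr do rewrite !big_split /= BYt addr0.
  rewrite !big_split /= [X in _ + X](_ : _ = 0) ?addr0 //.
  by rewrite exchange_big big1.
have e4 : \sum_a \sum_b (ip (Hs a b) (Hs a b) + ip (J *m Hs a b) (jf (Hs^~ b) a))
    = 2 * \sum_a \sum_b ip (Y a b) (Y a b).
  transitivity (\sum_a \sum_b (2 * ip (Y a b) (Y a b) + 2 * ip (B a b) (Y a b))).
    apply: eq_bigr => a _; apply: eq_bigr => b _.
    rewrite (eq_jf (B := fun c => Y c b + B c b)) => [|c]; last exact: HsYB.
    rewrite jfD jf_Y1 jf_B1 ipDr ipNr !ipJJ ?JHs // !HsYB !ipDl !ipDr.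
    by rewrite (ipC (B a b) (Y a b)); ring.
  rewrite exchange_big mulr_sumr [RHS](eq_bigr (fun a => \sum_b 2 * ip (Y a b) (Y a b))).
    rewrite [RHS]exchange_big; apply: eq_bigr => b _ /=.
    by rewrite big_split /= -[X in _ + X]mulr_sumr BY mulr0 addr0.
  by move=> a _; rewrite mulr_sumr.
have e5 : \sum_a \sum_b ip (Y a b - Y b a) (Y a b - Y b a) =
   2 * \sum_a \sum_b ip (Y a b) (Y a b) - 2 * \sum_a \sum_b ip (Y a b) (Y b a).
  transitivity (\sum_a \sum_b (ip (Y a b) (Y a b) - 2 * ip (Y a b) (Y b a)) +
                \sum_a \sum_b ip (Y b a) (Y b a)).
    rewrite -big_split; apply: eq_bigr => a _; rewrite -big_split /=.
    apply: eq_bigr => b _; rewrite !ipDl !ipDr !ipNl !ipNr (ipC (Y b a) (Y a b)).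
    ring.
  rewrite [X in _ + X]exchange_big mulr_sumr mulr_sumr -big_split -sumrB.
  apply: eq_bigr => a _ /=; rewrite sumrB -mulr_sumr; ring.
transitivity (\sum_a \sum_b (ip (Hs a b) (Hs a b) + ip (J *m Hs a b) (jf (Hs^~ b) a))
   - 2 * \sum_a \sum_b ip (Hs a b) (Hs b a)).
  by rewrite mulr_sumr -sumrB; apply: eq_bigr => a _; rewrite mulr_sumr -sumrB.
rewrite e3 e4 e5; lra.
Qed.

Let NE c e : N c e = \sum_a \sum_b T a b c * T a b e.
Proof.
rewrite /N !mxE summxE -sumrN; apply: eq_bigr => a _; rewrite mxE -sumrN.
by apply: eq_bigr => b _; rewrite (skE c b (TT a)) mulNr opprK.
Qed.

Let PE c e : P c e = \sum_a \sum_b T c a b * T e a b.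
Proof.
rewrite !mxE ip.unlock /mxtrace -sumrN; apply: eq_bigr => a _; rewrite mxE -sumrN.
by apply: eq_bigr => b _; rewrite (skE b a (TT e)) mulrN opprK.
Qed.

Let PT : P^T = P. Proof. by apply/matrixP => a b; rewrite !mxE ipC. Qed.

(** The cyclic identity replaces T_{bae} by T_{abe} + T_{eab}. The first term gives N; against the
    second only the part of T_{abc} skew in a and b counts, which by the cyclic identity again is
    -T_{cab} / 2. *)
Let sumTT c e : \sum_a \sum_b T a b c * T b a e = N c e - 2^-1 * P c e.
Proof.
have h : \sum_a \sum_b T a b c * T e a b = - (2^-1 * P c e).
  have h2 : \sum_a \sum_b T a b c * T e a b = - \sum_a \sum_b T b a c * T e a b.
    rewrite exchange_big -sumrN; apply: eq_bigr => a _; rewrite -sumrN.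
    by apply: eq_bigr => b _ /=; rewrite (skE b a (TT e)) mulrN.
  suff : \sum_a \sum_b T a b c * T e a b - \sum_a \sum_b T b a c * T e a b = - P c e.
    by move: h2; lra.
  rewrite -sumrB PE -sumrN; apply: eq_bigr => a _; rewrite -sumrB -sumrN.
  apply: eq_bigr => b _; rewrite -mulrBl -mulNr; congr (_ * _).
  by have := Tcyc a b c; rewrite (skE c a (TT b)); lra.
rewrite NE -h -big_split; apply: eq_bigr => a _; rewrite -big_split /=.
apply: eq_bigr => b _; rewrite -mulrDr; congr (_ * _).
by have := Tcyc b a e; rewrite (skE e b (TT a)) (skE b a (TT e)); lra.
Qed.

Lemma sum_ip_QQ : \sum_a \sum_b ip (Q a b) (Q b a)
  = \tr (N *m P) - 2^-1 * \tr (P *m P).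
Proof.
transitivity (\sum_c \sum_e (N c e - 2^-1 * P c e) * P e c); last first.
  rewrite /mxtrace mulr_sumr -sumrB; apply: eq_bigr => c _; rewrite !mx_expand.
  by rewrite mulr_sumr -sumrB; apply: eq_bigr => e _; ring.
transitivity (\sum_a \sum_b \sum_c \sum_e T a b c * T b a e * P e c).
  apply: eq_bigr => a _; apply: eq_bigr => b _; rewrite !QE ip_suml.
  apply: eq_bigr => c _; rewrite ip_sumr; apply: eq_bigr => e _.
  by rewrite ipZl ipZr mxE ipC mulrA.
under eq_bigr do rewrite exchange_big /=.
rewrite exchange_big; apply: eq_bigr => c _ /=.
under eq_bigr do rewrite exchange_big /=.
rewrite exchange_big; apply: eq_bigr => e _ /=.
rewrite -sumTT mulr_suml; apply: eq_bigr => a _.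
by rewrite mulr_suml.
Qed.

Let trN : \tr N = t.
Proof.
rewrite /N /t linearN /= (raddf_sum mxtrace) -sumrN; apply: eq_bigr => a _.
by rewrite ip.unlock.
Qed.

Let trP : \tr P = t.
Proof. by apply: eq_bigr => a _; rewrite mxE. Qed.

Let JN : J *m N = N *m J.
Proof.
rewrite /N mulmxN mulNmx mulmx_sumr mulmx_suml; congr (- _).
by apply: eq_bigr => a _.
Qed.

Let ipJT A A' : J *m A = - (A *m J) -> ip (J *m A) A' = - ip A (J *m A').
Proof. by move=> JA; rewrite ip.unlock JA mulNmx linearN /= mulmxA. Qed.

Let JPE a b : (J *m P) a b = ip (J *m T a) (T b).
Proof.
rewrite mxE -Tq ip_suml; apply: eq_bigr => c _; by rewrite ipZl mxE.
Qed.

Let JP : J *m P = P *m J.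
Proof.
apply/matrixP => a b; rewrite JPE ipJT // -Tq ip_sumr mxE -sumrN.
by apply: eq_bigr => c _; rewrite ipZr mxE (skE b c JT) mulNr opprK mulrC.
Qed.

Let Ss := \sum_a Hs a a.

Let JSs : J *m Ss = - (Ss *m J).
Proof. by rewrite /Ss mulmx_sumr mulmx_suml -sumrN; apply: eq_bigr => a _; exact: JHs. Qed.

Let SE : S = Ss - J *m N.
Proof.
rewrite /S /Ss /N mulmxN opprK mulmx_sumr -big_split; apply: eq_bigr => a _ /=.
by rewrite HsD HpE -[X in _ = _ + X]half_half mulmxDr scalerDr subrK.
Qed.

(** Only the J-commuting part of S, which is -J N, pairs with J, and it is quadratic in T. *)
Lemma ip_SJ : ip S J = - t.
Proof.
rewrite SE ipDl ipNl ipC (ip_comm_anti JJ _ JSs) // add0r ip.unlock.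
by rewrite JN -mulmxA JJ mulmxN mulmx1 linearN /= opprK trN.
Qed.

(** The anticommuting part of S drops out of every trace. In 6 lam t, the commutator with J
    contributes 4, because T anticommutes with J, and the contraction with J contributes 2. *)
Lemma twist_sumE : \sum_b ip (J *m T b) (T b *m (S - (2 * lam) *: J)
      - (S - (2 * lam) *: J) *m T b - \sum_e (S - (2 * lam) *: J) b e *: T e)
  = 6 * lam * t + 2 * \tr (N *m N) + \tr (N *m P).
Proof.
have e1 : \sum_b ip (J *m T b) (T b *m S - S *m T b) = 2 * \tr (N *m N).
  have p b : ip (J *m T b) (T b *m S - S *m T b)
     = - \tr (T b *m T b *m N) - \tr (T b *m T b *m N).
    have q : J *m (T b *m Ss - Ss *m T b) = (T b *m Ss - Ss *m T b) *m J.
      rewrite mulmxBr mulmxBl !mulmxA TJ JSs !mulNmx -(mulmxA _ J) JSs.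
      by rewrite -(mulmxA Ss J) TJ !mulmxN !opprK !mulmxA.
    have q2 : J *m (J *m T b) = - ((J *m T b) *m J).
      by rewrite -mulmxA {1}TJ mulmxN mulmxA.
    rewrite (_ : _ - _ = (T b *m Ss - Ss *m T b) + J *m (T b *m N + N *m T b)).
      rewrite ipDr (ipC _ (_ - _)) (ip_comm_anti JJ q q2) add0r ipJJ //.
      rewrite ipDr ip.unlock !mulmxA; congr (_ + _); congr (- _).
      by rewrite mxtrace_mulC mulmxA.
    rewrite SE mulmxBr mulmxBl opprB mulmxDr !mulmxA TJ mulNmx.
    by apply/matrixP => i j; rewrite !mxE; lra.
  rewrite (eq_bigr _ (fun b _ => p b)) sumrB sumrN /= -!mulr2n.
  have -> : \sum_b \tr (T b *m T b *m N) = - \tr (N *m N).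
    by rewrite {2}/N mulNmx mulmx_suml linearN /= opprK (raddf_sum mxtrace).
  lra.
have e2 : \sum_b ip (J *m T b) (\sum_e S b e *: T e) = - \tr (N *m P).
  transitivity (ip S (J *m P)).
    rewrite [RHS]ipE /mxtrace -sumrN; apply: eq_bigr => b _.
    rewrite ip_sumr [in RHS]mxE -sumrN; apply: eq_bigr => e _.
    rewrite ipZr -JPE (skE (A := J *m P) b e) ?mulrN //.
    by rewrite trmx_mul PT JT mulmxN -JP.
  rewrite SE ipDl ipNl (ip_anti_comm JJ JSs) ?add0r.
    by rewrite ipE JN -(mulmxA N) JJl mulmxN linearN /= opprK.
  by rewrite {1}JP mulmxA.
have e3 b : ip (J *m T b) (T b *m (S - (2 * lam) *: J)
      - (S - (2 * lam) *: J) *m T b - \sum_e (S - (2 * lam) *: J) b e *: T e)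
    = ip (J *m T b) (T b *m S - S *m T b) - ip (J *m T b) (\sum_e S b e *: T e)
      + 6 * lam * ip (T b) (T b).
  rewrite -[ip (T b) (T b)](ipJJ _ JJ (TJ b)) -ipZr -ipNr -!ipDr; congr ip.
  rewrite mulmxBr mulmxBl -scalemxAr -scalemxAl.
  have -> : \sum_e (S - (2 * lam) *: J) b e *: T e
     = \sum_e S b e *: T e - (2 * lam) *: (J *m T b).
    rewrite -Tq scaler_sumr -sumrB; apply: eq_bigr => e _.
    by rewrite scalerA -scalerBl !mxE.
  have -> : T b *m J = - (J *m T b) by rewrite TJ opprK.
  by apply/matrixP => i j; rewrite !mxE; ring.
rewrite (eq_bigr _ (fun b _ => e3 b)) big_split sumrB /= e1 e2 -mulr_sumr -/t.
ring.
Qed.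

Let TTTT a b : - ip (Hp a b) (Hp a b) + ip (T a *m T b) (jf (Hp^~ b) a)
  = - \tr (T a *m T a *m (T b *m T b)).
Proof.
have e1 : ip (Hp a b) (Hp a b) = 2^-1 * \tr (T a *m T b *m (T a *m T b))
   + 2^-1 * \tr (T a *m T a *m (T b *m T b)).
  rewrite HpE ipZl ipZr ipE mulmxDr.
  have -> : (J *m (T a *m T b) + J *m (T b *m T a)) *m
            (J *m (T a *m T b) + J *m (T b *m T a)) =
     - ((T a *m T b + T b *m T a) *m (T a *m T b + T b *m T a)).
    rewrite -mulmxDr {1}mulmxDr !JTT -mulmxDl -mulmxA (mulmxA J J) JJ.
    by rewrite mulNmx mul1mx mulmxN.
  rewrite linearN /= opprK !(mulmxDl, mulmxDr) !linearD /=.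
  have -> : \tr (T b *m T a *m (T b *m T a)) = \tr (T a *m T b *m (T a *m T b)).
    by rewrite -mulmxA mxtrace_mulC -!mulmxA.
  have -> : \tr (T b *m T a *m (T a *m T b)) = \tr (T a *m T a *m (T b *m T b)).
    by rewrite -!mulmxA mxtrace_mulC -!mulmxA.
  have -> : \tr (T a *m T b *m (T b *m T a)) = \tr (T a *m T a *m (T b *m T b)).
    by rewrite mulmxA mxtrace_mulC !mulmxA.
  lra.
rewrite e1 jf_Hp ipNr ipZr ipDr ipNr !ipE.
have -> : \tr (T a *m T b *m (T b *m T a)) = \tr (T a *m T a *m (T b *m T b)).
  by rewrite mulmxA mxtrace_mulC !mulmxA.
lra.
Qed.

(** The commuting and anticommuting parts of H are orthogonal, so the quadratic terms separate; by
    [TTTT] the commuting part leaves a single quartic trace. *)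
Let quadratic_split a b :
  ip (H a b) (H a b) + ip (J *m H a b) (jf (H^~ b) a)
    - 2 * ip (H a b) (H b a) + ip (T a *m T b) (jf (H^~ b) a)
  = ip (Hs a b) (Hs a b) + ip (J *m Hs a b) (jf (Hs^~ b) a)
    - 2 * ip (Hs a b) (Hs b a) - \tr (T a *m T a *m (T b *m T b)).
Proof.
have HE c e : H c e = Hp c e + Hs c e by rewrite HsD addrC subrK.
have jfE : jf (H^~ b) a = jf (Hp^~ b) a + jf (Hs^~ b) a.
  by rewrite -jfD; apply: eq_jf => c; exact: HE.
have c1 : J *m jf (Hs^~ b) a = - (jf (Hs^~ b) a *m J) by apply: Jcl => c; exact: JHs.
have c2 : J *m jf (Hp^~ b) a = jf (Hp^~ b) a *m J.
  rewrite jf_Hp mulmxN mulNmx -scalemxAr -scalemxAl; congr (- (_ *: _)).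
  by rewrite mulmxBr mulmxBl !JTT.
have c3 : J *m (J *m Hs a b) = - (J *m Hs a b *m J) by rewrite [X in J *m X = _](JHs a b) mulmxN mulmxA.
have c4 : J *m (J *m Hp a b) = J *m Hp a b *m J by rewrite [X in J *m X = _](JHp a b) mulmxA.
have c5 : ip (J *m Hp a b) (jf (Hp^~ b) a) = 0.
  rewrite JHpE jf_Hp ipNl ipNr ipZl ipZr ipE !(mulmxDl, mulmxDr, mulmxN, mulNmx).
  rewrite !linearD !linearN /=.
  have -> : \tr (T b *m T a *m (T b *m T a)) = \tr (T a *m T b *m (T a *m T b)).
    by rewrite -mulmxA mxtrace_mulC -!mulmxA.
  have -> : \tr (T b *m T a *m (T a *m T b)) = \tr (T a *m T b *m (T b *m T a)).
    by rewrite mxtrace_mulC.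
  lra.
rewrite jfE !HE (mulmxDr J (Hp a b)) -TTTT (HpC b a).
move: c1 c2 c3 c4 c5 (JHp a b) (JHs a b) (JHs b a) (JTT a b).
generalize (Hp a b) (Hs a b) (Hs b a) (jf (Hp^~ b) a) (jf (Hs^~ b) a).
move=> p s s' q r c1 c2 c3 c4 c5 c6 c7 c8 c9; rewrite !(ipDl, ipDr) c5.
rewrite (ip_comm_anti JJ c6 c7) (ip_anti_comm JJ c7 c6) (ip_comm_anti JJ c6 c8).
rewrite (ip_comm_anti JJ c4 c1) (ip_anti_comm JJ c3 c2) (ip_comm_anti JJ c9 c1).
lra.
Qed.

Hypothesis Ttr : forall k, \sum_i T i k i = 0.

(** On the left stands the divergence of xi after the Leibniz rule. The traces of N^2 and of N P in
    [twist_sumE] cancel those coming from [quadratic_split] and [sum_ip_QQ], which is the reason for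
    the J-twisted term. *)
Lemma sekigawa_identity :
  \sum_a \sum_b (ip (H a b) (H a b) + ip (T b) (X a a b)
     - 2 * (ip (H a b) (H b a) + ip (T b) (X a b a))
     + (ip (H a a) (H b b) + ip (T a) (X a b b))
     + \sum_e (T a a e * ip (J *m T b) (H e b)
                + J a e * (ip (T a *m T b) (H e b) + ip (J *m H a b) (H e b)
                           + ip (J *m T b) (X a e b))))
  = \sum_a \sum_b ip (Y a b - Y b a) (Y a b - Y b a) + ip S S
    + 4^-1 * \tr (P *m P) + 2 * lam * t.
Proof.
(* Where the derivative falls on the twisting J, only the trace of T appears, and it vanishes. *)
have e1 : \sum_a \sum_b \sum_e T a a e * ip (J *m T b) (H e b) = 0.
  rewrite exchange_big big1 // => b _; rewrite exchange_big big1 //= => e _.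
  rewrite -mulr_suml (_ : \sum_a _ = 0) ?mul0r //.
  rewrite -[RHS]oppr0 -[in RHS](Ttr e) -sumrN; apply: eq_bigr => a _.
  exact: skE.
have e2 : \sum_a \sum_b ip (H a a) (H b b) = ip S S.
  by rewrite ip_suml; apply: eq_bigr => a _; rewrite ip_sumr.
have e3 : \sum_a \sum_b \tr (T a *m T a *m (T b *m T b)) = \tr (N *m N).
  rewrite /N mulmxN mulNmx opprK mulmx_suml (raddf_sum mxtrace).
  by apply: eq_bigr => a _; rewrite mulmx_sumr (raddf_sum mxtrace).
have e4 a b : \sum_e J a e * (ip (T a *m T b) (H e b) + ip (J *m H a b) (H e b))
   = ip (J *m H a b) (jf (H^~ b) a) + ip (T a *m T b) (jf (H^~ b) a).
  rewrite !ip_sumr -big_split; apply: eq_bigr => e _ /=; rewrite !ipZr; ring.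
transitivity (\sum_a \sum_b (ip (Hs a b) (Hs a b)
    + ip (J *m Hs a b) (jf (Hs^~ b) a) - 2 * ip (Hs a b) (Hs b a))
  + \sum_a \sum_b (ip (T b) (X a a b) - 2 * ip (T b) (X a b a) + ip (T a) (X a b b))
  + \sum_a \sum_b \sum_e J a e * ip (J *m T b) (X a e b)
  + \sum_a \sum_b \sum_e T a a e * ip (J *m T b) (H e b)
  + \sum_a \sum_b ip (H a a) (H b b)
  - \sum_a \sum_b \tr (T a *m T a *m (T b *m T b))).
  rewrite -sumrN -!big_split; apply: eq_bigr => a _.
  rewrite -sumrN -!big_split; apply: eq_bigr => b _ /=.
  have -> : ip (Hs a b) (Hs a b) + ip (J *m Hs a b) (jf (Hs^~ b) a)
      - 2 * ip (Hs a b) (Hs b a) = ip (H a b) (H a b) - 2 * ip (H a b) (H b a)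
        + \sum_e J a e * (ip (T a *m T b) (H e b) + ip (J *m H a b) (H e b))
        + \tr (T a *m T a *m (T b *m T b)).
    by have := quadratic_split a b; rewrite e4; lra.
  have -> : \sum_e (T a a e * ip (J *m T b) (H e b)
                + J a e * (ip (T a *m T b) (H e b) + ip (J *m H a b) (H e b)
                           + ip (J *m T b) (X a e b))) =
    \sum_e T a a e * ip (J *m T b) (H e b) +
    \sum_e J a e * (ip (T a *m T b) (H e b) + ip (J *m H a b) (H e b)) +
    \sum_e J a e * ip (J *m T b) (X a e b).
    by rewrite -!big_split; apply: eq_bigr => e _ /=; ring.
  ring.
rewrite sum_ip_HsHs sum_ip_QQ third_order_sum twist_sum twist_sumE e1 e2 e3; lra.
Qed.

Let t_eq0 : n%:R = 0 :> K -> t = 0.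
Proof.
by move=> /eqP; rewrite pnatr_eq0 => /eqP n0; apply: big1 => i _; have := ltn_ord i; rewrite {2}n0.
Qed.

Lemma sekigawa_inequality :
  5 * t ^+ 2 + 8 * n%:R * lam * t <= 4 * n%:R * (\sum_a \sum_b (ip (H a b) (H a b)
     + ip (T b) (X a a b) - 2 * (ip (H a b) (H b a) + ip (T b) (X a b a))
     + (ip (H a a) (H b b) + ip (T a) (X a b b))
     + \sum_e (T a a e * ip (J *m T b) (H e b)
                + J a e * (ip (T a *m T b) (H e b) + ip (J *m H a b) (H e b)
                           + ip (J *m T b) (X a e b))))).
Proof.
rewrite sekigawa_identity.
have n0 : 0 <= n%:R :> K by [].
have z0 : 0 <= n%:R * \sum_a \sum_b ip (Y a b - Y b a) (Y a b - Y b a).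
  apply: mulr_ge0 => //; apply: sumr_ge0 => a _; apply: sumr_ge0 => b _.
  move: (YT a b) (YT b a); generalize (Y a b) (Y b a) => y y' h h'.
  by apply: ip_ge0; rewrite linearB /= h h' opprB opprK addrC.
(* Cauchy-Schwarz for the trace of P, obtained from the squared norm of n P - t 1. *)
have tP : t ^+ 2 <= n%:R * \tr (P *m P).
  have -> : \tr (P *m P) = \sum_i \sum_j P i j ^+ 2.
    apply: eq_bigr => i _; rewrite mx_expand; apply: eq_bigr => j _.
    have -> : P j i = P i j by rewrite !mxE ipC.
    by rewrite expr2.
  (* The inequality is multiplied by n below, so dimension zero, where t is an empty sum, is
     separated. *)
  have [n00|n1] := eqVneq (n%:R : K) 0.
    by rewrite n00 mul0r t_eq0 ?expr0n.
  rewrite -(ler_pM2l (x := n%:R)) ?lt_def ?n1 // -subr_ge0.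
  suff -> : n%:R * (n%:R * \sum_i \sum_j P i j ^+ 2) - n%:R * t ^+ 2
     = \sum_i \sum_j (n%:R * P i j - t * (i == j)%:R) ^+ 2.
    by apply: sumr_ge0 => i _; apply: sumr_ge0 => j _; exact: sqr_ge0.
  (* One copy of the trace is hidden behind [u], so that unfolding the trace affects only the linear
     occurrence. *)
  have [u uE] : {u | u = \tr P} by exists (\tr P).
  rewrite -trP -uE; set m := n%:R.
  transitivity (m ^+ 2 * (\sum_i \sum_j P i j ^+ 2) - 2 * m * u * \tr P + m * u ^+ 2).
    by rewrite -uE; ring.
  rewrite /mxtrace !mulr_sumr -sumrN -big_split /=.
  have -> : m * u ^+ 2 = \sum_(i < n) u ^+ 2 by rewrite sumr_const card_ord mulr_natl.
  rewrite -big_split; apply: eq_bigr => i _ /=.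
  rewrite -(sum_pickM (fun j => 2 * m * u * P i j) i).
  rewrite -(sum_pickM (fun=> u ^+ 2) i) mulr_sumr -sumrN -!big_split.
  by apply: eq_bigr => j _ /=; case: (i == j); rewrite ?mulr1n ?mulr0n; ring.
(* Cauchy-Schwarz for S against J, whose squared norm is n, obtained from the squared norm of n S +
   t J. *)
have tS : t ^+ 2 <= n%:R * ip S S.
  have [n00|n1] := eqVneq (n%:R : K) 0.
    by rewrite n00 mul0r t_eq0 ?expr0n.
  rewrite -(ler_pM2l (x := n%:R)) ?lt_def ?n1 // -subr_ge0.
  have ST : S^T = - S.
    by rewrite /S linear_sum -sumrN; apply: eq_bigr => a _; exact: HT.
  suff -> : n%:R * (n%:R * ip S S) - n%:R * t ^+ 2
     = ip (n%:R *: S + t *: J) (n%:R *: S + t *: J).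
    by apply: ip_ge0; rewrite linearD /= !linearZ /= ST JT !scalerN opprD.
  have iJ : ip J J = n%:R by rewrite ipE JJ linearN /= opprK mxtrace1.
  rewrite !(ipDl, ipDr, ipZl, ipZr) (ipC J S) ip_SJ iJ; ring.
lra.
Qed.

(** By the first Bianchi identity twice the star-Ricci contraction is, up to sign, the J-contraction
    of the first pair of curvature indices. [weitzenbock] evaluates the latter, and t enters through
    the pairing of S with J. *)
Lemma star_scalarE :
  2 * (\sum_(j < n) \sum_(k < n | (j < k)%N) (\sum_i (J *m R j i) i k) * J j k)
  = n%:R * lam + t / 2.
Proof.
pose r j k := \sum_i (J *m R j i) i k.
have rE j k : 2 * r j k = - (S - (2 * lam) *: J) j k.
  rewrite -weitzenbock summxE -sumrN.
  have r1 : r j k = \sum_i \sum_l J i l * R j i l k.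
    by apply: eq_bigr => i _; rewrite mx_expand.
  have r2 : r j k = \sum_i \sum_l J i l * R l j i k.
    rewrite r1 exchange_big; apply: eq_bigr => i _; apply: eq_bigr => l _ /=.
    by rewrite (skE l i JT) (RA j l) mxE mulrNN.
  rewrite mulr_natl mulr2n {1}r1 r2 -big_split; apply: eq_bigr => i _ /=.
  rewrite summxE -sumrN -big_split; apply: eq_bigr => l _ /=.
  by rewrite mxE -mulrDr -mulrN; congr (_ * _); have := Rbian j i l k; lra.
have ST : S^T = - S.
  by rewrite /S linear_sum -sumrN; apply: eq_bigr => a _; exact: HT.
have MT : (S - (2 * lam) *: J)^T = - (S - (2 * lam) *: J).
  by rewrite linearB linearZ /= ST JT scalerN opprB opprK addrC.
have rT j k : r j k = - r k j.
  have := rE j k; have := rE k j; have := skE j k MT.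
  by move: (S - (2 * lam) *: J) => M0; lra.
have iJ : ip J J = n%:R by rewrite ipE JJ linearN /= opprK mxtrace1.
have full : \sum_j \sum_k r j k * J j k = n%:R * lam + t / 2.
  have -> : \sum_j \sum_k r j k * J j k = - (2^-1 * ip (S - (2 * lam) *: J) J).
    rewrite ipE mulrN opprK /mxtrace mulr_sumr; apply: eq_bigr => j _.
    rewrite mx_expand mulr_sumr; apply: eq_bigr => k _.
    have e : r j k = - (2^-1 * (S - (2 * lam) *: J) j k) by have := rE j k; lra.
    by rewrite e (skE k j JT); ring.
  by rewrite ipDl ipNl ipZl ip_SJ iJ; lra.
rewrite -full mulr_natl mulr2n.
(* Both factors are skew, so the sums over j < k and k < j agree and the diagonal vanishes. *)
transitivity (\sum_(j < n) \sum_(k < n | (j < k)%N) r j k * J j k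
            + \sum_(j < n) \sum_(k < n | (k < j)%N) r j k * J j k).
  congr (_ + _); rewrite (exchange_big_dep xpredT) //=; apply: eq_bigr => j _.
  by apply: eq_bigr => k _; rewrite -/(r k j) rT (skE k j JT) mulrNN.
rewrite -big_split; apply: eq_bigr => j _ /=.
rewrite [RHS](bigID (fun k : 'I_n => (j < k)%N)) /=; congr (_ + _).
rewrite [RHS](bigD1 j) ?ltnn //= (_ : J j j = 0) ?mulr0 ?add0r.
  by apply: eq_bigl => k; rewrite -leqNgt ltn_neqAle andbC.
by have := skE j j JT; lra.
Qed.

End Pointwise.

(** * Tensor calculus over a ring with derivations *)

Section MxEntries.
Context {F : pzRingType} {m n : nat}.
Implicit Types (A B : 'M[F]_(m, n)).
Lemma mxaddE A B i j : (A + B) i j = A i j + B i j. Proof. by rewrite mxE. Qed.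
Lemma mxoppE A i j : (- A) i j = - A i j. Proof. by rewrite mxE. Qed.
Lemma mxscaleE x A i j : (x *: A) i j = x * A i j. Proof. by rewrite mxE. Qed.
Lemma mxzeroE i j : (0 : 'M[F]_(m, n)) i j = 0. Proof. by rewrite mxE. Qed.
End MxEntries.

(* Reduces an identity between noncommutative monomials to the commutative ring
   of entries, the monomials being atoms. *)
Ltac mx_ring :=
  rewrite ?(mulmxDl, mulmxDr, mulmxN, mulNmx, mulmxA);
  let i := fresh in let j := fresh in
  apply/matrixP => i j; rewrite !(mxaddE, mxoppE, mxscaleE, mxzeroE);
  first [ solve [
    repeat match goal with |- context [@fun_of_matrix ?K ?p ?q ?A i j] =>
      generalize (@fun_of_matrix K p q A i j); intro end; ring ]
  | ring ].

(** An algebraic model of a coordinate chart: F plays the ring of smooth functions, and [chr i j k]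
    the Christoffel symbol with lower indices i, j and upper index k. Identities proved in the ring
    can be differentiated again, and evaluation at a point is a ring morphism applied at the end.
    [two_reg] stands in for division by two. *)
Record calculus (F : comPzRingType) (n : nat) := Calculus {
  der : 'I_n -> F -> F;
  derD : forall i x y, der i (x + y) = der i x + der i y;
  derM : forall i x y, der i (x * y) = der i x * y + x * der i y;
  derC : forall i j x, der i (der j x) = der j (der i x);
  met : 'M[F]_n;
  imet : 'M[F]_n;
  chr : 'I_n -> 'M[F]_n;
  two_reg : forall x : F, x + x = 0 -> x = 0;
  met_sym : met^T = met;
  met_inv : met *m imet = 1%:M;
  chr_sym : forall i j k, chr i j k = chr j i k;
  met_par : forall i, map_mx (der i) met = chr i *m met + met *m (chr i)^T }.

Section Calculus.
Context {F : comPzRingType} {n : nat} (D : calculus F n).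
Implicit Types (x y : F) (A B M : 'M[F]_n) (i j k a b c : 'I_n).
Implicit Types (P Q : 'I_n -> 'M[F]_n) (W : 'I_n -> 'I_n -> 'M[F]_n).

Local Notation d := (der D).
Local Notation g := (met D).
Local Notation G := (imet D).
Local Notation Gam := (chr D).

Lemma der0 i : d i 0 = 0.
Proof. by apply: (addrI (d i 0)); rewrite -derD !addr0. Qed.

Lemma derN i x : d i (- x) = - d i x.
Proof. by apply: (addrI (d i x)); rewrite -derD !subrr der0. Qed.

Lemma der1 i : d i 1 = 0.
Proof.
by have := derM D i 1 1; rewrite !mulr1 mul1r -[LHS]addr0 => /addrI/esym.
Qed.

Lemma der_sum i I (r : seq I) (p : pred I) (f : I -> F) :
  d i (\sum_(k <- r | p k) f k) = \sum_(k <- r | p k) d i (f k).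
Proof.
exact: (big_morph (d i) (derD D i) (der0 i)).
Qed.

Definition dmx i A := map_mx (d i) A.

Lemma dmxE i A a b : dmx i A a b = d i (A a b).
Proof. by rewrite mxE. Qed.

Lemma dmxD i A B : dmx i (A + B) = dmx i A + dmx i B.
Proof. by apply/matrixP => a b; rewrite !mxE derD. Qed.

Lemma dmxN i A : dmx i (- A) = - dmx i A.
Proof. by apply/matrixP => a b; rewrite !mxE derN. Qed.

Lemma dmxM i A B : dmx i (A *m B) = dmx i A *m B + A *m dmx i B.
Proof.
apply/matrixP => a b; rewrite !mxE der_sum -big_split; apply: eq_bigr => k _.
by rewrite derM !mxE.
Qed.

Lemma dmxZ i x A : dmx i (x *: A) = d i x *: A + x *: dmx i A.
Proof. by apply/matrixP => a b; rewrite !mxE derM. Qed.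

Lemma dmx_tr i A : dmx i A^T = (dmx i A)^T.
Proof. by rewrite /dmx map_trmx. Qed.

Lemma dmx_sum i I (r : seq I) (p : pred I) (f : I -> 'M[F]_n) :
  dmx i (\sum_(k <- r | p k) f k) = \sum_(k <- r | p k) dmx i (f k).
Proof.
apply: (big_morph (dmx i) (dmxD i)).
by apply/matrixP => a b; rewrite !mxE der0.
Qed.

Lemma dmx1 i : dmx i 1%:M = 0.
Proof. by apply/matrixP => a b; rewrite !mxE; case: eqP => _; rewrite ?der1 ?der0. Qed.

Lemma dmxC i j A : dmx i (dmx j A) = dmx j (dmx i A).
Proof. by apply/matrixP => a b; rewrite !mxE derC. Qed.

(** On endomorphisms of row vectors the connection acts by a commutator with [Gam i]. In [cov1] and
    [cov2] the indices of the family are covariant tensor indices, each with its own correction. *)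
Definition cov i A := dmx i A + A *m Gam i - Gam i *m A.

Definition cov1 i P j := cov i (P j) - \sum_k Gam i j k *: P k.

Definition cov2 i W j k :=
  cov i (W j k) - \sum_l Gam i j l *: W l k - \sum_l Gam i k l *: W j l.

Lemma covD i A B : cov i (A + B) = cov i A + cov i B.
Proof. by rewrite /cov dmxD; mx_ring. Qed.

Lemma covN i A : cov i (- A) = - cov i A.
Proof. by rewrite /cov dmxN; mx_ring. Qed.

Lemma covM i A B : cov i (A *m B) = cov i A *m B + A *m cov i B.
Proof. by rewrite /cov dmxM; mx_ring. Qed.

Lemma cov1x i : cov i 1%:M = 0.
Proof. by rewrite /cov dmx1 mul1mx mulmx1; mx_ring. Qed.

Lemma covZ i x A : cov i (x *: A) = d i x *: A + x *: cov i A.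
Proof. by rewrite /cov dmxZ -scalemxAl -scalemxAr; mx_ring. Qed.

Lemma cov_sum i I (r : seq I) (p : pred I) (f : I -> 'M[F]_n) :
  cov i (\sum_(k <- r | p k) f k) = \sum_(k <- r | p k) cov i (f k).
Proof.
apply: (big_morph (cov i) (covD i)).
by rewrite -[in LHS](subrr 1%:M) covD covN cov1x subrr.
Qed.

Lemma der_tr i A : d i (\tr A) = \tr (cov i A).
Proof.
rewrite /cov !linearD linearN /= (mxtrace_mulC A) addrK /mxtrace der_sum.
by apply: eq_bigr => k _; rewrite !mxE.
Qed.

Lemma der_trM i A B : d i (\tr (A *m B)) = \tr (cov i A *m B) + \tr (A *m cov i B).
Proof. by rewrite der_tr covM linearD. Qed.

Lemma cov1Ml i A P j : cov1 i (fun k => A *m P k) j = cov i A *m P j + A *m cov1 i P j.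
Proof.
rewrite /cov1 covM; under eq_bigr do rewrite scalemxAr.
by rewrite -mulmx_sumr; mx_ring.
Qed.

(* [A] is used here as the (1,1) tensor acting on the index of the family. *)
Lemma cov1_contract i A P j : cov1 i (fun k => \sum_c A k c *: P c) j
  = \sum_c cov i A j c *: P c + \sum_c A j c *: cov1 i P c.
Proof.
rewrite /cov1 cov_sum.
under eq_bigr do rewrite covZ.
under [X in _ = _ + X]eq_bigr do rewrite scalerBr.
rewrite big_split sumrB /=.
have -> : \sum_k Gam i j k *: (\sum_c A k c *: P c) = \sum_c (Gam i *m A) j c *: P c.
  under eq_bigr do rewrite scaler_sumr.
  rewrite exchange_big; apply: eq_bigr => c _ /=.
  by rewrite mxE scaler_suml; apply: eq_bigr => k _; rewrite scalerA.
have -> : \sum_k A j k *: (\sum_c Gam i k c *: P c) = \sum_c (A *m Gam i) j c *: P c.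
  under eq_bigr do rewrite scaler_sumr.
  rewrite exchange_big; apply: eq_bigr => c _ /=.
  by rewrite mxE scaler_suml; apply: eq_bigr => k _; rewrite scalerA.
have -> : \sum_c cov i A j c *: P c = \sum_c d i (A j c) *: P c
   + \sum_c (A *m Gam i) j c *: P c - \sum_c (Gam i *m A) j c *: P c.
  rewrite -big_split -sumrB; apply: eq_bigr => c _ /=.
  by rewrite -scalerDl -scalerBl /cov !(mxaddE, mxoppE) mxE.
mx_ring.
Qed.

(** Skew-adjointness for the metric; it becomes ordinary skew-symmetry at a point where the metric
    evaluates to the identity. *)
Definition skew A := A *m g + (A *m g)^T = 0.

Lemma dmx_lower i A : dmx i (A *m g) = cov i A *m g + Gam i *m (A *m g) + A *m g *m (Gam i)^T.
Proof. by rewrite dmxM /dmx met_par /cov /dmx; mx_ring. Qed.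

Lemma skewP A : skew A <-> (A *m g)^T = - (A *m g).
Proof.
rewrite /skew addrC; split=> [/eqP|->]; last by rewrite addNr.
by rewrite addr_eq0 => /eqP.
Qed.

Lemma skew_cov i A : skew A -> skew (cov i A).
Proof.
move=> /skewP; have := dmx_lower i A; move: (A *m g) => L e sL; apply/skewP.
have {e} -> : cov i A *m g = dmx i L - Gam i *m L - L *m (Gam i)^T by rewrite e; mx_ring.
rewrite !linearB /= !trmx_mul trmxK -dmx_tr sL dmxN; mx_ring.
Qed.

Lemma skewZ x A : skew A -> skew (x *: A).
Proof. by move=> /skewP sA; apply/skewP; rewrite -scalemxAl linearZ /= sA scalerN. Qed.

Lemma skewD A B : skew A -> skew B -> skew (A + B).
Proof.
by move=> /skewP sA /skewP sB; apply/skewP; rewrite mulmxDl linearD /= sA sB opprD.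
Qed.

Lemma skewN A : skew A -> skew (- A).
Proof. by move=> sA; rewrite -scaleN1r; exact: skewZ. Qed.

Lemma skew_sum I (r : seq I) (f : I -> 'M[F]_n) :
  (forall u : I, skew (f u)) -> skew (\sum_(u <- r) f u).
Proof.
move=> sf; elim/big_ind: _ => //; last exact: skewD.
by apply/skewP; rewrite mul0mx trmx0 oppr0.
Qed.

Lemma skew_cov1 i P j : (forall k, skew (P k)) -> skew (cov1 i P j).
Proof.
move=> sP; apply: skewD; first exact: skew_cov.
by apply/skewN/skew_sum => k; exact: skewZ.
Qed.

(* The index [a] of the family together with the lowered matrix indices. *)
Definition cyclic P := forall a b c,
  (P a *m g) b c + (P b *m g) c a + (P c *m g) a b = 0.

(** The metric is parallel, so lowering commutes with covariant differentiation and puts the three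
    indices on the same footing; this is what makes cyclic identities differentiable. *)
Lemma cov1_lower i P a b c : (cov1 i P a *m g) b c = d i ((P a *m g) b c)
  - \sum_k Gam i a k * (P k *m g) b c - \sum_k Gam i b k * (P a *m g) k c
  - \sum_k Gam i c k * (P a *m g) b k.
Proof.
have e : cov1 i P a *m g = dmx i (P a *m g) - \sum_k Gam i a k *: (P k *m g)
    - Gam i *m (P a *m g) - P a *m g *m (Gam i)^T.
  rewrite /cov1 mulmxBl mulmx_suml dmx_lower.
  by under eq_bigr do rewrite -scalemxAl; mx_ring.
rewrite e !(mxaddE, mxoppE) summxE dmxE; congr (_ - _ - _ - _).
- by apply: eq_bigr => k _; rewrite mxE.
- by rewrite mx_expand.
- by rewrite mx_expand; apply: eq_bigr => k _; rewrite [X in _ * X]mxE mulrC.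
Qed.

Lemma cyclic_cov1 i P : cyclic P -> cyclic (cov1 i P).
Proof.
move=> cP a b c; rewrite !cov1_lower.
have e : d i ((P a *m g) b c) + d i ((P b *m g) c a) + d i ((P c *m g) a b) = 0.
  by rewrite -!derD cP der0.
have s u v w : \sum_k Gam i u k * (P k *m g) v w + \sum_k Gam i u k * (P v *m g) w k
   + \sum_k Gam i u k * (P w *m g) k v = 0.
  rewrite -!big_split big1 // => k _ /=.
  by rewrite -!mulrDr cP mulr0.
have := s a b c; have := s b c a; have := s c a b => s1 s2 s3.
have add3 (x y z : F) : x + y + z = 0 -> x = - (y + z).
  by rewrite -addrA => /eqP; rewrite addr_eq0 => /eqP.
rewrite (add3 _ _ _ e) (add3 _ _ _ s1) (add3 _ _ _ s2) (add3 _ _ _ s3); ring.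
Qed.

(** Row vectors reverse compositions, hence the order of the products: [w *m Rm a b] is R(e_a, e_b)
    w. *)
Definition Rm a b :=
  dmx a (Gam b) - dmx b (Gam a) + (Gam b *m Gam a - Gam a *m Gam b).

Lemma cov_comm a b A : cov a (cov b A) - cov b (cov a A) = A *m Rm a b - Rm a b *m A.
Proof.
rewrite /cov /Rm !(dmxD, dmxN, dmxM) (dmxC a b); mx_ring.
Qed.

Lemma RmN a b : Rm a b = - Rm b a.
Proof. rewrite /Rm; mx_ring. Qed.

(** The Ricci identity for a family: its index contributes a curvature term of its own, and the
    symmetry of the Christoffel symbols removes the torsion term. *)
Lemma cov1_comm c a P b :
  cov2 c (fun u v => cov1 u P v) a b - cov2 a (fun u v => cov1 u P v) c b
  = P b *m Rm c a - Rm c a *m P b - \sum_k Rm c a b k *: P k.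
Proof.
have e u v : cov2 u (fun u v => cov1 u P v) v b = cov u (cov v (P b))
   - \sum_l Gam u v l *: cov1 l P b - (\sum_k d u (Gam v b k) *: P k)
   - (\sum_k Gam v b k *: cov u (P k) + \sum_k Gam u b k *: cov v (P k))
   + \sum_k (Gam u *m Gam v) b k *: P k.
  rewrite /cov2 {1}/cov1 covD covN cov_sum; under eq_bigr do rewrite covZ.
  have -> : \sum_l Gam u b l *: cov1 v P l = \sum_k Gam u b k *: cov v (P k)
      - \sum_k (Gam u *m Gam v) b k *: P k.
    under eq_bigr do rewrite /cov1 scalerBr scaler_sumr.
    rewrite sumrB; congr (_ - _); rewrite exchange_big; apply: eq_bigr => k _ /=.
    by rewrite mxE scaler_suml; apply: eq_bigr => l _; rewrite scalerA.
  by rewrite big_split; mx_ring.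
rewrite !e.
have -> : \sum_l Gam a c l *: cov1 l P b = \sum_l Gam c a l *: cov1 l P b.
  by apply: eq_bigr => l _; rewrite chr_sym.
have -> : P b *m Rm c a - Rm c a *m P b = cov c (cov a (P b)) - cov a (cov c (P b)).
  by rewrite cov_comm.
have -> : \sum_k Rm c a b k *: P k = \sum_k d c (Gam a b k) *: P k
   - \sum_k d a (Gam c b k) *: P k + (\sum_k (Gam a *m Gam c) b k *: P k
   - \sum_k (Gam c *m Gam a) b k *: P k).
  rewrite -!sumrB -big_split; apply: eq_bigr => k _ /=.
  by rewrite -!scalerBl -scalerDl /Rm !(mxaddE, mxoppE) !dmxE.
by apply/matrixP => ? ?; rewrite !(mxaddE, mxoppE); ring.
Qed.

Definition DRm c a b := cov2 c Rm a b.

Lemma hess_comm A a b : cov1 a (cov^~ A) b - cov1 b (cov^~ A) a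
  = A *m Rm a b - Rm a b *m A.
Proof.
rewrite -cov_comm /cov1 (eq_bigr (fun k => Gam b a k *: cov k A)) => [|k _].
  by mx_ring.
by rewrite chr_sym.
Qed.

(** Equality of the mixed second derivatives of the metric, rewritten by [met_par]: the curvature
    acts trivially on a parallel metric. *)
Lemma skew_Rm a b : skew (Rm a b).
Proof.
apply/skewP; rewrite trmx_mul met_sym.
have tE : (Rm a b)^T = dmx a (Gam b)^T - dmx b (Gam a)^T
    + ((Gam a)^T *m (Gam b)^T - (Gam b)^T *m (Gam a)^T).
  by rewrite /Rm !(linearD, linearN) /= !trmx_mul !dmx_tr.
have h : dmx a (dmx b g) - dmx b (dmx a g) = 0 by rewrite dmxC subrr.
apply/eqP; rewrite -addr_eq0 -h tE /Rm; apply/eqP.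
rewrite [dmx b g]met_par [dmx a g]met_par !(dmxD, dmxM) [dmx b g]met_par [dmx a g]met_par.
mx_ring.
Qed.

Lemma bianchi1 a b c e : Rm a b c e + Rm b c a e + Rm c a b e = 0.
Proof.
have E u v w : Rm u v w e = d u (Gam v w e) - d v (Gam u w e)
    + (\sum_k Gam v w k * Gam u k e - \sum_k Gam u w k * Gam v k e).
  by rewrite /Rm !(mxaddE, mxoppE) !dmxE !mx_expand.
rewrite !E (chr_sym _ c a) (chr_sym _ b a) (chr_sym _ c b).
have S u v w : \sum_k Gam u v k * Gam w k e = \sum_k Gam v u k * Gam w k e.
  by apply: eq_bigr => k _; rewrite chr_sym.
rewrite (S c a) (S b a) (S c b); ring.
Qed.

Let add3 (x y z : F) : x + y + z = 0 -> x = - (y + z).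
Proof. by rewrite -addrA => /eqP; rewrite addr_eq0 => /eqP. Qed.

Lemma skewE A i j : skew A -> (A *m g) i j = - (A *m g) j i.
Proof. by move=> /skewP/matrixP/(_ j i); rewrite [LHS]mxE mxoppE. Qed.

Lemma bianchi1_lower a b c e :
  (Rm a b *m g) c e + (Rm b c *m g) a e + (Rm c a *m g) b e = 0.
Proof.
rewrite !mx_expand -!big_split big1 // => k _ /=.
by rewrite -!mulrDl bianchi1 mul0r.
Qed.

(** Four Bianchi identities, rewritten with the skew symmetries, add up to twice the difference of
    the two sides. *)
Lemma Rm_pair a b c e : (Rm a b *m g) c e = (Rm c e *m g) a b.
Proof.
have N u v w z : (Rm u v *m g) w z = - (Rm v u *m g) w z.
  by rewrite RmN mulNmx mxoppE.
have sk u v w z : (Rm u v *m g) w z = - (Rm u v *m g) z w.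
  exact: skewE (skew_Rm u v).
apply/subr0_eq/(two_reg D).
have NN u v w z : (Rm u v *m g) w z = (Rm v u *m g) z w by rewrite N sk opprK.
have s1 := bianchi1_lower a b c e; have s2 := bianchi1_lower b c e a.
have s3 := bianchi1_lower c e a b; have s4 := bianchi1_lower e a b c.
rewrite (sk b c e a) (sk c e b a) (NN e b c a) in s2.
rewrite (NN e a c b) (NN a c e b) in s3.
rewrite (N e a b c) (sk a b e c) in s4.
transitivity ((Rm a b *m g) c e + (Rm b c *m g) a e + (Rm c a *m g) b e
  + (- (Rm b c *m g) a e + - (Rm c e *m g) a b + (Rm b e *m g) a c)
  - ((Rm c e *m g) a b + (Rm a e *m g) b c + (Rm c a *m g) b e)
  - (- (Rm a e *m g) b c + - (Rm a b *m g) c e + (Rm b e *m g) a c)).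
  ring.
by rewrite s1 s2 s3 s4 !subr0 addr0.
Qed.

(** The cyclic sum already vanishes for [cov]; the corrections for the two form indices cancel in
    pairs, by the symmetry of [chr] and the antisymmetry of [Rm]. *)
Lemma bianchi2 a b c : DRm c a b + DRm a b c + DRm b c a = 0.
Proof.
have h : cov c (Rm a b) + cov a (Rm b c) + cov b (Rm c a) = 0.
  rewrite /cov /Rm !(dmxD, dmxN, dmxM) (dmxC b a (Gam c)) (dmxC c a (Gam b)).
  by rewrite (dmxC c b (Gam a)); mx_ring.
have S u v w : \sum_l Gam u v l *: Rm w l = - \sum_l Gam v u l *: Rm l w.
  by rewrite -sumrN; apply: eq_bigr => l _; rewrite chr_sym RmN scalerN.
rewrite -h /DRm /cov2 (S a c) (S b a) (S c b).
move: (cov c (Rm a b)) (cov a (Rm b c)) (cov b (Rm c a)) => U V W.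
repeat match goal with |- context [@bigop.body ?A ?B ?x ?r ?f] =>
  generalize (@bigop.body A B x r f); intro end.
mx_ring.
Qed.

Lemma cov2_lower c W a b i j : (cov2 c W a b *m g) i j = d c ((W a b *m g) i j)
  - \sum_l Gam c a l * (W l b *m g) i j - \sum_l Gam c b l * (W a l *m g) i j
  - \sum_l Gam c i l * (W a b *m g) l j - \sum_l Gam c j l * (W a b *m g) i l.
Proof.
have -> : cov2 c W a b = cov1 c (W a) b - \sum_l Gam c a l *: W l b.
  by rewrite /cov2 /cov1 addrAC.
rewrite mulmxBl mxaddE mxoppE cov1_lower mulmx_suml summxE.
under [X in _ - X]eq_bigr do rewrite -scalemxAl mxscaleE.
ring.
Qed.

Lemma DRm_pair c a b i j : (DRm c a b *m g) i j = (DRm c i j *m g) a b.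
Proof.
rewrite /DRm [LHS]cov2_lower [RHS]cov2_lower (Rm_pair a b i j).
have S1 u v w z : \sum_l Gam c u l * (Rm l v *m g) w z
    = \sum_l Gam c u l * (Rm w z *m g) l v.
  by apply: eq_bigr => l _; rewrite Rm_pair.
have S2 u v w z : \sum_l Gam c u l * (Rm v l *m g) w z
    = \sum_l Gam c u l * (Rm w z *m g) v l.
  by apply: eq_bigr => l _; rewrite Rm_pair.
rewrite (S1 a) (S2 b) (S1 i) (S2 j); ring.
Qed.

Lemma DRmN c a b : DRm c a b = - DRm c b a.
Proof.
have E u (f h : 'I_n -> 'M[F]_n) : (forall l, f l = - h l) ->
    \sum_l Gam c u l *: f l = - \sum_l Gam c u l *: h l.
  by move=> fh; rewrite -sumrN; apply: eq_bigr => l _; rewrite fh scalerN.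
rewrite /DRm /cov2 (RmN a b) covN.
rewrite (E a _ (Rm b)) => [|l]; last exact: RmN.
rewrite (E b _ (Rm^~ a)) => [|l]; last exact: RmN.
by rewrite !opprD !opprK addrAC.
Qed.

Lemma skew_DRm c a b : skew (DRm c a b).
Proof.
have -> : DRm c a b = cov1 c (Rm a) b - \sum_l Gam c a l *: Rm l b.
  by rewrite /DRm /cov2 /cov1 addrAC.
apply: skewD; first by apply: skew_cov1 => k; exact: skew_Rm.
by apply/skewN/skew_sum => l; exact/skewZ/skew_Rm.
Qed.

(** The trace pairs a covariant index with a contravariant one, so no metric is involved and the
    corrections for the two contracted indices cancel. *)
Lemma trace_cov1 c P : (forall k, \sum_i P i k i = 0) ->
  forall k, \sum_i cov1 c P i k i = 0.
Proof.
move=> tP k.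
have -> : \sum_i cov1 c P i k i = d c (\sum_i P i k i)
   + \sum_i (P i *m Gam c) k i - \sum_i (Gam c *m P i) k i
   - \sum_i \sum_l Gam c i l * P l k i.
  rewrite der_sum -big_split -!sumrB; apply: eq_bigr => i _ /=.
  rewrite /cov1 /cov !(mxaddE, mxoppE) dmxE summxE; congr (_ - _).
  by apply: eq_bigr => l _; rewrite mxscaleE.
have -> : \sum_i (Gam c *m P i) k i = 0.
  under eq_bigr do rewrite mx_expand.
  by rewrite exchange_big big1 // => l _ /=; rewrite -mulr_sumr tP mulr0.
have -> : \sum_i (P i *m Gam c) k i = \sum_i \sum_l Gam c i l * P l k i.
  under eq_bigr do rewrite mx_expand.
  rewrite [RHS]exchange_big; apply: eq_bigr => l _ /=.
  by apply: eq_bigr => i _; rewrite mulrC (chr_sym D c i).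
by rewrite tP der0 add0r subr0 subrr.
Qed.

End Calculus.

Lemma mxtraceB {F : pzRingType} {n : nat} (A B : 'M[F]_n) :
  \tr (A - B) = \tr A - \tr B.
Proof. by rewrite mxtraceD -scaleN1r mxtraceZ mulN1r. Qed.

(** * The field xi and the Leibniz expansion of its divergence *)

Section Fields.
Context {F : comPzRingType} {n : nat} (D : calculus F n) (J : 'M[F]_n).
Implicit Types (a b c e i j k : 'I_n).
Local Notation G := (imet D).
Local Notation Gam := (chr D).

Definition Tt a := cov D a J.
Definition Hh a b := cov1 D a Tt b.
Definition Xx c a b := cov2 D c Hh a b.

Definition tnorm := - \sum_a \sum_b G a b * \tr (Tt a *m Tt b).

(** Minus the trace form is the inner product, whence the sign in [xi]. In an orthonormal frame xi_a
    is the sum over b of <T_b, H_ab> - 2 <T_b, H_ba> + <T_a, H_bb> + <J T_b, H_{Ja,b}>. *)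
Definition Kk a b c := \tr (Tt b *m Hh a c) - \tr (Tt b *m Hh c a) *+ 2
  + \tr (Tt a *m Hh b c) + \tr (J *m Tt b *m \sum_e J a e *: Hh e c).

Definition xi a := - \sum_b \sum_c G b c * Kk a b c.

Definition divergence := \sum_a \sum_b G a b * (der D a (xi b) - \sum_c Gam a b c * xi c).

Lemma der_imet a : dmx D a G = - ((Gam a)^T *m G + G *m Gam a).
Proof.
have h : dmx D a (met D) *m G + met D *m dmx D a G = 0.
  by rewrite -dmxM met_inv dmx1.
have Gm : G *m met D = 1%:M.
  have := congr1 trmx (met_inv D); rewrite trmx_mul met_sym trmx1 => e.
  by rewrite -[LHS]mul1mx -{1}e -mulmxA (mulmxA _ G) met_inv mul1mx e.
have -> : dmx D a G = - (G *m (dmx D a (met D) *m G)).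
  apply/eqP; rewrite -addr_eq0; apply/eqP.
  by rewrite -{1}[dmx D a G]mul1mx -Gm -mulmxA -mulmxDr addrC h mulmx0.
rewrite [dmx D a (met D)]met_par mulmxDl mulmxDr !mulmxA Gm mul1mx.
by rewrite -!(mulmxA _ (met D)) met_inv mulmx1 addrC.
Qed.

(** The inverse metric is parallel, so differentiation passes through the contraction. *)
Lemma der_contract (B : 'I_n -> 'I_n -> F) a :
  der D a (\sum_b \sum_c G b c * B b c) = \sum_b \sum_c G b c *
    (der D a (B b c) - \sum_e Gam a b e * B e c - \sum_e Gam a c e * B b e).
Proof.
rewrite der_sum; under eq_bigr do rewrite der_sum.
have -> : \sum_b \sum_c G b c *
    (der D a (B b c) - \sum_e Gam a b e * B e c - \sum_e Gam a c e * B b e)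
  = \sum_b \sum_c G b c * der D a (B b c)
    - \sum_b \sum_c ((Gam a)^T *m G) b c * B b c
    - \sum_b \sum_c (G *m Gam a) b c * B b c.
  have -> : \sum_b \sum_c ((Gam a)^T *m G) b c * B b c
     = \sum_b \sum_c G b c * \sum_e Gam a b e * B e c.
    under eq_bigr => b _ do under eq_bigr => c _ do rewrite mx_expand mulr_suml.
    under [RHS]eq_bigr => b _ do under eq_bigr => c _ do rewrite mulr_sumr.
    under eq_bigr do rewrite exchange_big /=.
    rewrite exchange_big; apply: eq_bigr => b _ /=; rewrite exchange_big.
    apply: eq_bigr => c _; apply: eq_bigr => e _ /=; rewrite mxE; ring.
  have -> : \sum_b \sum_c (G *m Gam a) b c * B b c
     = \sum_b \sum_c G b c * \sum_e Gam a c e * B b e.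
    apply: eq_bigr => b _.
    under eq_bigr => c _ do rewrite mx_expand mulr_suml.
    under [RHS]eq_bigr => c _ do rewrite mulr_sumr.
    rewrite exchange_big; apply: eq_bigr => c _; apply: eq_bigr => e _ /=; ring.
  rewrite -!sumrB; apply: eq_bigr => b _; rewrite -!sumrB; apply: eq_bigr => c _.
  ring.
rewrite -!sumrB; apply: eq_bigr => b _; rewrite -!sumrB; apply: eq_bigr => c _.
rewrite derM -dmxE der_imet !(mxaddE, mxoppE); ring.
Qed.

Lemma der_xi a b : der D a (xi b) - \sum_e Gam a b e * xi e =
  - \sum_c \sum_e G c e * (der D a (Kk b c e) - \sum_k Gam a b k * Kk k c e
      - \sum_k Gam a c k * Kk b k e - \sum_k Gam a e k * Kk b c k).
Proof.
rewrite /xi derN (der_contract (Kk b)).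
have -> : \sum_e Gam a b e * (- \sum_b0 \sum_c G b0 c * Kk e b0 c)
   = - \sum_c \sum_e G c e * \sum_k Gam a b k * Kk k c e.
  under eq_bigr do rewrite mulrN mulr_sumr.
  rewrite sumrN exchange_big; congr (- _); apply: eq_bigr => c _ /=.
  under eq_bigr do rewrite mulr_sumr.
  rewrite exchange_big; apply: eq_bigr => e _ /=; rewrite mulr_sumr.
  by apply: eq_bigr => k _; rewrite mulrCA.
rewrite -opprD; congr (- _); rewrite -sumrN -big_split; apply: eq_bigr => c _ /=.
rewrite -sumrN -big_split; apply: eq_bigr => e _ /=; ring.
Qed.

Lemma leibniz12 a (P : 'I_n -> 'M[F]_n) (W : 'I_n -> 'I_n -> 'M[F]_n) b c e :
  der D a (\tr (P b *m W c e))
  - \sum_k Gam a b k * \tr (P k *m W c e) - \sum_k Gam a c k * \tr (P b *m W k e)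
  - \sum_k Gam a e k * \tr (P b *m W c k)
  = \tr (cov1 D a P b *m W c e) + \tr (P b *m cov2 D a W c e).
Proof.
have sl k (B : 'M[F]_n) (Q : 'I_n -> 'M[F]_n) :
    \tr ((\sum_l Gam a k l *: Q l) *m B) = \sum_l Gam a k l * \tr (Q l *m B).
  rewrite mulmx_suml (raddf_sum mxtrace); apply: eq_bigr => l _.
  rewrite -scalemxAl; exact: mxtraceZ.
have sr k (B : 'M[F]_n) (Q : 'I_n -> 'M[F]_n) :
    \tr (B *m (\sum_l Gam a k l *: Q l)) = \sum_l Gam a k l * \tr (B *m Q l).
  rewrite mulmx_sumr (raddf_sum mxtrace); apply: eq_bigr => l _.
  rewrite -scalemxAr; exact: mxtraceZ.
rewrite der_trM /cov1 /cov2; move: (cov D a (P b)) (cov D a (W c e)) => U V.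
rewrite (mulmxBl U) (mulmxBr _ (V - _)) (mulmxBr _ V) !mxtraceB.
by rewrite sl (sr c _ (W^~ e)) (sr e _ (W c)); ring.
Qed.

Lemma cov2_contract a (A : 'M[F]_n) (W : 'I_n -> 'I_n -> 'M[F]_n) b e :
  cov2 D a (fun b e => \sum_k A b k *: W k e) b e =
  \sum_k cov D a A b k *: W k e + \sum_k A b k *: cov2 D a W k e.
Proof.
have E (V : 'I_n -> 'I_n -> 'M[F]_n) c :
    cov2 D a V c e = cov1 D a (V^~ e) c - \sum_l Gam a e l *: V c l by [].
rewrite E cov1_contract.
under [X in _ = _ + X]eq_bigr do rewrite E scalerBr scaler_sumr.
rewrite sumrB addrA; congr (_ - _).
rewrite [RHS]exchange_big; apply: eq_bigr => l _ /=; rewrite scaler_sumr.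
by apply: eq_bigr => k _; rewrite !scalerA mulrC.
Qed.

Definition DKk a b c e := \tr (Hh a c *m Hh b e) + \tr (Tt c *m Xx a b e)
  - (\tr (Hh a c *m Hh e b) + \tr (Tt c *m Xx a e b)) *+ 2
  + (\tr (Hh a b *m Hh c e) + \tr (Tt b *m Xx a c e))
  + (\tr ((Tt a *m Tt c + J *m Hh a c) *m \sum_k J b k *: Hh k e)
     + \tr (J *m Tt c *m (\sum_k Tt a b k *: Hh k e + \sum_k J b k *: Xx a k e))).

Lemma leibniz_Kk a b c e : der D a (Kk b c e) - \sum_k Gam a b k * Kk k c e
      - \sum_k Gam a c k * Kk b k e - \sum_k Gam a e k * Kk b c k = DKk a b c e.
Proof.
have h1 := leibniz12 a Tt Hh c b e; have h2 := leibniz12 a Tt Hh c e b.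
have h3 := leibniz12 a Tt Hh b c e.
have := leibniz12 a (fun k => J *m Tt k) (fun b e => \sum_k J b k *: Hh k e) c b e.
rewrite cov2_contract cov1Ml => h4.
rewrite /DKk -/(Xx _ _ _) -[Hh a c]/(cov1 D a Tt c) -[Hh a b]/(cov1 D a Tt b).
rewrite -h1 -h2 -h3 -h4.
have e4 (f : 'I_n -> F) (u v w z : 'I_n -> F) :
   \sum_k f k * (u k - v k *+ 2 + w k + z k) = \sum_k f k * u k
     - (\sum_k f k * v k) *+ 2 + \sum_k f k * w k + \sum_k f k * z k.
  rewrite -sumrMnl -sumrB -!big_split; apply: eq_bigr => k _ /=; ring.
have e5 (u v w z : F) : der D a (u - v *+ 2 + w + z)
    = der D a u - der D a v *+ 2 + der D a w + der D a z.
  by rewrite mulr2n !derD derN derD -mulr2n.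
rewrite /Kk !e4 e5; ring.
Qed.

Lemma divE : divergence = - \sum_a \sum_b G a b *
  \sum_c \sum_e G c e * DKk a b c e.
Proof.
rewrite /divergence -sumrN; apply: eq_bigr => a _; rewrite -sumrN; apply: eq_bigr => b _.
rewrite der_xi mulrN; congr (- (_ * _)).
by apply: eq_bigr => c _; apply: eq_bigr => e _; rewrite leibniz_Kk.
Qed.

End Fields.

Lemma eq_cov1 {F : comPzRingType} {n : nat} (D : calculus F n) i
    (P Q : 'I_n -> 'M[F]_n) j : P =1 Q -> cov1 D i P j = cov1 D i Q j.
Proof.
by move=> PQ; rewrite /cov1 PQ; congr (_ - _); apply: eq_bigr => k _; rewrite PQ.
Qed.

Lemma cov1Mr {F : comPzRingType} {n : nat} (D : calculus F n) i
    (P : 'I_n -> 'M[F]_n) (A : 'M[F]_n) j :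
  cov1 D i (fun k => P k *m A) j = cov1 D i P j *m A + P j *m cov D i A.
Proof.
rewrite /cov1 covM (mulmxBl (cov D i (P j))) mulmx_suml addrAC; congr (_ - _ + _).
by apply: eq_bigr => k _; rewrite scalemxAl.
Qed.

(** * Consequences of the almost Kaehler and Einstein conditions, and evaluation at an orthonormal
    point *)

Section AlmostKahlerEinstein.
Context {F : comPzRingType} {n : nat} (D : calculus F n) (J : 'M[F]_n) (lam : F).
Implicit Types (a b c e i j k : 'I_n).
Local Notation g := (met D).
Local Notation G := (imet D).
Local Notation Gam := (chr D).
Local Notation T := (Tt D J).
Local Notation H := (Hh D J).
Hypothesis JJ : J *m J = - 1%:M.
Hypothesis JgJ : J *m g *m J^T = g.
Hypothesis dOm : forall i j k, der D i ((J *m g) j k) + der D j ((J *m g) k i)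
  + der D k ((J *m g) i j) = 0.
Hypothesis ein : forall u v, \sum_k Rm D k u v k = lam * g u v.
Hypothesis dlam : forall i, der D i lam = 0.

Let gJ : g *m J^T = - (J *m g).
Proof.
rewrite -[X in _ = - (_ *m X)]JgJ !mulmxA JJ !mulNmx opprK.
by rewrite -mulmxA mul1mx.
Qed.

Lemma skew_J : skew D J.
Proof. by apply/skewP; rewrite trmx_mul met_sym. Qed.

Lemma skew_T a : skew D (T a). Proof. exact/skew_cov/skew_J. Qed.

Lemma TJ a : J *m T a = - (T a *m J).
Proof.
by apply/eqP; rewrite -addr_eq0 addrC -covM JJ covN cov1x oppr0.
Qed.

Lemma cyclic_T : cyclic D T.
Proof.
move=> a b c.
have E u v w : (T u *m g) v w = der D u ((J *m g) v w)
   - \sum_k Gam u v k * (J *m g) k w - \sum_k Gam u w k * (J *m g) v k.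
  have -> : T u *m g = dmx D u (J *m g) - Gam u *m (J *m g) - J *m g *m (Gam u)^T.
    by rewrite dmx_lower; mx_ring.
  rewrite !(mxaddE, mxoppE) dmxE; congr (_ - _ - _); first by rewrite mx_expand.
  by rewrite mx_expand; apply: eq_bigr => k _; rewrite [X in _ * X]mxE mulrC.
rewrite !E.
have S u v w : \sum_k Gam u v k * (J *m g) w k = - \sum_k Gam v u k * (J *m g) k w.
  by rewrite -sumrN; apply: eq_bigr => k _; rewrite chr_sym (skewE _ _ skew_J) mulrN.
rewrite (S a c) (S b a) (S c b); transitivity (0 : F); last by [].
rewrite -[RHS](dOm a b c); ring.
Qed.

Definition Eq a := \sum_c J a c *: T c - J *m T a.

(** Inserting J into one slot of the cyclic identity gives two vanishing sums. J can be moved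
    between the two matrix slots of T, and the difference of the sums says that the lowered defect
    [Eq] is invariant under rotation of its three indices. *)
Let Eq_cyc a b c : (Eq a *m g) b c = (Eq b *m g) c a.
Proof.
pose U1 a b c := \sum_e J a e * (T e *m g) b c.
pose U2 a b c := \sum_e J b e * (T a *m g) e c.
pose U3 a b c := \sum_e J c e * (T a *m g) b e.
have EE u v w : (Eq u *m g) v w = U1 u v w - U2 u v w.
  rewrite /Eq mulmxBl mxaddE mxoppE; congr (_ - _).
    by rewrite mulmx_suml summxE; apply: eq_bigr => k _; rewrite -scalemxAl mxscaleE.
  by rewrite -mulmxA mx_expand.
have U23 u v w : U2 u v w = U3 u v w.
  transitivity ((J *m T u *m g) v w); first by rewrite -mulmxA mx_expand.
  rewrite TJ mulNmx -mulmxA -[J *m g]opprK -gJ mulmxN opprK mulmxA mx_expand.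
  by apply: eq_bigr => k _; rewrite [X in _ * X]mxE mulrC.
have c1 : U1 a b c + U3 b c a + U2 c a b = 0.
  rewrite -!big_split big1 // => k _ /=.
  by rewrite -!mulrDr cyclic_T mulr0.
have c2 : U2 a b c + U1 b c a + U3 c a b = 0.
  rewrite -!big_split big1 // => k _ /=.
  by rewrite -!mulrDr cyclic_T mulr0.
rewrite !EE; apply/eqP; rewrite -subr_eq0; apply/eqP.
transitivity (U1 a b c + U3 b c a + U2 c a b - (U2 a b c + U1 b c a + U3 c a b)).
  rewrite -!U23; ring.
by rewrite c1 c2 subr0.
Qed.

(** J on the index of the defect [Eq] is the opposite of J on its matrix, so by [Eq_cyc] the tensor
    V = J Eq changes sign under rotation of its indices. Three rotations give V = -V, hence V = 0,
    and J is invertible. *)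
Lemma quasi_kahler b : \sum_c J b c *: T c = J *m T b.
Proof.
have JE u : \sum_c J u c *: Eq c = - (J *m Eq u).
  under eq_bigr do rewrite /Eq scalerBr scaler_sumr scalemxAr.
  rewrite sumrB exchange_big /= /Eq mulmxBr mulmxA JJ mulNmx mul1mx mulmx_sumr.
  under eq_bigr do under eq_bigr do rewrite scalerA.
  have -> : \sum_j \sum_i (J u i * J i j) *: T j = - T u.
    under eq_bigr do rewrite -scaler_suml -mx_expand JJ mxoppE scaleNr mxE.
    by rewrite sumrN sum_pick.
  by rewrite [RHS]opprB.
pose V a b c := (J *m Eq a *m g) b c.
have V2 u v w : V u v w = \sum_e J v e * (Eq u *m g) e w by rewrite /V -mulmxA mx_expand.
have V1 u v w : V u v w = - \sum_e J u e * (Eq e *m g) v w.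
  rewrite /V -[J *m _]opprK -JE mulNmx mxoppE mulmx_suml summxE; congr (- _).
  by apply: eq_bigr => k _; rewrite -scalemxAl mxscaleE.
have VN u v w : V u v w = - V v w u.
  rewrite [in RHS]V1 opprK V2; apply: eq_bigr => e _.
  by rewrite Eq_cyc.
have V0 u v w : V u v w = 0.
  apply: (two_reg D); rewrite {1}VN VN opprK {1}VN addNr //.
have h : J *m Eq b *m g = 0 by apply/matrixP => u v; rewrite [LHS]V0 mxE.
have h2 : J *m Eq b = 0.
  by rewrite -[J *m Eq b]mulmx1 -(met_inv D) mulmxA h mul0mx.
have : J *m (J *m Eq b) = - Eq b by rewrite mulmxA JJ mulNmx mul1mx.
rewrite h2 mulmx0 => /esym/eqP; rewrite oppr_eq0 subr_eq0 => /eqP; exact.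
Qed.

(** [quasi_kahler] and anticommutation make the trace of T J its own opposite. Hence J annihilates
    the trace of T, and J is invertible. *)
Lemma trace_T k : \sum_i T i k i = 0.
Proof.
have s0 v : \sum_i (T i *m J) v i = 0.
  apply: (two_reg D); rewrite -[X in _ + X]opprK -[X in _ - X]sumrN.
  apply/eqP; rewrite subr_eq0; apply/eqP.
  transitivity (\sum_i (\sum_c J i c *: T c) v i); last first.
    by apply: eq_bigr => i _; rewrite quasi_kahler TJ mxoppE.
  under eq_bigr do rewrite mx_expand.
  under [RHS]eq_bigr do rewrite summxE.
  rewrite [RHS]exchange_big; apply: eq_bigr => i _; apply: eq_bigr => c _ /=.
  by rewrite mxscaleE mulrC.
pose w : 'cV_n := \col_v \sum_i T i v i.
have Jw : J *m w = 0.
  apply/matrixP => u v; rewrite mxE mxzeroE.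
  transitivity (\sum_i (J *m T i) u i).
    under eq_bigr do rewrite mxE mulr_sumr.
    by rewrite exchange_big; apply: eq_bigr => i _ /=; rewrite mx_expand.
  under eq_bigr do rewrite TJ mxoppE.
  by rewrite sumrN s0 oppr0.
have : J *m (J *m w) = - w by rewrite mulmxA JJ mulNmx mul1mx.
rewrite Jw mulmx0 => /esym/eqP; rewrite oppr_eq0 => /eqP/matrixP/(_ k 0).
by rewrite !mxE.
Qed.

Lemma acs_hess a b : J *m H a b + H a b *m J = - (T a *m T b + T b *m T a).
Proof.
have : cov1 D a (fun k => J *m T k) b = cov1 D a (fun k => T k *m (- J)) b.
  by apply: eq_cov1 => k; rewrite TJ mulmxN.
rewrite cov1Ml cov1Mr covN !mulmxN -/(T a) -/(H a b) => h.
apply/eqP; rewrite -subr_eq0; apply/eqP.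
transitivity (T a *m T b + J *m H a b - (- (H a b *m J) - T b *m T a)).
  by mx_ring.
by rewrite h subrr.
Qed.

Lemma quasi_hess a b : \sum_c T a b c *: T c + \sum_c J b c *: H a c
  = T a *m T b + J *m H a b.
Proof.
rewrite -[RHS](cov1Ml D a J T b) -(eq_cov1 D a b quasi_kahler) cov1_contract.
by [].
Qed.

Lemma hess_comm_T a b : H a b - H b a = J *m Rm D a b - Rm D a b *m J.
Proof. exact: hess_comm. Qed.

Lemma third_comm c a b : Xx D J c a b - Xx D J a c b
  = T b *m Rm D c a - Rm D c a *m T b - \sum_e Rm D c a b e *: T e.
Proof. exact: cov1_comm. Qed.

Lemma cov_hess_comm c a b : Xx D J c a b - Xx D J c b a
  = J *m DRm D c a b - DRm D c a b *m J + (T c *m Rm D a b - Rm D a b *m T c).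
Proof.
have E (V : 'I_n -> 'I_n -> 'M[F]_n) : (forall u v, V u v = J *m Rm D u v - Rm D u v *m J) ->
    cov2 D c V a b = J *m DRm D c a b - DRm D c a b *m J + (T c *m Rm D a b - Rm D a b *m T c).
  move=> VE; rewrite /DRm /cov2 VE covD covN !covM -/(T c).
  have sE u (f : 'I_n -> 'M[F]_n) (h : 'I_n -> 'M[F]_n) :
      (forall l, f l = J *m h l - h l *m J) ->
      \sum_l Gam c u l *: f l = J *m (\sum_l Gam c u l *: h l) - (\sum_l Gam c u l *: h l) *m J.
    move=> fE; rewrite mulmx_sumr mulmx_suml -sumrB; apply: eq_bigr => l _.
    by rewrite fE scalerBr scalemxAr scalemxAl.
  rewrite (sE a _ (fun l => Rm D l b)) => [|l]; last exact: VE.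
  rewrite (sE b _ (Rm D a)) => [|l]; last exact: VE.
  move: (T c) (Rm D a b) (cov D c (Rm D a b)) (\sum_l Gam c a l *: Rm D l b)
    (\sum_l Gam c b l *: Rm D a l) => T0 V0 U S1 S2.
  mx_ring.
rewrite -(E (fun u v => H u v - H v u)) => [|u v]; last exact: hess_comm_T.
rewrite /Xx /cov2 covD covN.
have sB u (f h : 'I_n -> 'M[F]_n) : \sum_l Gam c u l *: (f l - h l)
    = \sum_l Gam c u l *: f l - \sum_l Gam c u l *: h l.
  by rewrite -sumrB; apply: eq_bigr => l _; rewrite scalerBr.
rewrite !sB.
move: (cov D c (H a b)) (cov D c (H b a)) (\sum_l Gam c a l *: H l b)
  (\sum_l Gam c b l *: H a l) (\sum_l Gam c b l *: H l a)
  (\sum_l Gam c a l *: H b l) => U V S1 S2 S3 S4.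
mx_ring.
Qed.

(** The Ricci tensor is a constant multiple of a parallel tensor. *)
Lemma einstein_cov c u v : \sum_k DRm D c k u v k = 0.
Proof.
have -> : \sum_k DRm D c k u v k = der D c (\sum_k Rm D k u v k)
    + \sum_k (Rm D k u *m Gam c) v k - \sum_k (Gam c *m Rm D k u) v k
    - \sum_k \sum_l Gam c k l * Rm D l u v k
    - \sum_k \sum_l Gam c u l * Rm D k l v k.
  rewrite /DRm; move: (Rm D) => W.
  rewrite der_sum -big_split -!sumrB; apply: eq_bigr => k _ /=.
  rewrite /cov2 !(mxaddE, mxoppE) dmxE !summxE.
  by congr (_ - _ - _); apply: eq_bigr => l _; rewrite mxscaleE.
have -> : \sum_k (Rm D k u *m Gam c) v k = \sum_k \sum_l Gam c k l * Rm D l u v k.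
  under eq_bigr do rewrite mx_expand.
  rewrite [RHS]exchange_big; apply: eq_bigr => l _ /=; apply: eq_bigr => k _.
  by rewrite mulrC.
have -> : \sum_k (Gam c *m Rm D k u) v k = lam * \sum_l Gam c v l * g u l.
  under eq_bigr do rewrite mx_expand.
  rewrite exchange_big mulr_sumr; apply: eq_bigr => l _ /=.
  by rewrite -mulr_sumr ein mulrCA.
have -> : \sum_k \sum_l Gam c u l * Rm D k l v k = lam * \sum_l Gam c u l * g l v.
  rewrite exchange_big mulr_sumr; apply: eq_bigr => l _ /=.
  by rewrite -mulr_sumr ein mulrCA.
rewrite ein derM dlam mul0r add0r.
have -> : der D c (g u v) = \sum_l Gam c u l * g l v + \sum_l Gam c v l * g u l.
  have /matrixP/(_ u v) := met_par D c; rewrite mxE => ->.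
  rewrite mxaddE !mx_expand; congr (_ + _); apply: eq_bigr => l _.
  by rewrite [X in _ * X]mxE mulrC.
ring.
Qed.

(** The second Bianchi identity with the pair symmetry. Summed over a, the right-hand side is a
    difference of derivatives of Ricci, so an Einstein metric has divergence-free curvature. *)
Lemma div_Rm a b c e : (DRm D a a b *m g) c e
  = (DRm D e a c *m g) b a - (DRm D c a e *m g) b a.
Proof.
have h : (DRm D a c e *m g) a b + (DRm D c e a *m g) a b + (DRm D e a c *m g) a b = 0.
  by rewrite -!mxaddE -!mulmxDl bianchi2 mul0mx mxzeroE.
have h2 : (DRm D c e a *m g) a b = - (DRm D c a e *m g) a b.
  by rewrite DRmN mulNmx mxoppE.
have gen (x y z w u v : F) : x + w + z = 0 -> w = - y -> u = - z -> v = - y -> x = u - v.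
  by move=> h0 e1 -> ->; move: h0; rewrite e1 => h0; apply/eqP; rewrite -subr_eq0 -h0; apply/eqP; ring.
rewrite (DRm_pair D a a b c e).
exact: (gen _ _ _ _ _ _ h h2 (skewE b a (skew_DRm D e a c)) (skewE b a (skew_DRm D c a e))).
Qed.

Section Evaluation.
(** [ev] models evaluation at a point where the coordinate basis is orthonormal; there, upper and
    lower indices agree. *)
Context {K : realFieldType} (ev : {rmorphism F -> K}).
Local Notation m := (map_mx ev).
Hypothesis ev_met : m g = 1%:M.

Let ev_inv : m G = 1%:M.
Proof. by rewrite -[LHS]mul1mx -ev_met -map_mxM met_inv map_mx1. Qed.

Let ev_skew (A : 'M[F]_n) : skew D A -> (m A)^T = - m A.
Proof.
have e : m A = m (A *m g) by rewrite map_mxM ev_met mulmx1.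
by move=> /skewP; rewrite e map_trmx => ->; rewrite map_mxN.
Qed.

Let ev_low (A : 'M[F]_n) i j : ev ((A *m g) i j) = m A i j.
Proof. by rewrite -[m A]mulmx1 -ev_met -map_mxM [RHS]mxE. Qed.

Let ev_sum (f : 'I_n -> F) (P : 'I_n -> 'M[F]_n) :
  m (\sum_c f c *: P c) = \sum_c ev (f c) *: m (P c).
Proof. by rewrite map_mx_sum; apply: eq_bigr => c _; rewrite map_mxZ. Qed.

Let ev_contract (f : 'I_n -> 'I_n -> F) :
  ev (\sum_a \sum_b G a b * f a b) = \sum_a ev (f a a).
Proof.
rewrite rmorph_sum; apply: eq_bigr => a _; rewrite rmorph_sum.
rewrite -(sum_pickM (fun b => ev (f a b)) a); apply: eq_bigr => b _.
have /matrixP/(_ a b) := ev_inv; rewrite !mxE => e.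
by rewrite rmorphM /= e.
Qed.

Let ev_tr (A B : 'M[F]_n) : ev (\tr (A *m B)) = - ip (m A) (m B).
Proof. by rewrite -trace_map_mx map_mxM ipE opprK. Qed.

Let mE (A : 'M[F]_n) i j : m A i j = ev (A i j). Proof. by rewrite mxE. Qed.

Lemma ev_tnorm : ev (tnorm D J) = \sum_a ip (m (T a)) (m (T a)).
Proof.
rewrite /tnorm rmorphN ev_contract -sumrN; apply: eq_bigr => a _.
by rewrite ev_tr opprK.
Qed.

Let H' a b := m (H a b).
Let T' a := m (T a).
Let X' c a b := m (Xx D J c a b).
Let J' := m J.

Lemma ev_div : ev (divergence D J) = \sum_a \sum_b (ip (H' a b) (H' a b)
     + ip (T' b) (X' a a b) - 2 * (ip (H' a b) (H' b a) + ip (T' b) (X' a b a))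
     + (ip (H' a a) (H' b b) + ip (T' a) (X' a b b))
     + \sum_e (T' a a e * ip (J' *m T' b) (H' e b)
                + J' a e * (ip (T' a *m T' b) (H' e b) + ip (J' *m H' a b) (H' e b)
                           + ip (J' *m T' b) (X' a e b)))).
Proof.
rewrite divE rmorphN ev_contract -sumrN; apply: eq_bigr => a _.
rewrite ev_contract -sumrN; apply: eq_bigr => b _.
have E (u1 u2 u3 u4 u5 u6 u7 u8 : F) :
    ev (u1 + u2 - (u3 + u4) *+ 2 + (u5 + u6) + (u7 + u8)) = ev u1 + ev u2
     - 2 * (ev u3 + ev u4) + (ev u5 + ev u6) + (ev u7 + ev u8).
  by rewrite mulr2n !(rmorphD, rmorphN) /=; ring.
rewrite /DKk E !ev_tr.
have e1 : m (T a *m T b + J *m H a b) = T' a *m T' b + J' *m H' a b.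
  by rewrite (map_mxD ev (T a *m T b)) !map_mxM.
have e2 : m (\sum_k T a a k *: H k b + \sum_k J a k *: Xx D J a k b)
    = \sum_k ev (T a a k) *: H' k b + \sum_k ev (J a k) *: X' a k b.
  by rewrite (map_mxD ev (\sum_k T a a k *: H k b)) !ev_sum.
have e3 : m (J *m T b) = J' *m T' b by rewrite map_mxM.
rewrite e1 e2 e3 ev_sum -/(H' a b) -/(H' b a) -/(T' a) -/(T' b).
have -> : \sum_e (T' a a e * ip (J' *m T' b) (H' e b)
     + J' a e * (ip (T' a *m T' b) (H' e b) + ip (J' *m H' a b) (H' e b)
                           + ip (J' *m T' b) (X' a e b)))
  = ip (T' a *m T' b + J' *m H' a b) (\sum_c ev (J a c) *: H' c b)
    + ip (J' *m T' b) (\sum_c ev (T a a c) *: H' c b + \sum_c ev (J a c) *: X' a c b).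
  rewrite ipDl ipDr !ip_sumr -!big_split; apply: eq_bigr => e _ /=.
  by rewrite !ipZr /J' /T' !mxE; ring.
rewrite /H' /T' /X' /J'.
repeat match goal with |- context [@ip ?A ?p ?U ?V] =>
  generalize (@ip A p U V); intro end.
ring.
Qed.

Theorem div_ge : 5 * ev (tnorm D J) ^+ 2 + 8 * n%:R * ev lam * ev (tnorm D J)
  <= 4 * n%:R * ev (divergence D J).
Proof.
rewrite ev_tnorm ev_div.
apply: (@sekigawa_inequality K n J' T' H' (fun a b => m (Rm D a b)) X'
  (fun c a b => m (DRm D c a b))).
- exact/ev_skew/skew_J.
- by rewrite -map_mxM JJ map_mxN map_mx1.
- by move=> a; exact/ev_skew/skew_T.
- by move=> a; rewrite -!map_mxM TJ map_mxN.
- by move=> a b c; rewrite -!ev_low -!rmorphD cyclic_T rmorph0.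
- by move=> b; rewrite -map_mxM -quasi_kahler ev_sum; under eq_bigr do rewrite mxE.
- by move=> a b; apply/ev_skew/skew_cov1 => k; exact: skew_T.
- move=> a b c e; rewrite -!ev_low -!rmorphD.
  by rewrite (cyclic_cov1 a cyclic_T) rmorph0.
- by move=> a b; rewrite -!map_mxM -!map_mxD acs_hess map_mxN.
- move=> a b; rewrite -!map_mxM -!map_mxD -quasi_hess map_mxD !ev_sum.
  by congr (_ + _); apply: eq_bigr => c _; rewrite mxE.
- move=> a k; under eq_bigr do rewrite mxE.
  by rewrite -rmorph_sum (trace_cov1 D a trace_T) rmorph0.
- by move=> a b; rewrite -!map_mxM -!map_mxB hess_comm_T.
- by move=> a b; rewrite {1}RmN map_mxN.
- by move=> a b; exact/ev_skew/skew_Rm.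
- by move=> a b c e; rewrite !mE -!rmorphD /= bianchi1 rmorph0.
- move=> a b c e; transitivity (ev ((Rm D a b *m g) c e)); first exact/esym/ev_low.
  transitivity (ev ((Rm D c e *m g) a b)); last exact: ev_low.
  exact: congr1 (Rm_pair D a b c e).
- move=> u v; under eq_bigr do rewrite mxE.
  rewrite -rmorph_sum ein rmorphM mulrC; congr (_ * _).
  by have /matrixP/(_ u v) := ev_met; rewrite !mxE.
- by move=> c a b; rewrite -!map_mxM -!map_mxB -map_mxD cov_hess_comm.
- move=> c a b.
  have e : m (\sum_e Rm D c a b e *: T e) = \sum_e m (Rm D c a) b e *: T' e.
    by rewrite ev_sum; apply: eq_bigr => e _; rewrite mE.
  by rewrite -e -!map_mxM -!map_mxB third_comm.
- move=> b; apply/matrixP => c e; rewrite summxE mxzeroE.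
  have z u v w : \sum_a m (DRm D u a v) w a = 0.
    under eq_bigr do rewrite mxE.
    by rewrite -rmorph_sum einstein_cov rmorph0.
  transitivity (\sum_a m (DRm D e a c) b a - \sum_a m (DRm D c a e) b a).
    rewrite -sumrB; apply: eq_bigr => a _; rewrite -!ev_low -rmorphB; congr (ev _).
    exact: div_Rm.
  by rewrite !z subrr.
- move=> k; under eq_bigr do rewrite mxE.
  by rewrite -rmorph_sum trace_T rmorph0.
Qed.

Lemma ev_tnorm_ge0 : 0 <= ev (tnorm D J).
Proof.
by rewrite ev_tnorm; apply: sumr_ge0 => a _; exact/ip_ge0/ev_skew/skew_T.
Qed.

Lemma ev_tnorm_eq0 a : ev (tnorm D J) = 0 -> m (T a) = 0.
Proof.
have sT b : (m (T b))^T = - m (T b) by exact/ev_skew/skew_T.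
rewrite ev_tnorm => /eqP; rewrite psumr_eq0 => [/allP/(_ a)|b _]; last exact: ip_ge0.
rewrite mem_index_enum => /(_ isT); rewrite /= ip_skew // => /eqP h.
have h2 i : \sum_j m (T a) i j ^+ 2 = 0.
  move/eqP: h; rewrite psumr_eq0 => [/allP/(_ i)|k _].
    by rewrite mem_index_enum => /(_ isT)/eqP.
  by apply: sumr_ge0 => l _; exact: sqr_ge0.
apply/matrixP => i j; rewrite mxzeroE; have /eqP := h2 i.
rewrite psumr_eq0 => [/allP/(_ j)|l _]; last exact: sqr_ge0.
by rewrite mem_index_enum => /(_ isT); rewrite /= sqrf_eq0 => /eqP.
Qed.

Lemma ev_star :
  2 * (\sum_(j < n) \sum_(k < n | (j < k)%N) (\sum_i (m J *m m (Rm D j i)) i k) * m J j k)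
  = n%:R * ev lam + ev (tnorm D J) / 2.
Proof.
rewrite ev_tnorm.
apply: (@star_scalarE K n J' T' H' (fun a b => m (Rm D a b))).
- exact/ev_skew/skew_J.
- by rewrite -map_mxM JJ map_mxN map_mx1.
- by move=> a; rewrite -!map_mxM TJ map_mxN.
- by move=> a b; apply/ev_skew/skew_cov1 => k; exact: skew_T.
- move=> a b c e; rewrite -!ev_low -!rmorphD.
  by rewrite (cyclic_cov1 a cyclic_T) rmorph0.
- by move=> a b; rewrite -!map_mxM -!map_mxD acs_hess map_mxN.
- move=> a k; under eq_bigr do rewrite mxE.
  by rewrite -rmorph_sum (trace_cov1 D a trace_T) rmorph0.
- by move=> a b; rewrite -!map_mxM -!map_mxB hess_comm_T.
- by move=> a b; rewrite {1}RmN map_mxN.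
- by move=> a b c e; rewrite !mE -!rmorphD /= bianchi1 rmorph0.
- move=> a b c e; transitivity (ev ((Rm D a b *m g) c e)); first exact/esym/ev_low.
  transitivity (ev ((Rm D c e *m g) a b)); last exact: ev_low.
  exact: congr1 (Rm_pair D a b c e).
- move=> u v; under eq_bigr do rewrite mxE.
  rewrite -rmorph_sum ein rmorphM mulrC; congr (_ * _).
  by have /matrixP/(_ u v) := ev_met; rewrite !mxE.
Qed.

End Evaluation.
End AlmostKahlerEinstein.

(** The lowered difference of two such connections is symmetric in its first two indices and skew in
    the last two; six alternating exchanges show it to be its own opposite. *)
Lemma chr_unique {F : comPzRingType} {n : nat} (D : calculus F n)
    (C : 'I_n -> 'M[F]_n) :
  (forall i j k, C i j k = C j i k) ->
  (forall i, dmx D i (met D) = C i *m met D + met D *m (C i)^T) ->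
  forall i, C i = chr D i.
Proof.
move=> Cs Cm i.
pose e i j k := ((C i - chr D i) *m met D) j k.
have es a b c : e a b c = e b a c.
  by rewrite /e !mx_expand; apply: eq_bigr => k _; rewrite !(mxaddE, mxoppE) Cs chr_sym.
have ea a b c : e a b c = - e a c b.
  apply/eqP; rewrite -addr_eq0; apply/eqP.
  have /matrixP/(_ b c) : (C a - chr D a) *m met D + ((C a - chr D a) *m met D)^T = 0.
    rewrite mulmxBl linearB /= !trmx_mul !met_sym.
    have := Cm a; rewrite [LHS]met_par => h.
    apply: subr0_eq; rewrite subr0; apply: etrans (subrr (chr D a *m met D + met D *m (chr D a)^T)).
    by rewrite {1}h; mx_ring.
  by rewrite mxaddE [X in _ + X = _]mxE mxzeroE.
have e0 a b c : e a b c = 0.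
  apply: (two_reg D); rewrite {1}ea {1}es {1}ea {1}es {1}ea {1}es.
  by rewrite ?opprK ?addNr.
have : (C i - chr D i) *m met D = 0 by apply/matrixP => a b; rewrite [LHS]e0 mxzeroE.
move=> h; apply: subr0_eq.
by rewrite -[LHS]mulmx1 -(met_inv D) mulmxA h mul0mx.
Qed.

Lemma mxtrace_sum {F : comPzRingType} {n m : nat} (h : 'I_m -> 'M[F]_n) :
  \tr (\sum_k h k) = \sum_k \tr (h k).
Proof. exact: raddf_sum. Qed.

(** * Covariance under a change of coordinates *)

Section Covariance.
Context {F F' : comPzRingType} {n : nat} (D : calculus F n) (D' : calculus F' n).
Context (phi : {rmorphism F' -> F}) (A B : 'M[F]_n) (J : 'M[F]_n) (J' : 'M[F']_n).
Implicit Types (a b c e i j k l : 'I_n).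
Local Notation f := (map_mx phi).
Hypothesis AB : A *m B = 1%:M.
Hypothesis BA : B *m A = 1%:M.
(** [phi] models the pullback of functions and [A] the Jacobian: this is the chain rule, and [der_A]
    is the symmetry of the second derivatives of the coordinate change. *)
Hypothesis der_phi : forall i x, der D i (phi x) = \sum_k A i k * phi (der D' k x).
Hypothesis der_A : forall i j k, der D i (A j k) = der D j (A i k).
Hypothesis met_A : met D = A *m f (met D') *m A^T.
Hypothesis acs_A : J *m A = A *m f J'.

Definition cj M := A *m f M *m B.

Lemma cjB M N : cj (M - N) = cj M - cj N.
Proof. by rewrite /cj map_mxB mulmxBr mulmxBl. Qed.
Lemma cjM M N : cj (M *m N) = cj M *m cj N.
Proof. by rewrite /cj map_mxM !mulmxA -(mulmxA _ B A) BA mulmx1. Qed.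
Lemma cjZ x M : cj (x *: M) = phi x *: cj M.
Proof. by rewrite /cj map_mxZ -scalemxAr -scalemxAl. Qed.
Lemma cj_sum (h : 'I_n -> 'M[F']_n) : cj (\sum_k h k) = \sum_k cj (h k).
Proof. by rewrite /cj map_mx_sum mulmx_sumr mulmx_suml. Qed.
Lemma tr_cj M : \tr (cj M) = phi (\tr M).
Proof. by rewrite /cj mxtrace_mulC mulmxA BA mul1mx trace_map_mx. Qed.

Lemma acs_cj : J = cj J'.
Proof. by rewrite /cj -acs_A -mulmxA AB mulmx1. Qed.

Lemma dmx_phi i (M : 'M[F']_n) : dmx D i (f M) = \sum_k A i k *: f (dmx D' k M).
Proof.
apply/matrixP => a b; rewrite summxE dmxE mxE der_phi; apply: eq_bigr => k _.
by rewrite !mxE.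
Qed.

(** No Koszul formula is transformed: the right-hand side defines a torsion-free metric connection,
    which [chr_unique] identifies. *)
Lemma chr_A i : chr D i *m A = dmx D i A + \sum_k A i k *: (A *m f (chr D' k)).
Proof.
pose C i := (dmx D i A + \sum_k A i k *: (A *m f (chr D' k))) *m B.
suff <- : C i = chr D i by rewrite /C -mulmxA BA mulmx1.
have CA u : C u *m A = dmx D u A + \sum_k A u k *: (A *m f (chr D' k)).
  by rewrite /C -mulmxA BA mulmx1.
apply: chr_unique => {i} [i j k | i].
  rewrite /C !mx_expand; apply: eq_bigr => l _; congr (_ * _).
  rewrite !mxaddE !dmxE der_A; congr (_ + _); rewrite !summxE.
  under eq_bigr do rewrite mxscaleE mx_expand mulr_sumr.
  rewrite exchange_big; apply: eq_bigr => m _ /=.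
  rewrite mxscaleE mx_expand mulr_sumr; apply: eq_bigr => p _.
  by rewrite !mxE (chr_sym D' p m) mulrCA.
have -> : C i *m met D = (dmx D i A + \sum_k A i k *: (A *m f (chr D' k))) *m f (met D') *m A^T.
  by rewrite met_A !mulmxA CA.
have -> : met D *m (C i)^T = A *m f (met D') *m (dmx D i A + \sum_k A i k *: (A *m f (chr D' k)))^T.
  by rewrite met_A -mulmxA -trmx_mul CA.
rewrite met_A !dmxM dmx_phi dmx_tr.
have -> : \sum_k A i k *: f (dmx D' k (met D'))
  = (\sum_k A i k *: f (chr D' k)) *m f (met D') + f (met D') *m (\sum_k A i k *: f (chr D' k))^T.
  rewrite linear_sum mulmx_suml mulmx_sumr -big_split; apply: eq_bigr => k _ /=.
  rewrite [dmx D' k (met D')]met_par map_mxD !map_mxM scalerDr -scalemxAl.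
  by rewrite linearZ /= -scalemxAr map_trmx.
have -> : \sum_k A i k *: (A *m f (chr D' k)) = A *m (\sum_k A i k *: f (chr D' k)).
  by rewrite mulmx_sumr; apply: eq_bigr => k _; rewrite scalemxAr.
move: (dmx D i A) (\sum_k A i k *: f (chr D' k)) (f (met D')) => U S0 g0.
have -> : (U + A *m S0)^T = U^T + S0^T *m A^T by rewrite linearD /= trmx_mul.
mx_ring.
Qed.

(** After multiplication by A on the right the inverse B disappears, so that its derivative never
    has to be computed. *)
Lemma cov_cj i M : cov D i (cj M) = \sum_k A i k *: cj (cov D' k M).
Proof.
suff h : cov D i (cj M) *m A = (\sum_k A i k *: cj (cov D' k M)) *m A.
  by rewrite -[LHS]mulmx1 -AB mulmxA h -mulmxA AB mulmx1.
have cA N : cj N *m A = A *m f N by rewrite /cj -mulmxA BA mulmx1.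
have dA : dmx D i (cj M) *m A + cj M *m dmx D i A = dmx D i A *m f M + A *m dmx D i (f M).
  by rewrite -!dmxM cA.
have -> : (\sum_k A i k *: cj (cov D' k M)) *m A = A *m dmx D i (f M)
   + A *m f M *m (\sum_k A i k *: f (chr D' k)) - A *m (\sum_k A i k *: f (chr D' k)) *m f M.
  rewrite mulmx_suml dmx_phi -!mulmxA mulmx_suml !mulmx_sumr -sumrN -!big_split.
  apply: eq_bigr => k _ /=; rewrite -scalemxAl cA /cov !(map_mxD, map_mxN, map_mxM).
  by rewrite -!scalemxAr -!scalemxAl -!scalemxAr -scalerDr -scalerBr; congr (_ *: _); mx_ring.
have {}cA := cA M; move: (cj M) cA dA => c0 cA dA.
have gA : chr D i *m A = dmx D i A + A *m (\sum_k A i k *: f (chr D' k)).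
  by rewrite chr_A mulmx_sumr; congr (_ + _); apply: eq_bigr => k _; rewrite scalemxAr.
rewrite /cov mulmxBl mulmxDl -(mulmxA c0) -(mulmxA _ c0) cA (mulmxA (chr D i)) gA.
rewrite (mulmxDr c0) (mulmxA c0 A) cA.
move: dA; move: (dmx D i c0) (dmx D i A) (dmx D i (f M)) => U W Z dA.
apply: subr0_eq; rewrite -[RHS](subrr (U *m A + c0 *m W)) {2}dA; mx_ring.
Qed.

Definition tf (P : 'I_n -> 'M[F']_n) i := \sum_k A i k *: cj (P k).
Definition tf2 (W : 'I_n -> 'I_n -> 'M[F']_n) i j :=
  \sum_k \sum_l (A i k * A j l) *: cj (W k l).

Lemma Tt_tf i : Tt D J i = tf (Tt D' J') i.
Proof. by rewrite /Tt {1}acs_cj cov_cj. Qed.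

Lemma cov1_tf i P j : cov1 D i (tf P) j = tf2 (fun k l => cov1 D' k P l) i j.
Proof.
rewrite /cov1 /tf cov_sum.
under eq_bigr do rewrite covZ cov_cj scaler_sumr.
have -> : \sum_k chr D i j k *: (\sum_l A k l *: cj (P l)) =
    \sum_l (chr D i *m A) j l *: cj (P l).
  under eq_bigr do rewrite scaler_sumr.
  rewrite exchange_big; apply: eq_bigr => l _ /=.
  by rewrite mx_expand scaler_suml; apply: eq_bigr => k _; rewrite scalerA.
have -> : \sum_l (chr D i *m A) j l *: cj (P l) = \sum_l der D i (A j l) *: cj (P l)
    + \sum_k \sum_l \sum_m (A i k * A j l) *: (phi (chr D' k l m) *: cj (P m)).
  have -> : \sum_k \sum_l \sum_m (A i k * A j l) *: (phi (chr D' k l m) *: cj (P m))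
     = \sum_m (\sum_k A i k * (A *m f (chr D' k)) j m) *: cj (P m).
    under eq_bigr do rewrite exchange_big /=.
    rewrite exchange_big; apply: eq_bigr => m _ /=; rewrite scaler_suml.
    apply: eq_bigr => k _; rewrite mx_expand mulr_sumr scaler_suml.
    by apply: eq_bigr => l _; rewrite scalerA mxE mulrA.
  rewrite -big_split; apply: eq_bigr => l _ /=; rewrite -scalerDl; congr (_ *: _).
  rewrite chr_A mxaddE dmxE summxE; congr (_ + _).
  by apply: eq_bigr => k _; rewrite mxscaleE.
rewrite big_split /= opprD addrACA subrr add0r /tf2 exchange_big -sumrB.
apply: eq_bigr => k _ /=; rewrite -sumrB; apply: eq_bigr => l _.
rewrite (cjB (cov D' k (P l))) scalerBr cj_sum scaler_sumr scalerA mulrC; congr (_ - _).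
by apply: eq_bigr => m _; rewrite cjZ.
Qed.

Lemma Hh_tf i j : Hh D J i j = tf2 (Hh D' J') i j.
Proof. by rewrite /Hh (eq_cov1 D i j Tt_tf) cov1_tf. Qed.

Definition tri (k : 'I_n -> 'I_n -> 'I_n -> F') a b c :=
  \sum_i \sum_j \sum_l A a i * A b j * A c l * phi (k i j l).

Lemma triD u v a b c : tri (fun i j l => u i j l + v i j l) a b c
  = tri u a b c + tri v a b c.
Proof.
rewrite -big_split; apply: eq_bigr => i _; rewrite -big_split; apply: eq_bigr => j _.
by rewrite -big_split; apply: eq_bigr => l _ /=; rewrite rmorphD mulrDr.
Qed.

Lemma triN u a b c : tri (fun i j l => - u i j l) a b c = - tri u a b c.
Proof.
rewrite -sumrN; apply: eq_bigr => i _; rewrite -sumrN; apply: eq_bigr => j _.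
by rewrite -sumrN; apply: eq_bigr => l _ /=; rewrite rmorphN mulrN.
Qed.

Lemma tr_tf P W a b c : \tr (tf P b *m tf2 W a c)
  = tri (fun i j l => \tr (P j *m W i l)) a b c.
Proof.
rewrite /tf mulmx_suml mxtrace_sum /tri [RHS]exchange_big; apply: eq_bigr => j _ /=.
rewrite /tf2 mulmx_sumr mxtrace_sum; apply: eq_bigr => i _ /=.
rewrite mulmx_sumr mxtrace_sum; apply: eq_bigr => l _ /=.
rewrite -scalemxAl -scalemxAr -cjM scalerA -tr_cj -mxtraceZ; congr (\tr (_ *: _)).
ring.
Qed.

Lemma tri_swap12 u a b c : tri u a b c = tri (fun i j l => u j i l) b a c.
Proof.
rewrite /tri exchange_big; apply: eq_bigr => j _; apply: eq_bigr => i _.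
by apply: eq_bigr => l _ /=; rewrite (mulrC (A a i)).
Qed.

Lemma tri_swap23 u a b c : tri u a b c = tri (fun i j l => u i l j) a c b.
Proof.
apply: eq_bigr => i _; rewrite exchange_big; apply: eq_bigr => l _.
by apply: eq_bigr => j _ /=; rewrite -(mulrA (A a i)) (mulrC (A b j)) mulrA.
Qed.

Lemma Kk_tri a b c : Kk D J a b c = tri (Kk D' J') a b c.
Proof.
rewrite /Kk mulr2n.
have -> : tri (fun a b c => \tr (Tt D' J' b *m Hh D' J' a c)
     - (\tr (Tt D' J' b *m Hh D' J' c a)) *+ 2 + \tr (Tt D' J' a *m Hh D' J' b c)
     + \tr (J' *m Tt D' J' b *m \sum_e J' a e *: Hh D' J' e c)) a b c =
  tri (fun a b c => \tr (Tt D' J' b *m Hh D' J' a c)) a b c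
  - (tri (fun a b c => \tr (Tt D' J' b *m Hh D' J' c a)) a b c +
     tri (fun a b c => \tr (Tt D' J' b *m Hh D' J' c a)) a b c)
  + tri (fun a b c => \tr (Tt D' J' a *m Hh D' J' b c)) a b c
  + tri (fun a b c => \tr (J' *m Tt D' J' b *m \sum_e J' a e *: Hh D' J' e c)) a b c.
  rewrite -triD -triN -!triD; apply: eq_bigr => i _; apply: eq_bigr => j _.
  by apply: eq_bigr => l _; rewrite mulr2n.
have TH u v w : \tr (Tt D J v *m Hh D J u w)
    = tri (fun a b c => \tr (Tt D' J' b *m Hh D' J' a c)) u v w.
  by rewrite Tt_tf Hh_tf tr_tf.
congr (_ - (_ + _) + _ + _); rewrite ?TH //.
- by rewrite tri_swap12 tri_swap23 tri_swap12.
- by rewrite tri_swap12 tri_swap23 tri_swap12.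
- by rewrite tri_swap12.
have -> : J *m Tt D J b = tf (fun k => J' *m Tt D' J' k) b.
  rewrite Tt_tf /tf mulmx_sumr; apply: eq_bigr => k _.
  by rewrite -scalemxAr {1}acs_cj cjM.
have -> : \sum_e J a e *: Hh D J e c = tf2 (fun i l => \sum_e J' i e *: Hh D' J' e l) a c.
  transitivity (\sum_k (J *m A) a k *: \sum_l A c l *: cj (Hh D' J' k l)).
    under eq_bigr do rewrite Hh_tf /tf2 scaler_sumr.
    rewrite exchange_big; apply: eq_bigr => k _ /=.
    rewrite mx_expand scaler_suml; apply: eq_bigr => e _.
    by rewrite !scaler_sumr; apply: eq_bigr => l _; rewrite !scalerA mulrA.
  rewrite acs_A /tf2.
  under eq_bigr do rewrite mx_expand scaler_suml.
  rewrite exchange_big; apply: eq_bigr => i _ /=.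
  under eq_bigr do rewrite scaler_sumr.
  rewrite exchange_big; apply: eq_bigr => l _ /=.
  rewrite cj_sum scaler_sumr; apply: eq_bigr => k _.
  by rewrite cjZ !scalerA mxE; congr (_ *: _); ring.
exact: tr_tf.
Qed.

Lemma inv_A : A^T *m imet D *m A = f (imet D').
Proof.
have iG : imet D = B^T *m f (imet D') *m B.
  have h : met D *m (B^T *m f (imet D') *m B) = 1%:M.
    rewrite met_A !mulmxA -(mulmxA _ A^T) -trmx_mul BA trmx1 mulmx1.
    by rewrite -(mulmxA A) -map_mxM met_inv map_mx1 mulmx1.
  have Gm : imet D *m met D = 1%:M.
    have := congr1 trmx (met_inv D); rewrite trmx_mul met_sym trmx1 => e.
    by rewrite -[LHS]mul1mx -{1}e -mulmxA (mulmxA _ (imet D)) met_inv mul1mx e.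
  by rewrite -[LHS]mulmx1 -h mulmxA Gm mul1mx.
by rewrite iG !mulmxA -trmx_mul BA trmx1 mul1mx -mulmxA BA mulmx1.
Qed.

Lemma contract_A (u : 'I_n -> 'I_n -> F) :
  \sum_b \sum_c imet D b c * (\sum_j \sum_l A b j * A c l * u j l)
  = \sum_j \sum_l phi (imet D' j l) * u j l.
Proof.
have e j l : phi (imet D' j l) = \sum_b \sum_c A b j * imet D b c * A c l.
  have /matrixP/(_ j l) := inv_A; rewrite [RHS]mxE => <-.
  rewrite mx_expand exchange_big; apply: eq_bigr => c _ /=.
  by rewrite mx_expand mulr_suml; apply: eq_bigr => b _; rewrite mxE.
transitivity (\sum_b \sum_c \sum_j \sum_l imet D b c * (A b j * A c l * u j l)).
  apply: eq_bigr => b _; apply: eq_bigr => c _; rewrite mulr_sumr.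
  by apply: eq_bigr => j _; rewrite mulr_sumr.
under eq_bigr do rewrite exchange_big /=.
rewrite exchange_big; apply: eq_bigr => j _ /=.
under eq_bigr do rewrite exchange_big /=.
rewrite exchange_big; apply: eq_bigr => l _ /=.
rewrite e mulr_suml; apply: eq_bigr => b _; rewrite mulr_suml.
by apply: eq_bigr => c _; ring.
Qed.

Lemma xi_A a : xi D J a = \sum_i A a i * phi (xi D' J' i).
Proof.
rewrite /xi.
have -> : \sum_b \sum_c imet D b c * Kk D J a b c
    = \sum_b \sum_c imet D b c * (\sum_j \sum_l A b j * A c l *
        (\sum_i A a i * phi (Kk D' J' i j l))).
  apply: eq_bigr => b _; apply: eq_bigr => c _; rewrite Kk_tri /tri; congr (_ * _).
  rewrite exchange_big; apply: eq_bigr => j _ /=.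
  rewrite exchange_big; apply: eq_bigr => l _ /=; rewrite mulr_sumr.
  by apply: eq_bigr => i _; ring.
rewrite contract_A -sumrN.
have -> : \sum_i A a i * phi (- (\sum_b \sum_c imet D' b c * Kk D' J' i b c))
   = - \sum_i \sum_j \sum_l A a i * (phi (imet D' j l) * phi (Kk D' J' i j l)).
  rewrite -sumrN; apply: eq_bigr => i _; rewrite rmorphN mulrN rmorph_sum mulr_sumr.
  congr (- _); apply: eq_bigr => j _; rewrite rmorph_sum mulr_sumr.
  by apply: eq_bigr => l _; rewrite rmorphM.
rewrite exchange_big -sumrN; apply: eq_bigr => j _ /=.
congr (- _); rewrite [RHS]exchange_big; apply: eq_bigr => l _ /=.
by rewrite mulr_sumr; apply: eq_bigr => i _; rewrite mulrCA.
Qed.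

Lemma tnorm_A : tnorm D J = phi (tnorm D' J').
Proof.
rewrite /tnorm rmorphN; congr (- _).
transitivity (\sum_j \sum_l phi (imet D' j l) * phi (\tr (Tt D' J' j *m Tt D' J' l))).
  rewrite -contract_A; apply: eq_bigr => b _; apply: eq_bigr => c _; congr (_ * _).
  rewrite !Tt_tf /tf mulmx_suml mxtrace_sum; apply: eq_bigr => j _ /=.
  rewrite mulmx_sumr mxtrace_sum; apply: eq_bigr => l _ /=.
  by rewrite -scalemxAl -scalemxAr -cjM scalerA -tr_cj -mxtraceZ.
rewrite rmorph_sum; apply: eq_bigr => j _; rewrite rmorph_sum.
by apply: eq_bigr => l _; rewrite rmorphM.
Qed.

(** The inhomogeneous term of [chr_A] cancels the derivative that falls on A when the transformed
    covector is differentiated. *)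
Lemma div_A : divergence D J = phi (divergence D' J').
Proof.
have e a b : der D a (xi D J b) - \sum_c chr D a b c * xi D J c =
   \sum_j \sum_l A a j * A b l *
     phi (der D' j (xi D' J' l) - \sum_m chr D' j l m * xi D' J' m).
  have -> : \sum_c chr D a b c * xi D J c = \sum_i (chr D a *m A) b i * phi (xi D' J' i).
    under eq_bigr do rewrite xi_A mulr_sumr.
    rewrite exchange_big; apply: eq_bigr => i _ /=.
    by rewrite mx_expand mulr_suml; apply: eq_bigr => c _; rewrite mulrA.
  rewrite chr_A xi_A der_sum -sumrB.
  have -> : \sum_j \sum_l A a j * A b l *
     phi (der D' j (xi D' J' l) - \sum_m chr D' j l m * xi D' J' m) =
     \sum_i (\sum_j A b i * (A a j * phi (der D' j (xi D' J' i)))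
       - (\sum_k A a k * (A *m f (chr D' k)) b i) * phi (xi D' J' i)).
    rewrite [RHS]sumrB.
    have -> : \sum_i (\sum_k A a k * (A *m f (chr D' k)) b i) * phi (xi D' J' i) =
       \sum_j \sum_l A a j * A b l * \sum_m phi (chr D' j l m * xi D' J' m).
      under eq_bigr do rewrite mulr_suml.
      rewrite exchange_big; apply: eq_bigr => k _ /=.
      under eq_bigr do rewrite mx_expand mulr_sumr mulr_suml.
      rewrite exchange_big; apply: eq_bigr => l _ /=; rewrite mulr_sumr.
      by apply: eq_bigr => i _; rewrite mxE rmorphM; ring.
    rewrite [X in _ = X - _]exchange_big -sumrB; apply: eq_bigr => j _ /=.
    rewrite -sumrB; apply: eq_bigr => l _; rewrite rmorphB rmorph_sum mulrBr.
    by congr (_ - _); rewrite mulrA (mulrC (A b l)).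
  apply: eq_bigr => i _; rewrite derM der_phi mxaddE dmxE summxE.
  under [X in _ - (_ + X) * _]eq_bigr do rewrite mxscaleE.
  rewrite mulr_sumr; ring.
rewrite /divergence rmorph_sum; under eq_bigr do under eq_bigr do rewrite e.
rewrite contract_A; apply: eq_bigr => j _; rewrite rmorph_sum.
by apply: eq_bigr => l _; rewrite rmorphM.
Qed.

End Covariance.

(** * Constant changes of basis *)

Section FrameChange.
Context {F : comPzRingType} {n : nat} (D : calculus F n) (E B : 'M[F]_n).
Implicit Types (a b c e i j k l : 'I_n) (x y : F).
Hypothesis EB : E *m B = 1%:M.
Hypothesis BE : B *m E = 1%:M.
(** Orthonormality is needed at one point only, so a constant E is enough: the new derivations still
    commute, and no orthonormal frame field has to be built in the ring. *)
Hypothesis dE : forall i j k, der D i (E j k) = 0.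
Local Notation d := (der D).

Let dB i : dmx D i B = 0.
Proof.
have dE0 : dmx D i E = 0 by apply/matrixP => j k; rewrite !mxE dE.
have : dmx D i (B *m E) = 0 by rewrite BE dmx1.
rewrite dmxM dE0 mulmx0 addr0 => h.
by rewrite -[LHS]mulmx1 -EB mulmxA h mul0mx.
Qed.

Let dE0 i : dmx D i E = 0.
Proof. by apply/matrixP => j k; rewrite !mxE dE. Qed.

Definition fder a x := \sum_i E a i * d i x.

Let fderD a x y : fder a (x + y) = fder a x + fder a y.
Proof. by rewrite -big_split; apply: eq_bigr => i _; rewrite derD mulrDr. Qed.

Let fderM a x y : fder a (x * y) = fder a x * y + x * fder a y.
Proof.
rewrite mulr_suml mulr_sumr -big_split; apply: eq_bigr => i _ /=; rewrite derM; ring.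
Qed.

Let fderC a b x : fder a (fder b x) = fder b (fder a x).
Proof.
have e u v : fder u (fder v x) = \sum_i \sum_j E u i * E v j * d i (d j x).
  apply: eq_bigr => i _; rewrite der_sum mulr_sumr; apply: eq_bigr => j _.
  by rewrite derM dE mul0r add0r mulrA.
rewrite !e exchange_big; apply: eq_bigr => i _; apply: eq_bigr => j _ /=.
by rewrite derC (mulrC (E a j)).
Qed.

Definition fcj (M : 'M[F]_n) := E *m M *m B.

Definition fchr a := \sum_i E a i *: fcj (chr D i).

Let fdmx a M : map_mx (fder a) M = \sum_i E a i *: dmx D i M.
Proof.
apply/matrixP => j k; rewrite mxE summxE; apply: eq_bigr => i _.
by rewrite mxscaleE dmxE.
Qed.

Let fdcj i M : dmx D i (fcj M) = fcj (dmx D i M).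
Proof. by rewrite /fcj !dmxM dE0 dB mul0mx add0r mulmx0 addr0. Qed.

Definition fmet := E *m met D *m E^T.

Let fmet_sym : fmet^T = fmet.
Proof. by rewrite /fmet !trmx_mul trmxK met_sym mulmxA. Qed.

Let fmet_inv : fmet *m (B^T *m imet D *m B) = 1%:M.
Proof.
rewrite /fmet !mulmxA -(mulmxA _ E^T) -trmx_mul BE trmx1 mulmx1.
by rewrite -(mulmxA E) met_inv mulmx1.
Qed.

Let fchr_sym a b c : fchr a b c = fchr b a c.
Proof.
have e u v : fchr u v c = \sum_i \sum_j \sum_k E u i * E v j * (chr D i j k * B k c).
  rewrite summxE; apply: eq_bigr => i _; rewrite mxscaleE /fcj -mulmxA mx_expand.
  rewrite mulr_sumr; apply: eq_bigr => j _; rewrite mx_expand !mulr_sumr.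
  by apply: eq_bigr => k _; rewrite mulrA.
rewrite !e exchange_big; apply: eq_bigr => i _; apply: eq_bigr => j _ /=.
by apply: eq_bigr => k _; rewrite chr_sym (mulrC (E a j)).
Qed.

Let fmet_par a : map_mx (fder a) fmet = fchr a *m fmet + fmet *m (fchr a)^T.
Proof.
rewrite fdmx /fchr linear_sum mulmx_suml mulmx_sumr -big_split.
apply: eq_bigr => i _ /=; rewrite linearZ /= -scalemxAl -scalemxAr -scalerDr.
congr (_ *: _); rewrite /fmet !dmxM dmx_tr dE0 trmx0 mulmx0 addr0 mul0mx add0r.
rewrite [dmx D i (met D)]met_par /fcj !trmx_mul mulmxDr mulmxDl !mulmxA.
congr (_ + _); first by rewrite -(mulmxA _ B) BE mulmx1.
by rewrite -(mulmxA _ E^T) -trmx_mul BE trmx1 mulmx1.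
Qed.

Definition frame_calculus : calculus F n :=
  Calculus fderD fderM fderC (two_reg D) fmet_sym fmet_inv fchr_sym fmet_par.

Variable J : 'M[F]_n.

(** A constant change of basis is a linear change of coordinates on the same functions, hence an
    instance of the covariance results with the identity as pullback. *)
Let idf := [the {rmorphism F -> F} of idfun].

Let map_id (M : 'M[F]_n) : map_mx idf M = M.
Proof. by apply/matrixP => i j; rewrite mxE. Qed.

Let idE i x : fder i (idf x) = \sum_k E i k * idf (d k x).
Proof. by []. Qed.

Let fdA i j k : fder i (E j k) = fder j (E i k).
Proof. by rewrite /fder !big1 // => l _; rewrite dE mulr0. Qed.

Let fJA : fcj J *m E = E *m map_mx idf J.
Proof. by rewrite map_id /fcj -mulmxA BE mulmx1. Qed.

Let fmA : fmet = E *m map_mx idf (met D) *m E^T.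
Proof. by rewrite map_id. Qed.

Lemma frame_tnorm : tnorm frame_calculus (fcj J) = tnorm D J.
Proof. exact: (@tnorm_A _ _ _ frame_calculus D idf E B _ _ EB BE idE fdA fmA fJA). Qed.

Lemma frame_div : divergence frame_calculus (fcj J) = divergence D J.
Proof. exact: (@div_A _ _ _ frame_calculus D idf E B _ _ EB BE idE fdA fmA fJA). Qed.

Let fcjM (M N : 'M[F]_n) : fcj M *m fcj N = fcj (M *m N).
Proof. by rewrite /fcj !mulmxA -(mulmxA _ B E) BE mulmx1. Qed.

Let fcjD (M N : 'M[F]_n) : fcj (M + N) = fcj M + fcj N.
Proof. by rewrite /fcj mulmxDr mulmxDl. Qed.

Let fcjN (M : 'M[F]_n) : fcj (- M) = - fcj M.
Proof. by rewrite /fcj mulmxN mulNmx. Qed.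

Lemma frame_Rm a b :
  Rm frame_calculus a b = \sum_i \sum_j (E a i * E b j) *: fcj (Rm D i j).
Proof.
have e u v : map_mx (fder u) (fchr v) = \sum_i \sum_j (E u i * E v j) *: fcj (dmx D i (chr D j)).
  rewrite fdmx; apply: eq_bigr => i _; rewrite dmx_sum scaler_sumr.
  by apply: eq_bigr => j _; rewrite dmxZ dE scale0r add0r fdcj scalerA.
have e2 u v : fchr u *m fchr v = \sum_i \sum_j (E u i * E v j) *: fcj (chr D i *m chr D j).
  rewrite mulmx_suml; apply: eq_bigr => i _; rewrite mulmx_sumr.
  by apply: eq_bigr => j _; rewrite -scalemxAl -scalemxAr scalerA fcjM.
rewrite /Rm [dmx frame_calculus a _]e [dmx frame_calculus b _]e [chr _ b *m _]e2 [chr _ a *m _]e2.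
rewrite [X in _ - X + _]exchange_big [X in _ + (X - _)]exchange_big -!sumrB -big_split.
apply: eq_bigr => i _ /=; rewrite -!sumrB -big_split; apply: eq_bigr => j _ /=.
rewrite (mulrC (E b j)) -!scalerBr -scalerDr; congr (_ *: _).
by rewrite !fcjD !fcjN.
Qed.

Variable lam : F.
Hypothesis JJ : J *m J = - 1%:M.
Hypothesis JgJ : J *m met D *m J^T = met D.
Hypothesis dOm : forall i j k, d i ((J *m met D) j k) + d j ((J *m met D) k i)
  + d k ((J *m met D) i j) = 0.
Hypothesis ein : forall u v, \sum_k Rm D k u v k = lam * met D u v.
Hypothesis dlam : forall i, d i lam = 0.

Let fOm : fcj J *m fmet = E *m (J *m met D) *m E^T.
Proof. by rewrite /fcj /fmet !mulmxA -(mulmxA _ B E) BE mulmx1. Qed.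

Let fdOm i j k : fder i ((fcj J *m fmet) j k) + fder j ((fcj J *m fmet) k i)
  + fder k ((fcj J *m fmet) i j) = 0.
Proof.
have e u v w : fder u ((fcj J *m fmet) v w) = \sum_a \sum_b \sum_c
    E u a * E v b * E w c * d a ((J *m met D) b c).
  apply: eq_bigr => a _; rewrite fOm -dmxE !dmxM dE0 mul0mx add0r dmx_tr dE0 trmx0 mulmx0 addr0.
  rewrite -dmxM -[E *m _ *m _]mulmxA !mx_expand mulr_sumr; apply: eq_bigr => b _.
  rewrite mx_expand !mulr_sumr; apply: eq_bigr => c _; rewrite dmxE [E^T _ _]mxE; ring.
rewrite !e.
have -> : \sum_a \sum_b \sum_c E j a * E k b * E i c * d a ((J *m met D) b c)
   = \sum_a \sum_b \sum_c E i a * E j b * E k c * d b ((J *m met D) c a).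
  rewrite exchange_big; under eq_bigr do rewrite exchange_big /=.
  rewrite exchange_big; apply: eq_bigr => a _ /=; rewrite exchange_big.
  by apply: eq_bigr => b _; apply: eq_bigr => c _ /=; congr (_ * _); ring.
have -> : \sum_a \sum_b \sum_c E k a * E i b * E j c * d a ((J *m met D) b c)
   = \sum_a \sum_b \sum_c E i a * E j b * E k c * d c ((J *m met D) a b).
  rewrite exchange_big; apply: eq_bigr => a _ /=; rewrite exchange_big.
  by apply: eq_bigr => b _; apply: eq_bigr => c _ /=; congr (_ * _); ring.
rewrite -!big_split big1 // => a _; rewrite -!big_split big1 // => b _.
by rewrite -!big_split big1 // => c _ /=; rewrite -!mulrDr dOm mulr0.
Qed.

Let fein u v : \sum_k Rm frame_calculus k u v k = lam * fmet u v.
Proof.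
have -> : \sum_k Rm frame_calculus k u v k
    = \sum_j \sum_p E u j * E v p * (\sum_i Rm D i j p i).
  have e k : Rm frame_calculus k u v k =
      \sum_i \sum_j \sum_p \sum_q E u j * E v p * (Rm D i j p q * (B q k * E k i)).
    rewrite frame_Rm summxE; apply: eq_bigr => i _; rewrite summxE; apply: eq_bigr => j _.
    rewrite mxscaleE /fcj -mulmxA mx_expand mulr_sumr; apply: eq_bigr => p _.
    by rewrite mx_expand !mulr_sumr; apply: eq_bigr => q _; ring.
  under eq_bigr do rewrite e.
  rewrite exchange_big.
  transitivity (\sum_i \sum_j \sum_p E u j * E v p * Rm D i j p i).
    apply: eq_bigr => i _ /=; rewrite exchange_big; apply: eq_bigr => j _ /=.
    rewrite exchange_big; apply: eq_bigr => p _ /=; rewrite exchange_big /=.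
    transitivity (\sum_q E u j * E v p * (Rm D i j p q * (i == q)%:R)).
      apply: eq_bigr => q _; rewrite -!mulr_sumr -mx_expand BE; congr (_ * (_ * _)).
      by rewrite mxE eq_sym.
    rewrite -mulr_sumr; congr (_ * _); rewrite -[RHS](sum_pickM (fun q => Rm D i j p q) i).
    by apply: eq_bigr => q _; rewrite mulrC.
  rewrite exchange_big; apply: eq_bigr => j _ /=; rewrite exchange_big.
  by apply: eq_bigr => p _ /=; rewrite mulr_sumr.
under eq_bigr do under eq_bigr do rewrite ein.
rewrite /fmet -mulmxA mx_expand mulr_sumr; apply: eq_bigr => j _.
rewrite mx_expand !mulr_sumr; apply: eq_bigr => p _.
rewrite [E^T _ _]mxE; ring.
Qed.

Let fdlam i : fder i lam = 0.
Proof. by rewrite /fder big1 // => k _; rewrite dlam mulr0. Qed.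

Let fJJ : fcj J *m fcj J = - 1%:M.
Proof. by rewrite fcjM JJ fcjN /fcj mulmx1 EB. Qed.

Let fJgJ : fcj J *m fmet *m (fcj J)^T = fmet.
Proof.
rewrite fOm /fcj trmx_mul [(E *m J)^T]trmx_mul !mulmxA -(mulmxA _ E^T) -trmx_mul BE.
by rewrite trmx1 mulmx1 /fmet -{2}JgJ !mulmxA.
Qed.

Section Point.
Context {K : realFieldType} (ev : {rmorphism F -> K}).
Local Notation m := (map_mx ev).
Hypothesis evE : m (E *m met D *m E^T) = 1%:M.

Theorem frame_div_ge :
  5 * ev (tnorm D J) ^+ 2 + 8 * n%:R * ev lam * ev (tnorm D J)
    <= 4 * n%:R * ev (divergence D J).
Proof.
rewrite -frame_tnorm -frame_div.
exact: (@div_ge _ _ frame_calculus (fcj J) lam fJJ fJgJ fdOm fein fdlam).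
Qed.

Lemma frame_tnorm_ge0 : 0 <= ev (tnorm D J).
Proof.
rewrite -frame_tnorm.
exact: (@ev_tnorm_ge0 _ _ frame_calculus (fcj J) fJJ fJgJ).
Qed.

Lemma frame_tnorm_eq0 a : ev (tnorm D J) = 0 -> m (Tt D J a) = 0.
Proof.
rewrite -frame_tnorm => t0.
have h i : m (Tt frame_calculus (fcj J) i) = 0.
  exact: (@ev_tnorm_eq0 _ _ frame_calculus (fcj J) fJJ fJgJ _ _ evE i t0).
have e : \sum_i B a i *: Tt frame_calculus (fcj J) i = fcj (Tt D J a).
  under eq_bigr => i _ do
    rewrite (@Tt_tf _ _ _ frame_calculus D idf E B _ _ EB BE idE fdA fmA fJA i) scaler_sumr.
  rewrite exchange_big /=.
  transitivity (\sum_k (a == k)%:R *: fcj (Tt D J k)); last exact: sum_pick.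
  apply: eq_bigr => k _.
  under eq_bigr do rewrite scalerA.
  rewrite -scaler_suml -mx_expand BE mxE; congr (_ *: _).
  by rewrite /cj map_id.
have : m (fcj (Tt D J a)) = 0.
  rewrite -e map_mx_sum big1 // => i _.
  by rewrite map_mxZ h scaler0.
move=> h2; have : m (B *m fcj (Tt D J a) *m E) = 0 by rewrite map_mxM (map_mxM ev B) h2 mulmx0 mul0mx.
by rewrite /fcj !mulmxA BE mul1mx -mulmxA BE mulmx1.
Qed.

Lemma frame_star :
  2 * (\sum_(j < n) \sum_(k < n | (j < k)%N)
    (\sum_i m (E *m J *m (\sum_a \sum_b (E j a * E i b) *: Rm D a b) *m B) i k)
    * m (E *m J *m B) j k)
  = n%:R * ev lam + ev (tnorm D J) / 2.
Proof.
rewrite -frame_tnorm.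
rewrite -(@ev_star _ _ frame_calculus (fcj J) lam fJJ fJgJ fdOm fein _ _ evE).
congr (_ * _); apply: eq_bigr => j _; apply: eq_bigr => k _; congr (_ * _).
apply: eq_bigr => i _; rewrite -map_mxM frame_Rm.
suff -> : \sum_i0 \sum_j0 (E j i0 * E i j0) *: fcj (Rm D i0 j0)
  = fcj (\sum_a \sum_b (E j a * E i b) *: Rm D a b).
  by rewrite fcjM /fcj mulmxA.
rewrite /fcj mulmx_sumr mulmx_suml; apply: eq_bigr => a _.
rewrite mulmx_sumr mulmx_suml; apply: eq_bigr => b _.
by rewrite -scalemxAr -scalemxAl.
Qed.

End Point.

End FrameChange.

From mathcomp Require Import perm.
From mathcomp Require Import all_classical all_reals all_analysis.
From mathcomp Require Import ring lra.
Require Import Defs.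
Import Order.TTheory GRing.Theory Num.Theory.
Import numFieldNormedType.Exports.
Local Open Scope classical_set_scope.
Local Open Scope ring_scope.

(** * Functions of class C^k on open subsets of R^n *)

Lemma differentiable_of_bound (R : numFieldType) (V W : normedModType R)
    (f : V -> W) (x : V) :
  (forall e : R, 0 < e -> \forall h \near (0 : V), `|f (x + h) - f x| <= e * `|h|) ->
  differentiable f x.
Proof.
move=> fe.
have o : f \o shift x = cst (f x) + (\0 : {linear V -> W}) +o_ 0 id.
  apply/eqaddoE/eqaddoP => e e0.
  near=> h; rewrite /= !fctE /= addr0.
  rewrite [h + x]addrC; near: h; exact: fe.
have c0 : continuous (\0 : {linear V -> W}) by move=> ?; exact: cvg_cst.
have du := diff_unique c0 o.
by apply/diff_locallyP; rewrite du; split.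
Unshelve. all: by end_near. Qed.

Section Partial.
Context {R : realType} {n : nat}.
Local Notation vec := 'rV[R]_n.
Implicit Types (f g : vec -> R) (x y v h : vec) (i j : 'I_n).

Definition pd i f : vec -> R := 'D_(delta_mx 0 i) f.

Lemma is_derive_line f y v s : derivable f (y + s *: v) v ->
  is_derive s 1 (fun t : R => f (y + t *: v)) ('D_v f (y + s *: v)).
Proof.
have e : (fun h : R => h^-1 *: (((fun t => f (y + t *: v)) \o shift s) (h *: 1)
     - f (y + s *: v))) =
   (fun h : R => h^-1 *: ((f \o shift (y + s *: v)) (h *: v) - f (y + s *: v))).
  rewrite funeqE => h /=; congr (_ *: (f _ - _)).
  by rewrite (mulr1 h : h *: (1 : R) = h) scalerDl addrCA.
move=> df; split; first by rewrite /derivable e.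
by rewrite /derive e.
Qed.

Lemma line_MVT f y v (c : R) :
  (forall s : R, `|s| <= `|c| -> derivable f (y + s *: v) v) ->
  exists2 s : R, `|s| <= `|c| & f (y + c *: v) - f y = c * 'D_v f (y + s *: v).
Proof.
move=> df.
pose psi := fun t : R => f (y + t *: v).
have dpsi (s : R) : `|s| <= `|c| -> is_derive s 1 psi ('D_v f (y + s *: v)).
  by move=> /df; exact: is_derive_line.
have cpsi (a b : R) : (forall s : R, s \in `[a, b] -> `|s| <= `|c|) ->
    {within `[a, b], continuous psi}.
  move=> ab; apply: derivable_within_continuous => s sab.
  by have [] := dpsi s (ab _ sab).
have [c0|c0] := leP 0 c.
  have h (s : R) : s \in `[0, c] -> `|s| <= `|c|.
    by rewrite in_itv /= => /andP[s0 sc]; rewrite !ger0_norm.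
  have [||s sc e] := @MVT_segment R psi (fun s => 'D_v f (y + s *: v)) 0 c c0.
  - by move=> s /subset_itv_oo_cc /h /dpsi.
  - exact: cpsi.
  exists s; first exact: h.
  by move: e; rewrite /psi scale0r addr0 subr0 mulrC.
have h (s : R) : s \in `[c, 0] -> `|s| <= `|c|.
  by rewrite in_itv /= => /andP[s0 sc]; rewrite (ler0_norm sc) ltr0_norm // lerN2.
have [||s sc e] := @MVT_segment R psi (fun s => 'D_v f (y + s *: v)) c 0 (ltW c0).
- by move=> s /subset_itv_oo_cc /h /dpsi.
- exact: cpsi.
exists s; first exact: h.
by move: e; rewrite /psi scale0r addr0 sub0r => e; rewrite -opprB e; ring.
Qed.

(** The truncations join 0 to h by steps parallel to the axes, inside the sup-norm ball of radius
    |h|. *)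
Definition trunc (h : vec) (k : nat) : vec := \row_i (if (i < k)%N then h 0 i else 0).

Lemma truncS h (k : 'I_n) : trunc h k.+1 = trunc h k + h 0 k *: delta_mx 0 k.
Proof.
apply/rowP => j; rewrite !mxE eqxx /= ltnS leq_eqVlt val_eqE.
by case: eqVneq => [->|jk] /=; rewrite ?ltnn ?mulr0 ?addr0 // mulr1 add0r.
Qed.

Lemma coord_le_norm (v : vec) i : `|v 0 i| <= `|v|.
Proof. by rewrite [leRHS]/Num.Def.normr /= mx_normrE; exact: (le_bigmax _ _ (0, i)). Qed.

Lemma norm_le_coord (v : vec) (e : R) : 0 <= e -> (forall i, `|v 0 i| <= e) -> `|v| <= e.
Proof.
move=> e0 h; rewrite [leLHS]/Num.Def.normr /= mx_normrE; apply: bigmax_le => // -[a b] _.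
by rewrite ord1.
Qed.

Lemma trunc_line_norm (h : vec) (k : 'I_n) (s : R) : `|s| <= `|h 0 k| ->
  `|trunc h k + s *: delta_mx 0 k| <= `|h|.
Proof.
move=> sh; apply: norm_le_coord => // i; rewrite !mxE eqxx /=.
have [ik|ik] := ltnP i k.
  by rewrite (_ : (i == k) = false) ?mulr0 ?addr0 ?coord_le_norm // -val_eqE ltn_eqF.
rewrite add0r; case: (i == k); last by rewrite mulr0 normr0.
by rewrite mulr1 (le_trans sh) // coord_le_norm.
Qed.

Lemma small_partials_bound f x (d M : R) :
  (forall y, `|y| < d -> forall i, derivable f (x + y) (delta_mx 0 i)) ->
  (forall y, `|y| < d -> forall i, `|pd i f (x + y)| <= M) ->
  forall h, `|h| < d -> `|f (x + h) - f x| <= M * `|h| *+ n.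
Proof.
move=> df Mf h hd.
have telescope m : (m <= n)%N -> `|f (x + trunc h m) - f x| <= M * `|h| *+ m.
  elim: m => [_|m IH mn].
    rewrite (_ : trunc h 0 = 0); last by apply/rowP => i; rewrite !mxE.
    by rewrite addr0 subrr normr0.
  pose k := Ordinal mn; rewrite (truncS h k) addrA.
  have tl (s : R) : `|s| <= `|h 0 k| -> `|trunc h k + s *: delta_mx 0 k| < d.
    by move=> sh; rewrite (le_lt_trans _ hd) // trunc_line_norm.
  have [|s sh e] := @line_MVT f (x + trunc h k) (delta_mx 0 k) (h 0 k).
    by move=> s sh; rewrite -addrA; apply: df; exact: tl.
  apply: le_trans (ler_distD (f (x + trunc h k)) _ _) _.
  rewrite mulrSr [leLHS]addrC; apply: lerD; first exact/IH/ltnW.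
  rewrite e normrM mulrC; apply: ler_pM => //; last exact: coord_le_norm.
  by rewrite -addrA; apply: Mf; exact: tl.
have hE : trunc h n = h by apply/rowP => i; rewrite !mxE ltn_ord.
by rewrite -{1}hE; exact: telescope.
Qed.

Definition linform (p : 'I_n -> R) (y : vec) : R := \sum_i p i * y 0 i.

Lemma linform_lin p (c : R) (v y : vec) :
  linform p (c *: v + y) = c * linform p v + linform p y.
Proof.
rewrite mulr_sumr -big_split; apply: eq_bigr => i _ /=; rewrite !mxE; ring.
Qed.

Lemma is_derive_linform p (x v : vec) : is_derive x v (linform p) (linform p v).
Proof.
have c : (fun h : R => h^-1 *: ((linform p \o shift x) (h *: v) - linform p x))
    @ 0^' --> linform p v.
  apply: cvg_near_cst; near=> h; have h0 : h != 0 by near: h; exact: nbhs_dnbhs_neq.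
  by rewrite /= linform_lin addrK; exact: (mulKf h0).
split; first by apply/cvg_ex; exists (linform p v).
exact: cvg_lim.
Unshelve. all: by end_near. Qed.

Lemma differentiable_linform p x : differentiable (linform p) x.
Proof.
rewrite (_ : linform p = \sum_i (fun y : vec => p i * y 0 i)); last first.
  by apply/funext => y; rewrite fct_sumE.
apply: differentiable_sum => i; apply: differentiableM; first exact: differentiable_cst.
exact: differentiable_coord.
Qed.

Lemma linform_delta p i : linform p (delta_mx 0 i) = p i.
Proof.
rewrite /linform (bigD1 i) //= mxE !eqxx mulr1 big1 ?addr0 // => j ji.
by rewrite mxE (negbTE ji) andbF mulr0.
Qed.

Lemma near0_shift (x : vec) (P : vec -> Prop) :
  (\forall y \near x, P y) -> exists2 d : R, 0 < d & forall y, `|y| < d -> P (x + y).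
Proof.
move=> /nbhs_ballP[d d0 Pd]; exists d => // y yd; apply: Pd.
by rewrite -ball_normE /= opprD addNKr normrN.
Qed.

(** Subtracting the linear form of the partial derivatives at x leaves a function whose partials are
    small near x, and whose increments [small_partials_bound] therefore controls. *)
Lemma C1_differentiable f x :
  (\forall y \near x, forall i, derivable f y (delta_mx 0 i)) ->
  (forall i, {for x, continuous (pd i f)}) -> differentiable f x.
Proof.
move=> df cf; pose p i := pd i f x; pose g := f - linform p.
have -> : f = g + linform p by rewrite /g subrK.
apply: differentiableD; last exact: differentiable_linform.
apply: differentiable_of_bound => e e0.
(* The path along the axes has n steps; dividing by n + 1 also covers n = 0. *)
have M0 : 0 < e / n.+1%:R by rewrite divr_gt0.
have nearp : \forall y \near x, forall i, `|pd i f y - p i| <= e / n.+1%:R.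
  have H i : \forall y \near x, `|pd i f y - p i| <= e / n.+1%:R.
    by have /cvgrPdist_le/(_ _ M0) := cf i; apply: filterS => y; rewrite distrC.
  exact: filter_forall H.
have [d1 d10 h1] := near0_shift df.
have [d2 d20 h2] := near0_shift nearp.
have gd y : `|y| < Order.min d1 d2 -> forall i,
    is_derive (x + y) (delta_mx 0 i) g (pd i f (x + y) - p i).
  rewrite lt_min => /andP[y1 y2] i; rewrite -(linform_delta p i); apply: is_deriveB.
    by split=> //; exact: h1.
  exact: is_derive_linform.
apply/nbhs_ballP; exists (Order.min d1 d2) => /=; first by rewrite lt_min d10.
move=> h; rewrite -ball_normE /= sub0r normrN => hd.
apply: le_trans (small_partials_bound (d := Order.min d1 d2) (M := e / n.+1%:R) _ _ hd) _.
- by move=> y yd i; have [] := gd y yd i.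
- move=> y yd i; have [_ v] := gd y yd i; rewrite /pd v; apply: h2.
  by move: yd; rewrite lt_min => /andP[].
rewrite -mulr_natr mulrAC ler_wpM2r //.
rewrite -mulrA ger_pMr // ler_pdivrMl ?ltr0n // mulr1 ler_nat //.
Qed.

Lemma derive_linform f x v : differentiable f x ->
  'D_v f x = \sum_i pd i f x * v 0 i.
Proof.
move=> df; rewrite deriveE // {1}(row_sum_delta v) linear_sum /=.
apply: eq_bigr => i _; rewrite linearZ /= mulrC /pd deriveE //.
Qed.

Lemma norm_delta (c : R) i : `|c *: (delta_mx 0 i : vec)| <= `|c|.
Proof.
apply: norm_le_coord => // j; rewrite !mxE eqxx; case: (j == i) => /=.
  by rewrite mulr1.
by rewrite mulr0 normr0.
Qed.

(** The second difference over a square of side s: the mean value theorem in direction i, for the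
    increment of f in direction j, and then in direction j. *)
Lemma double_MVT f x i j (d s : R) : `|s| + `|s| < d ->
  (forall y, `|y| < d -> derivable f (x + y) (delta_mx 0 i)) ->
  (forall y, `|y| < d -> derivable (pd i f) (x + y) (delta_mx 0 j)) ->
  exists2 y, `|y| <= `|s| + `|s| &
    f (x + s *: delta_mx 0 i + s *: delta_mx 0 j) - f (x + s *: delta_mx 0 i)
    - (f (x + s *: delta_mx 0 j) - f x) = s * (s * pd j (pd i f) (x + y)).
Proof.
move=> sd df ddf; pose u : vec := delta_mx 0 i; pose v : vec := delta_mx 0 j.
have small (a b : R) : `|a| <= `|s| -> `|b| <= `|s| -> `|a *: u + b *: v| <= `|s| + `|s|.
  move=> ha hb; apply: le_trans (ler_normD _ _) _; apply: lerD.
    exact: le_trans (norm_delta a i) ha.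
  exact: le_trans (norm_delta b j) hb.
pose phi (y : vec) := f (y + s *: v) - f y.
have dphi (a : R) : `|a| <= `|s| ->
    is_derive (x + a *: u) u phi (pd i f (x + (a *: u + s *: v)) - pd i f (x + a *: u)).
  move=> ha; apply: is_deriveB; last first.
    split=> //; apply: df; apply: le_lt_trans sd; rewrite -[a *: u]addr0 -(scale0r v).
    by apply: small => //; rewrite normr0.
  have dd : derivable f (x + (a *: u + s *: v)) u by apply: df; exact: le_lt_trans (small _ _ ha _) sd.
  have e : (fun h : R => h^-1 *: (((fun y => f (y + s *: v)) \o shift (x + a *: u)) (h *: u)
       - f (x + a *: u + s *: v))) =
     (fun h : R => h^-1 *: ((f \o shift (x + (a *: u + s *: v))) (h *: u)
       - f (x + (a *: u + s *: v)))).
    by rewrite funeqE => h /=; congr (_ *: (f _ - f _)); rewrite !addrA.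
  by split; [rewrite /derivable e | rewrite /derive e].
have [|a ha ea] := @line_MVT phi x u s.
  by move=> a /dphi[].
have [_ v1] := dphi a ha.
have [|b hb eb] := @line_MVT (pd i f) (x + a *: u) v s.
  move=> b hb; rewrite -addrA; apply: ddf; exact: le_lt_trans (small _ _ ha hb) sd.
exists (a *: u + b *: v); first exact: small.
change (phi (x + s *: u) - phi x = s * (s * pd j (pd i f) (x + (a *: u + b *: v)))).
by rewrite ea v1 addrA eb -addrA.
Qed.

(** The second difference is symmetric in i and j, so the two mixed derivatives agree at two points
    close to x; their continuity at x concludes. *)
Lemma schwarz f x i j :
  (\forall y \near x, forall k, derivable f y (delta_mx 0 k)) ->
  (\forall y \near x, forall k l, derivable (pd k f) y (delta_mx 0 l)) ->
  (forall k l, {for x, continuous (pd k (pd l f))}) ->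
  pd i (pd j f) x = pd j (pd i f) x.
Proof.
move=> df ddf cf.
have [d1 d10 h1] := near0_shift df.
have [d2 d20 h2] := near0_shift ddf.
apply/eqP; rewrite -subr_eq0 -normr_le0; apply/ler_addgt0Pl => e e0; rewrite addr0.
have e20 : 0 < e / 2 by rewrite divr_gt0.
have near k l : \forall y \near x, `|pd k (pd l f) x - pd k (pd l f) y| <= e / 2.
  by have /cvgrPdist_le/(_ _ e20) := cf k l.
have [d3 d30 h3] := near0_shift (near i j).
have [d4 d40 h4] := near0_shift (near j i).
pose d := Order.min (Order.min d1 d2) (Order.min d3 d4).
have d0 : 0 < d by rewrite !lt_min d10 d20 d30.
pose s := d / 4; have s0 : 0 < s by rewrite divr_gt0.
have sd : `|s| + `|s| < d by rewrite gtr0_norm // /s; lra.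
have dl y : `|y| < d -> [/\ `|y| < d1, `|y| < d2, `|y| < d3 & `|y| < d4].
  by rewrite !lt_min => /andP[/andP[-> ->] /andP[-> ->]].
have [||y1 hy1 e1] := @double_MVT f x i j d s sd.
- by move=> y /dl[+ _ _ _] => /h1.
- by move=> y /dl[_ + _ _] => /h2.
have [||y2 hy2 e2] := @double_MVT f x j i d s sd.
- by move=> y /dl[+ _ _ _] => /h1.
- by move=> y /dl[_ + _ _] => /h2.
have ss : s != 0 by rewrite gt_eqF.
have eq12 : pd j (pd i f) (x + y1) = pd i (pd j f) (x + y2).
  apply: (mulfI ss); apply: (mulfI ss); refine (etrans (esym e1) (etrans _ e2)).
  rewrite (addrAC x); move: (f (_ + _)) (f (x + _)) (f (x + _)) (f x) => a b c d'; ring.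
have [_ _ k3 _] := dl _ (le_lt_trans hy2 sd).
have [_ _ _ k4] := dl _ (le_lt_trans hy1 sd).
have h5 := h3 _ k3; have h6 := h4 _ k4; rewrite eq12 distrC in h6.
rewrite [e]splitr.
exact: le_trans (ler_distD (pd i (pd j f) (x + y2)) _ _) (lerD h5 h6).
Qed.

End Partial.

Section CkGeneral.
Context {R : realType} {n : nat} {W : normedModType R}.
Local Notation vec := 'rV[R]_n.
Implicit Types (f g : vec -> W) (U V : set vec).

Lemma nearU U (P : vec -> Prop) x : open U -> U x -> (forall y, U y -> P y) ->
  \forall y \near x, P y.
Proof. by move=> oU Ux h; apply: filterS (open_nbhs_nbhs (conj oU Ux)). Qed.

Lemma Ck_S k U f : Ck_on k.+1 U f -> Ck_on k U f.
Proof.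
elim: k f => [|k IH] f [cf df]; split=> // a.
by have [d1 d2] := df a; split=> //; exact: IH.
Qed.

Lemma Ck_sub k U V f : V `<=` U -> Ck_on k U f -> Ck_on k V f.
Proof.
move=> VU; elim: k f => [|k IH] f [cf df]; split=> //.
- by move=> x /VU/cf.
- by move=> x /VU/cf.
- by move=> a; have [d1 d2] := df a; split; [move=> x /VU/d1|exact: IH].
Qed.

Lemma continuous_near_eq f g (x : vec) : (\forall y \near x, f y = g y) ->
  {for x, continuous f} -> {for x, continuous g}.
Proof.
move=> fg cf; rewrite /prop_for /continuous_at -(nbhs_singleton fg).
exact: (cvg_trans (near_eq_cvg fg) cf).
Qed.

Lemma Ck_ext k U f g : open U -> (forall x, U x -> f x = g x) ->
  Ck_on k U f -> Ck_on k U g.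
Proof.
move=> oU; elim: k f g => [|k IH] f g fg [cf df]; split=> //.
- by move=> x Ux; apply: continuous_near_eq (cf x Ux); exact: nearU fg.
- by move=> x Ux; apply: continuous_near_eq (cf x Ux); exact: nearU fg.
move=> a; have [d1 d2] := df a; split=> [x Ux|].
  by apply: near_eq_derivable (d1 x Ux); exact: nearU fg.
by apply: IH d2 => x Ux; apply: near_eq_derive; exact: nearU fg.
Qed.

Lemma Ck_local k U f : (forall x, U x -> exists2 V, open V /\ V x & Ck_on k V f) ->
  Ck_on k U f.
Proof.
elim: k f => [|k IH] f h; split=> //.
- by move=> x /h[V [_ Vx] [cf _]]; exact: cf.
- by move=> x /h[V [_ Vx] [cf _]]; exact: cf.
move=> a; split=> [x /h[V [_ Vx] [_ df]]|].
  by have [d1 _] := df a; exact: d1.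
apply: IH => x /h[V VV [_ df]]; exists V => //; by case: (df a).
Qed.

Lemma Ck_continuous k U f x : Ck_on k U f -> U x -> {for x, continuous f}.
Proof. by case: k => [|k] [cf _]; exact: cf. Qed.

Lemma Ck_derivable k U f x a : Ck_on k.+1 U f -> U x -> derivable f x (delta_mx 0 a).
Proof. by move=> [_ df]; have [d1 _] := df a; exact: d1. Qed.

Lemma Ck_derive k U f a : Ck_on k.+1 U f -> Ck_on k U ('D_(delta_mx 0 a) f).
Proof. by move=> [_ df]; have [_ d1] := df a. Qed.

Lemma Ck_cst k U (c : W) : open U -> Ck_on k U (cst c).
Proof.
move=> oU; elim: k c => [|k IH] c; split=> //.
- by move=> x _; exact: cst_continuous.
- by move=> x _; exact: cst_continuous.
move=> a; split=> [x _|]; first exact: derivable_cst.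
rewrite (_ : 'D_(delta_mx 0 a) (cst c) = cst 0) //.
by apply/funext => x; rewrite derive_cst.
Qed.

Lemma Ck_add k U f g : open U -> Ck_on k U f -> Ck_on k U g -> Ck_on k U (f + g).
Proof.
move=> oU; elim: k f g => [|k IH] f g [cf df] [cg dg]; split=> //.
- by move=> x Ux; apply: continuousD; [exact: cf|exact: cg].
- by move=> x Ux; apply: continuousD; [exact: cf|exact: cg].
move=> a; have [d1 d2] := df a; have [e1 e2] := dg a; split=> [x Ux|].
  by apply: derivableD; [exact: d1|exact: e1].
apply: Ck_ext (IH _ _ d2 e2) => // x Ux.
by rewrite deriveD //; [exact: d1|exact: e1].
Qed.

End CkGeneral.

Section CkReal.
Context {R : realType} {n : nat}.
Local Notation vec := 'rV[R]_n.
Implicit Types (f g : vec -> R) (U V : set vec).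

Lemma Ck_mul k U f g : open U -> Ck_on k U f -> Ck_on k U g -> Ck_on k U (f * g).
Proof.
move=> oU; elim: k f g => [|k IH] f g kf kg; split=> //.
- by move=> x Ux; apply: continuousM; [exact: Ck_continuous kf Ux|exact: Ck_continuous kg Ux].
- by move=> x Ux; apply: continuousM; [exact: Ck_continuous kf Ux|exact: Ck_continuous kg Ux].
move=> a; split=> [x Ux|].
  by apply: derivableM; [exact: Ck_derivable kf Ux|exact: Ck_derivable kg Ux].
apply: (@Ck_ext _ _ _ _ _ (f * 'D_(delta_mx 0 a) g + g * 'D_(delta_mx 0 a) f)) => //.
  move=> x Ux; rewrite deriveM //; [exact: Ck_derivable kf Ux|exact: Ck_derivable kg Ux].
by apply: Ck_add => //; apply: IH; [exact: Ck_S|exact: Ck_derive|exact: Ck_S|exact: Ck_derive].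
Qed.

Lemma Ck_opp k U f : open U -> Ck_on k U f -> Ck_on k U (- f).
Proof.
move=> oU kf; rewrite (_ : - f = cst (-1) * f); first by apply: Ck_mul => //; exact: Ck_cst.
by apply/funext => x; rewrite -[RHS]/(-1 * f x) mulN1r.
Qed.

Lemma Ck_sum k U I (r : seq I) (P : pred I) (F : I -> vec -> R) : open U ->
  (forall i, P i -> Ck_on k U (F i)) -> Ck_on k U (\sum_(i <- r | P i) F i).
Proof.
move=> oU kF; elim/big_ind: _ => //; first exact: (Ck_cst _ 0).
by move=> f g; exact: Ck_add.
Qed.

Lemma Ck_prod k U I (r : seq I) (F : I -> vec -> R) : open U ->
  (forall i, Ck_on k U (F i)) -> Ck_on k U (fun x => \prod_(i <- r) F i x).
Proof.
move=> oU kF; elim: r => [|i r IH].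
  by apply: (@Ck_ext _ _ _ k U (cst (1 : R))) => [|x _|]; rewrite ?big_nil //; exact: Ck_cst.
by apply: (Ck_ext oU _ (Ck_mul oU (kF i) IH)) => x _; rewrite big_cons.
Qed.

Lemma Ck_inv k U f : open U -> (forall x, U x -> f x != 0) ->
  Ck_on k U f -> Ck_on k U (fun x => (f x)^-1).
Proof.
move=> oU f0; elim: k f f0 => [|k IH] f f0 kf; split=> //.
- by move=> x Ux; apply: continuousV; [exact: f0|exact: Ck_continuous kf Ux].
- by move=> x Ux; apply: continuousV; [exact: f0|exact: Ck_continuous kf Ux].
move=> a; split=> [x Ux|].
  by apply: derivableV; [exact: f0|exact: Ck_derivable kf Ux].
pose h x := (f x)^-1.
apply: (@Ck_ext _ _ _ _ _ (- (h * h * 'D_(delta_mx 0 a) f))) => //.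
  move=> x Ux; rewrite deriveV; [|exact: f0|exact: Ck_derivable kf Ux].
  rewrite -[LHS]/(- (h x * h x * 'D_(delta_mx 0 a) f x)) -[RHS]/(- (f x) ^- 2 * 'D_(delta_mx 0 a) f x).
  by rewrite mulNr /h expr2 invfM.
have kh : Ck_on k U h by apply: IH => //; exact: Ck_S.
apply: Ck_opp => //; apply: Ck_mul => //; last exact: Ck_derive.
exact: Ck_mul.
Qed.

Lemma Ck_linform k p : Ck_on k [set: vec] (linform p).
Proof.
have c x : {for x, continuous (linform p)} by exact: differentiable_continuous (differentiable_linform p x).
case: k => [|k]; split=> // a; split=> [x _|].
  by have [] := is_derive_linform p x (delta_mx 0 a).
rewrite (_ : 'D_(delta_mx 0 a) (linform p) = cst (p a)); first exact/Ck_cst/openT.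
by apply/funext => x; have [_ ->] := is_derive_linform p x (delta_mx 0 a); rewrite linform_delta.
Qed.

Lemma Ck_coord k i : Ck_on k [set: vec] (fun x => x 0 i).
Proof.
apply: Ck_ext (Ck_linform k (fun j => (j == i)%:R)) => [|x _]; first exact: openT.
rewrite /linform (bigD1 i) //= eqxx mul1r big1 ?addr0 // => j /negPf->.
by rewrite mul0r.
Qed.

Lemma Ck_differentiable k U f x : open U -> Ck_on k.+1 U f -> U x -> differentiable f x.
Proof.
move=> oU kf Ux; apply: C1_differentiable => [|i].
  by apply: nearU oU Ux _ => y Uy i; exact: Ck_derivable kf Uy.
exact: Ck_continuous (Ck_derive i kf) Ux.
Qed.

Lemma Ck_schwarz U f x i j : open U -> Ck_on 2 U f -> U x ->
  pd i (pd j f) x = pd j (pd i f) x.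
Proof.
move=> oU kf Ux; apply: schwarz.
- by apply: nearU oU Ux _ => y Uy k; exact: Ck_derivable kf Uy.
- by apply: nearU oU Ux _ => y Uy k l; exact: Ck_derivable (Ck_derive k kf) Uy.
- by move=> k l; exact: Ck_continuous (Ck_derive k (Ck_derive l kf)) Ux.
Qed.

End CkReal.

Section CkMatrix.
Context {R : realType} {n p q : nat}.
Local Notation vec := 'rV[R]_n.

Lemma Ck_entry k (U : set vec) (f : vec -> 'M[R]_(p, q)) i j : open U ->
  Ck_on k U f -> Ck_on k U (fun x => f x i j).
Proof.
move=> oU; elim: k f => [|k IH] f kf; split=> //.
- by move=> x Ux; exact: (@continuous_comp _ _ _ f (fun M : 'M[R]_(p, q) => M i j) x (Ck_continuous kf Ux) (@coord_continuous _ _ _ i j _)).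
- by move=> x Ux; exact: (@continuous_comp _ _ _ f (fun M : 'M[R]_(p, q) => M i j) x (Ck_continuous kf Ux) (@coord_continuous _ _ _ i j _)).
move=> a; split=> [x Ux|].
  by have /derivable_mxP := Ck_derivable (a := a) kf Ux; move=> /(_ i j).
apply: Ck_ext (IH _ (Ck_derive a kf)) => // x Ux.
by rewrite derive_mx ?mxE //; exact: Ck_derivable kf Ux.
Qed.

End CkMatrix.

Section CkComp.
Context {R : realType} {n m : nat}.
Local Notation vec := 'rV[R]_n.
Local Notation wec := 'rV[R]_m.

Lemma rV_differentiable (phi : vec -> wec) x :
  (forall i, differentiable (fun y => phi y 0 i) x) -> differentiable phi x.
Proof.
move=> dphi.
rewrite (_ : phi = \sum_i (fun y => phi y 0 i *: (delta_mx 0 i : wec))); last first.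
  apply/funext => y; rewrite fct_sumE {1}[phi y]row_sum_delta.
  by apply: eq_bigr.
apply: differentiable_sum => i; apply: differentiableZl; exact: dphi.
Qed.

Lemma pd_comp (phi : vec -> wec) (f : wec -> R) x a :
  (forall i, differentiable (fun y => phi y 0 i) x) -> differentiable f (phi x) ->
  pd a (f \o phi) x = \sum_i pd i f (phi x) * pd a (fun y => phi y 0 i) x.
Proof.
move=> dphi df; have dp := rV_differentiable dphi.
have dfp : differentiable (f \o phi) x by exact: differentiable_comp.
rewrite {1}/pd deriveE // diff_comp //= -deriveE // derive_linform; last exact: df.
apply: eq_bigr => i _; congr (_ * _); rewrite -deriveE // derive_mx ?mxE //.
exact: diff_derivable.
Qed.

Lemma Ck_comp k (U : set vec) (V : set wec) (phi : vec -> wec) (f : wec -> R) : open U -> open V ->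
  (forall x, U x -> V (phi x)) ->
  (forall i, Ck_on k U (fun y => phi y 0 i)) -> Ck_on k V f -> Ck_on k U (f \o phi).
Proof.
move=> oU oV UV.
have cp j : (forall i, Ck_on j U (fun y => phi y 0 i)) -> forall x, U x -> {for x, continuous phi}.
  move=> h x Ux; rewrite (_ : phi = \sum_i (fun y => phi y 0 i *: (delta_mx 0 i : wec))); last first.
    apply/funext => y; rewrite fct_sumE {1}[phi y]row_sum_delta; exact: eq_bigr.
  elim/big_ind: _ => [|f1 f2|i _]; first exact: (@cst_continuous _ _ (0 : wec)).
    exact: continuousD.
  by apply: continuousZr_tmp; exact: Ck_continuous (h i) Ux.
elim: k f => [|k IH] f kphi kf; split=> //.
- by move=> x Ux; apply: continuous_comp; [exact: cp kphi _ Ux|exact: Ck_continuous kf (UV _ Ux)].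
- by move=> x Ux; apply: continuous_comp; [exact: cp kphi _ Ux|exact: Ck_continuous kf (UV _ Ux)].
have dphi x i : U x -> differentiable (fun y => phi y 0 i) x.
  by move=> Ux; exact: Ck_differentiable oU (kphi i) Ux.
have df x : U x -> differentiable f (phi x).
  by move=> Ux; exact: Ck_differentiable oV kf (UV _ Ux).
move=> a; split=> [x Ux|].
  apply: diff_derivable; apply: differentiable_comp; last exact: df.
  by apply: rV_differentiable => i; exact: dphi.
apply: (@Ck_ext _ _ _ _ _ (\sum_i (pd i f \o phi) * pd a (fun y => phi y 0 i))) => //.
  move=> x Ux; rewrite -[RHS]/(pd a (f \o phi) x) pd_comp; last exact: df.
    by rewrite fct_sumE.
  by move=> i; exact: dphi.
apply: Ck_sum => // i _; apply: Ck_mul => //; last exact: Ck_derive.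
apply: IH; last exact: Ck_derive.
by move=> j; exact: Ck_S.
Qed.

End CkComp.

(** * The ring of smooth functions and its Levi-Civita connection *)

Section LeviCivita.
Context {F : comPzRingType} {n : nat} (der : 'I_n -> F -> F) (half : F) (g G : 'M[F]_n).
Hypothesis derD : forall i x y, der i (x + y) = der i x + der i y.
Hypothesis derM : forall i x y, der i (x * y) = der i x * y + x * der i y.
Hypothesis derC : forall i j x, der i (der j x) = der j (der i x).
Hypothesis halfE : half + half = 1.
Hypothesis g_sym : g^T = g.
Hypothesis gG : g *m G = 1%:M.
Hypothesis Gg : G *m g = 1%:M.

Definition koszul i j l := half * (der i (g j l) + der j (g i l) - der l (g i j)).

Definition lc_chr i : 'M[F]_n := (\matrix_(j, l) koszul i j l) *m G.

Let two_reg (x : F) : x + x = 0 -> x = 0.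
Proof. by move=> h; rewrite -[x]mul1r -halfE mulrDl -mulrDr h mulr0. Qed.

Let gs i j : g i j = g j i. Proof. by rewrite -{1}g_sym mxE. Qed.

Let lc_sym i j k : lc_chr i j k = lc_chr j i k.
Proof.
rewrite !mxE; apply: eq_bigr => l _; rewrite !mxE /koszul (gs i j).
by rewrite [der i _ + _]addrC.
Qed.

Let lc_par i : map_mx (der i) g = lc_chr i *m g + g *m (lc_chr i)^T.
Proof.
have e : lc_chr i *m g = \matrix_(j, l) koszul i j l by rewrite /lc_chr -mulmxA Gg mulmx1.
rewrite -{3}g_sym -trmx_mul e; apply/matrixP => j k; rewrite !mxE /koszul.
rewrite (gs k j) -mulrDr -[LHS]mul1r -halfE; move: (der _ _) (der _ _) (der _ _) => x y z; ring.
Qed.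

Definition levi_civita : calculus F n :=
  Calculus derD derM derC two_reg g_sym gG lc_sym lc_par.

End LeviCivita.

Section SmoothRing.
Context {R : realType} {n : nat} {U : set 'rV[R]_n}.
Local Notation vec := 'rV[R]_n.

(* A smooth function on U is represented by its extension by zero. *)
Definition sfun (oU : open U) :=
  {f : vec -> R | smooth_on U f /\ forall x, ~ U x -> f x = 0}.

Variable oU : open U.
Implicit Types (f g : sfun oU) (x : vec).

Definition clip (f : vec -> R) x := if `[< U x >] then f x else 0.

Lemma clipE (f : vec -> R) x : U x -> clip f x = f x.
Proof. by move=> Ux; rewrite /clip asboolT. Qed.

Lemma clip_smooth (f : vec -> R) : smooth_on U f ->
  smooth_on U (clip f) /\ forall x, ~ U x -> clip f x = 0.
Proof.
move=> sf; split=> [k|x Ux]; last by rewrite /clip asboolF.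
by apply: Ck_ext (sf k) => // x Ux; rewrite clipE.
Qed.

Definition mks (f : vec -> R) (sf : smooth_on U f) : sfun oU := exist _ _ (clip_smooth sf).

Lemma sfun_smooth f : smooth_on U (sval f). Proof. by case: (svalP f). Qed.

(** Extension by zero turns equality on U into equality of elements, as the ring axioms require. *)
Lemma sfunP f g : (forall x, U x -> sval f x = sval g x) -> f = g.
Proof.
case: f g => f [sf f0] [g [sg g0]] /= e.
suff fg : f = g by subst g; congr exist; exact: Prop_irrelevance.
by apply/funext => x; have [/e//|Ux] := pselect (U x); rewrite f0 // g0.
Qed.

Let s_cst c : smooth_on U (cst c : vec -> R). Proof. by move=> k; exact: Ck_cst. Qed.
Let s_add f g : smooth_on U (sval f + sval g).
Proof. by move=> k; apply: Ck_add => //; exact: sfun_smooth. Qed.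
Let s_opp f : smooth_on U (- sval f).
Proof. by move=> k; apply: Ck_opp => //; exact: sfun_smooth. Qed.
Let s_mul f g : smooth_on U (sval f * sval g).
Proof. by move=> k; apply: Ck_mul => //; exact: sfun_smooth. Qed.
Let s_pd i f : smooth_on U (pd i (sval f)).
Proof. by move=> k; apply: Ck_derive; exact: sfun_smooth. Qed.

Definition sfun_cst c := mks (s_cst c).
Definition sfun_add f g := mks (s_add f g).
Definition sfun_opp f := mks (s_opp f).
Definition sfun_mul f g := mks (s_mul f g).
Definition sfun_pd i f := mks (s_pd i f).

Let addE f g x : U x -> sval (sfun_add f g) x = sval f x + sval g x.
Proof. exact: clipE. Qed.
Let oppE f x : U x -> sval (sfun_opp f) x = - sval f x.
Proof. exact: clipE. Qed.
Let mulE f g x : U x -> sval (sfun_mul f g) x = sval f x * sval g x.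
Proof. exact: clipE. Qed.
Let cstE c x : U x -> sval (sfun_cst c) x = c.
Proof. exact: clipE. Qed.

HB.instance Definition _ := gen_eqMixin (sfun oU).
HB.instance Definition _ := gen_choiceMixin (sfun oU).

Let addA : associative sfun_add.
Proof. by move=> f g h; apply: sfunP => x Ux; rewrite !(addE, oppE, mulE, cstE) // addrA. Qed.
Let addC : commutative sfun_add.
Proof. by move=> f g; apply: sfunP => x Ux; rewrite !addE // addrC. Qed.
Let add0 : left_id (sfun_cst 0) sfun_add.
Proof. by move=> f; apply: sfunP => x Ux; rewrite !(addE, oppE, mulE, cstE) // add0r. Qed.
Let addN : left_inverse (sfun_cst 0) sfun_opp sfun_add.
Proof. by move=> f; apply: sfunP => x Ux; rewrite !(addE, oppE, mulE, cstE) // addNr. Qed.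

HB.instance Definition _ := GRing.isZmodule.Build (sfun oU) addA addC add0 addN.

Let mulA : associative sfun_mul.
Proof. by move=> f g h; apply: sfunP => x Ux; rewrite !(addE, oppE, mulE, cstE) // mulrA. Qed.
Let mulC : commutative sfun_mul.
Proof. by move=> f g; apply: sfunP => x Ux; rewrite !mulE // mulrC. Qed.
Let mul1 : left_id (sfun_cst 1) sfun_mul.
Proof. by move=> f; apply: sfunP => x Ux; rewrite !(addE, oppE, mulE, cstE) // mul1r. Qed.
Let mulD : left_distributive sfun_mul sfun_add.
Proof. by move=> f g h; apply: sfunP => x Ux; rewrite !(addE, oppE, mulE, cstE) // mulrDl. Qed.

HB.instance Definition _ := GRing.Zmodule_isComPzRing.Build (sfun oU) mulA mulC mul1 mulD.

(** Membership in U is an argument because evaluation is a ring morphism only there: outside U even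
    the unit evaluates to 0. *)
Definition sev x (Ux : U x) f : R := sval f x.

Lemma sev_zmod x (Ux : U x) : zmod_morphism (sev Ux).
Proof. by move=> f g; rewrite /sev addE // oppE. Qed.

Lemma sev_mono x (Ux : U x) : monoid_morphism (sev Ux).
Proof. by split=> [|f g]; rewrite /sev ?cstE ?mulE. Qed.

#[local] Arguments sev : simpl never.
HB.instance Definition _ x (Ux : U x) := GRing.isZmodMorphism.Build (sfun oU) R (sev Ux) (sev_zmod Ux).
HB.instance Definition _ x (Ux : U x) := GRing.isMonoidMorphism.Build (sfun oU) R (sev Ux) (sev_mono Ux).

Lemma sfun_evP f g : (forall x (Ux : U x), sev Ux f = sev Ux g) -> f = g.
Proof. by move=> h; apply: sfunP => x Ux; exact: h. Qed.

Lemma sev_cst c x (Ux : U x) : sev Ux (sfun_cst c) = c.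
Proof. exact: clipE. Qed.

Lemma cst_zmod : zmod_morphism sfun_cst.
Proof. by move=> a b; apply: sfun_evP => x Ux; rewrite rmorphB /= !sev_cst. Qed.

Lemma cst_mono : monoid_morphism sfun_cst.
Proof. by split=> [|a b]; apply: sfun_evP => x Ux; rewrite ?rmorphM ?rmorph1 /= ?sev_cst. Qed.

HB.instance Definition _ := GRing.isZmodMorphism.Build R (sfun oU) sfun_cst cst_zmod.
HB.instance Definition _ := GRing.isMonoidMorphism.Build R (sfun oU) sfun_cst cst_mono.

Lemma sev_pd i f x (Ux : U x) : sev Ux (sfun_pd i f) = pd i (sval f) x.
Proof. exact: clipE. Qed.

Lemma sev_mks (f : vec -> R) sf x (Ux : U x) : sev Ux (@mks f sf) = f x.
Proof. exact: clipE. Qed.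

Lemma pd_eq (f g : vec -> R) x i : U x -> (forall y, U y -> f y = g y) -> pd i f x = pd i g x.
Proof. by move=> Ux fg; apply: near_eq_derive; exact: nearU fg. Qed.

Lemma sval_mks (f : vec -> R) sf i x : U x -> pd i (sval (@mks f sf)) x = pd i f x.
Proof. by move=> Ux; apply: pd_eq => // y Uy; rewrite [LHS]clipE. Qed.

Lemma pd_derivable f x i : U x -> derivable (sval f) x (delta_mx 0 i).
Proof. exact: Ck_derivable (sfun_smooth f 1). Qed.

Lemma sfun_pdD i f g : sfun_pd i (f + g) = sfun_pd i f + sfun_pd i g.
Proof.
apply: sfun_evP => x Ux; rewrite rmorphD /= !sev_pd.
rewrite (pd_eq _ (g := sval f + sval g)) //; last by move=> y Uy; rewrite [LHS]clipE.
by rewrite /pd deriveD //; exact: pd_derivable.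
Qed.

Lemma sfun_pdM i f g : sfun_pd i (f * g) = sfun_pd i f * g + f * sfun_pd i g.
Proof.
apply: sfun_evP => x Ux; rewrite rmorphD !rmorphM /= !sev_pd.
rewrite (pd_eq _ (g := sval f * sval g)) //; last by move=> y Uy; rewrite [LHS]clipE.
by rewrite /pd deriveM; [rewrite addrC [X in X + _]mulrC|exact: pd_derivable|exact: pd_derivable].
Qed.

Lemma sfun_pdC i j f : sfun_pd i (sfun_pd j f) = sfun_pd j (sfun_pd i f).
Proof.
apply: sfun_evP => x Ux; rewrite !sev_pd.
transitivity (pd i (pd j (sval f)) x); first by apply: pd_eq => // y Uy; exact: clipE.
transitivity (pd j (pd i (sval f)) x); last by apply: pd_eq => // y Uy; rewrite [RHS]clipE.
by apply: Ck_schwarz Ux => //; exact: sfun_smooth.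
Qed.

Lemma sfun_pd_cst i c : sfun_pd i (sfun_cst c) = 0.
Proof.
apply: sfun_evP => x Ux; rewrite rmorph0 sev_pd (pd_eq _ (g := cst c)) ?/pd ?derive_cst // => y Uy; exact: clipE.
Qed.

Lemma sfun_half : sfun_cst 2^-1 + sfun_cst 2^-1 = 1.
Proof. by rewrite -rmorphD /= -(rmorph1 sfun_cst); congr sfun_cst; lra. Qed.

Definition smx (A : vec -> 'M[R]_n) (sA : forall i j, smooth_on U (fun x => A x i j)) : 'M[sfun oU]_n :=
  \matrix_(i, j) mks (sA i j).

Lemma smxE A sA x (Ux : U x) : map_mx (sev Ux) (@smx A sA) = A x.
Proof. by apply/matrixP => i j; rewrite !mxE sev_mks. Qed.

Lemma sfun_mxP (A B : 'M[sfun oU]_n) :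
  (forall x (Ux : U x), map_mx (sev Ux) A = map_mx (sev Ux) B) -> A = B.
Proof.
move=> h; apply/matrixP => i j; apply: sfun_evP => x Ux.
by have /matrixP/(_ i j) := h x Ux; rewrite !mxE.
Qed.

Lemma sev_mx x (Ux : U x) p q (A : 'M[sfun oU]_(p, q)) i j : sev Ux (A i j) = map_mx (sev Ux) A i j.
Proof. by rewrite mxE. Qed.

End SmoothRing.
Arguments sev : simpl never.
Arguments clip : simpl never.
Arguments sfun_mul : simpl never.
Arguments sfun_add : simpl never.
Arguments sfun_opp : simpl never.
Arguments sfun_cst : simpl never.
Arguments sfun_pd : simpl never.

(** * Determinants, inverses and orthonormal frames *)

Section DetSmooth.
Context {R : realType} {n : nat} {U : set 'rV[R]_n}.
Hypothesis oU : open U.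

Lemma det_smooth p (A : 'rV[R]_n -> 'M[R]_p) : (forall i j, smooth_on U (fun x => A x i j)) ->
  smooth_on U (fun x => \det (A x)).
Proof.
move=> sA k; apply: (@Ck_ext _ _ _ k U (\sum_(s : 'S_p) (cst ((-1) ^+ s) * (fun x => \prod_i A x i (s i))))) => //.
  by move=> x _; rewrite fct_sumE.
apply: Ck_sum => // s _; apply: Ck_mul => //; first exact: Ck_cst.
by apply: Ck_prod => // i; exact: sA.
Qed.

Lemma invmx_smooth (A : 'rV[R]_n -> 'M[R]_n) : (forall i j, smooth_on U (fun x => A x i j)) ->
  (forall x, U x -> A x \in unitmx) -> forall i j, smooth_on U (fun x => invmx (A x) i j).
Proof.
move=> sA uA i j k.
pose M x := row' j (col' i (A x)).
apply: (@Ck_ext _ _ _ k U ((fun x => (\det (A x))^-1) * (cst ((-1) ^+ (j + i)) * (fun x => \det (M x))))) => //.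
  by move=> x /uA ux; rewrite /invmx ux !mxE /cofactor.
apply: Ck_mul => //.
  apply: Ck_inv => //; last exact: det_smooth.
  by move=> x /uA; rewrite unitmxE unitfE.
apply: Ck_mul => //; first exact: Ck_cst.
apply: det_smooth => a b; rewrite /M.
rewrite (_ : (fun x => _) = (fun x => A x (lift j a) (lift i b))) //.
by apply/funext => x; rewrite !mxE.
Qed.

End DetSmooth.

Section Bilinear.
Context {R : realType} {n : nat}.
Implicit Types (B : 'M[R]_n) (u v w : 'rV[R]_n).

Lemma bilE B u v : bil B u v = \sum_i \sum_j u 0 i * v 0 j * B i j.
Proof.
rewrite /bil mxE exchange_big; apply: eq_bigr => j _; rewrite !mxE mulr_suml.
by apply: eq_bigr => i _; rewrite mulrAC.
Qed.

Lemma bil_delta B i j : bil B (delta_mx 0 i) (delta_mx 0 j) = B i j.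
Proof. by rewrite /bil -rowE trmx_delta -colE !mxE. Qed.

Lemma bil_rows m B (A C : 'M[R]_(m, n)) i j : bil B (row i A) (row j C) = (A *m B *m C^T) i j.
Proof.
rewrite /bil -row_mul mxE [RHS]mxE; apply: eq_bigr => l _.
by rewrite tr_row [row _ _ _ _]mxE [col _ _ _ _]mxE.
Qed.

Lemma posdef_unit B : (forall u, u != 0 -> 0 < bil B u u) -> B \in unitmx.
Proof.
move=> pos; rewrite -row_free_unit; apply/row_freeP; apply/row_freeP.
rewrite -kermx_eq0; apply/negPn/negP => /rowV0Pn[u /sub_kermxP uB u0].
by have := pos u u0; rewrite /bil uB mul0mx mxE ltxx.
Qed.

End Bilinear.

(** Induction on the size: [E1] eliminates the first variable, and the Schur complement that remains
    is again symmetric and positive definite. *)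
Lemma posdef_frame {R : realType} n (B : 'M[R]_n) : B^T = B ->
  (forall u, u != 0 -> 0 < bil B u u) -> exists E : 'M[R]_n, E *m B *m E^T = 1%:M.
Proof.
elim: n B => [|n IH] B sB pB.
  by exists 0; apply/matrixP => -[].
move: B sB pB; change n.+1 with (1 + n)%N => B sB pB.
pose a := B 0 0; pose v := ursubmx B; pose C := drsubmx B.
have a0 : 0 < a.
  have := pB (delta_mx 0 0); rewrite bil_delta; apply.
  by apply/eqP => /matrixP/(_ 0 0)/eqP; rewrite !mxE !eqxx oner_eq0.
have BE : B = block_mx a%:M v v^T C.
  rewrite -[LHS]submxK; congr block_mx; last first.
    by rewrite /v trmx_ursub sB.
  apply/matrixP => i j; rewrite !ord1 !mxE eqxx mulr1n /a; congr (B _ _); exact/val_inj.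
have sC : C^T = C by rewrite /C trmx_drsub sB.
pose S := C - a^-1 *: (v^T *m v).
pose E1 : 'M[R]_(1 + n) := block_mx 1%:M 0 (- a^-1 *: v^T) 1%:M.
have E1B : E1 *m B *m E1^T = block_mx a%:M 0 0 S.
  rewrite BE /E1 tr_block_mx !mulmx_block !trmx1 !trmx0 !(mul1mx, mul0mx, mulmx1, mulmx0, addr0, add0r).
  have va : - a^-1 *: v^T *m a%:M = - v^T.
    by rewrite -scalemxAl mul_mx_scalar scalerA mulNr mulVf ?gt_eqF // scaleN1r.
  rewrite va addNr mul0mx add0r.
  have av : a%:M *m (- a^-1 *: v^T)^T + v = 0.
    by rewrite linearZ /= trmxK mul_scalar_mx scalerA mulrN mulfV ?gt_eqF // scaleN1r addNr.
  by rewrite av /S -scalemxAl scaleNr addrC.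
have [E2 hE2] : exists E : 'M[R]_n, E *m S *m E^T = 1%:M.
  apply: IH => [|u u0].
    by rewrite /S linearB /= linearZ /= trmx_mul trmxK sC.
  pose w : 'rV[R]_(1 + n) := row_mx 0 u *m E1.
  have -> : bil S u u = bil B w w.
    rewrite /bil /w trmx_mul !mulmxA -(mulmxA _ E1) -(mulmxA _ (E1 *m B)) E1B.
    rewrite mul_row_block tr_row_mx mul_row_col !(mul0mx, mulmx0, add0r, trmx0) //.
  apply: pB; apply: contra_neq u0 => w0.
  have : w = row_mx (u *m (- a^-1 *: v^T)) u.
    by rewrite /w /E1 mul_row_block !(mul0mx, mulmx0, mulmx1, add0r).
  by rewrite w0 => /esym; rewrite -[RHS]row_mx0 => /eq_row_mx[].
pose s := (Num.sqrt a)^-1.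
exists (block_mx s%:M 0 0 E2 *m E1).
rewrite trmx_mul !mulmxA -(mulmxA _ E1) -(mulmxA _ (E1 *m B)) E1B.
rewrite tr_block_mx !mulmx_block !trmx0 !(mul0mx, mulmx0, addr0, add0r) hE2.
rewrite tr_scalar_mx -!scalar_mxM [X in block_mx X](_ : _ = 1%:M) -?scalar_mx_block //.
congr scalar_mx; rewrite /s mulrAC -invfM -expr2 sqr_sqrtr ?mulVf ?gt_eqF //.
exact: ltW.
Qed.

Lemma frameP {R : realType} n (B : 'M[R]_n) : B^T = B ->
  (forall u, u != 0 -> 0 < bil B u u) -> frame B *m B *m (frame B)^T = 1%:M.
Proof. by move=> sB pB; have [E hE] := posdef_frame sB pB; exact: (@xgetPex _ 0 [set E : 'M[R]_n | E *m B *m E^T = 1%:M] (ex_intro _ E hE)). Qed.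

(** * The calculus of a chart and its agreement with the analytic definitions *)

Record chart_data {R : realType} {n : nat} (U : set 'rV[R]_n)
    (g J : 'rV[R]_n -> 'M[R]_n) : Prop := ChartData {
  cd_open : open U;
  cd_g : forall i j, smooth_on U (fun x => g x i j);
  cd_sym : forall x, U x -> (g x)^T = g x;
  cd_pos : forall x, U x -> forall u, u != 0 -> 0 < bil (g x) u u;
  cd_J : forall i j, smooth_on U (fun x => J x i j);
  cd_sqr : forall x, U x -> J x *m J x = - 1%:M }.

Section Chart.
Context {R : realType} {n : nat} {U : set 'rV[R]_n} {g J : 'rV[R]_n -> 'M[R]_n}.
Hypothesis cd : chart_data U g J.
Local Notation vec := 'rV[R]_n.
Let oU := cd_open cd.

Lemma cd_unit x : U x -> g x \in unitmx.
Proof. by move=> Ux; exact: posdef_unit (cd_pos cd Ux). Qed.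

Let G_smooth := invmx_smooth oU (cd_g cd) cd_unit.

Definition smet := smx oU (cd_g cd).
Definition sinv := smx oU G_smooth.
Definition sacs := smx oU (cd_J cd).

Lemma smetE x (Ux : U x) : map_mx (sev (oU := oU) Ux) smet = g x. Proof. exact: smxE. Qed.
Lemma sinvE x (Ux : U x) : map_mx (sev (oU := oU) Ux) sinv = invmx (g x). Proof. exact: smxE. Qed.
Lemma sacsE x (Ux : U x) : map_mx (sev (oU := oU) Ux) sacs = J x. Proof. exact: smxE. Qed.

Let smet_sym : smet^T = smet.
Proof. by apply: sfun_mxP => x Ux; rewrite -map_trmx smetE (cd_sym cd). Qed.
Let smet_inv : smet *m sinv = 1%:M.
Proof. by apply: sfun_mxP => x Ux; rewrite map_mxM smetE sinvE map_mx1 mulmxV // cd_unit. Qed.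
Let sinv_met : sinv *m smet = 1%:M.
Proof. by apply: sfun_mxP => x Ux; rewrite map_mxM smetE sinvE map_mx1 mulVmx // cd_unit. Qed.

Definition mcalc : calculus (sfun oU) n :=
  levi_civita (@sfun_pdD _ _ _ oU) (@sfun_pdM _ _ _ oU) (@sfun_pdC _ _ _ oU) (sfun_half oU)
    smet_sym smet_inv sinv_met.

Lemma mcalc_der_lin a (c : 'I_n -> R) (f : 'I_n -> sfun oU) :
  sfun_pd a (\sum_k sfun_cst oU (c k) * f k) = \sum_k sfun_cst oU (c k) * sfun_pd a (f k).
Proof.
rewrite -[LHS]/(der mcalc a _) der_sum; apply: eq_bigr => k _; rewrite derM /=.
by rewrite sfun_pd_cst mul0r add0r.
Qed.

Lemma smx_pd (A : vec -> 'M[R]_n) (sA : forall i j, smooth_on U (fun x => A x i j)) a x (Ux : U x) :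
  map_mx (sev (oU := oU) Ux) (map_mx (sfun_pd (oU := oU) a) (smx oU sA)) = \matrix_(i, j) pd a (fun y => A y i j) x.
Proof. by apply/matrixP => i j; rewrite !mxE sev_pd sval_mks. Qed.

Lemma derive_smx (A : vec -> 'M[R]_n) (sA : forall i j, smooth_on U (fun x => A x i j)) x (Ux : U x) v :
  'D_v A x = \sum_a v 0 a *: map_mx (sev (oU := oU) Ux) (map_mx (sfun_pd (oU := oU) a) (smx oU sA)).
Proof.
have dA i j : differentiable (fun y => A y i j) x by exact: Ck_differentiable oU (sA i j 1) Ux.
rewrite derive_mx; last by apply/derivable_mxP => i j; exact: diff_derivable.
apply/matrixP => i j; rewrite mxE derive_linform // summxE; apply: eq_bigr => a _.
by rewrite smx_pd !mxE mulrC.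
Qed.

Lemma christoffelE x (Ux : U x) v w :
  christoffel g x v w = \sum_b v 0 b *: (w *m map_mx (sev (oU := oU) Ux) (chr mcalc b)).
Proof.
pose d a := map_mx (sev (oU := oU) Ux) (map_mx (sfun_pd (oU := oU) a) smet).
have dg y : 'D_y g x = \sum_a y 0 a *: d a := derive_smx (cd_g cd) Ux y.
have chrE b : map_mx (sev (oU := oU) Ux) (chr mcalc b) =
    (\matrix_(j, l) (2^-1 * (d b j l + d j b l - d l b j))) *m invmx (g x).
  rewrite -sinvE map_mxM; congr (_ *m _); apply/matrixP => j l.
  by rewrite !mxE /koszul rmorphM rmorphB rmorphD /= -[X in X * _]/(sev Ux (sfun_cst oU 2^-1)) sev_cst; rewrite !mxE.
rewrite (eq_bigr (fun b => (v 0 b *: (w *m \matrix_(j, l) (2^-1 * (d b j l + d j b l - d l b j))))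
  *m invmx (g x))); last by move=> b _; rewrite chrE mulmxA -scalemxAl.
rewrite -mulmx_suml /christoffel; congr (_ *m _); apply/rowP => l.
rewrite !mxE summxE !bilE !dg.
have e1 (u y : vec) : \sum_i \sum_j u 0 i * (delta_mx 0 l : vec) 0 j * (\sum_a y 0 a *: d a) i j
    = \sum_b \sum_i y 0 b * u 0 i * d b i l.
  rewrite [RHS]exchange_big; apply: eq_bigr => i _ /=; rewrite (bigD1 l) //= [X in _ + X = _]big1 ?addr0.
    rewrite summxE mulr_sumr; apply: eq_bigr => a _.
    by rewrite !mxE !eqxx mulr1 mulrA [u 0 i * _]mulrC.
  by move=> j jl; rewrite [delta_mx _ _ _ _]mxE (negbTE jl) andbF mulr0 mul0r.
rewrite !e1 [X in _ + X - _]exchange_big /=.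
have e2 : (\sum_a (delta_mx 0 l : vec) 0 a *: d a) = d l.
  rewrite (bigD1 l) //= mxE !eqxx scale1r big1 ?addr0 // => j jl.
  by rewrite mxE (negbTE jl) andbF scale0r.
rewrite e2 -big_split -sumrB mulr_sumr; apply: eq_bigr => b _ /=.
rewrite -big_split -sumrB mulr_sumr !mxE mulr_sumr; apply: eq_bigr => j _ /=.
rewrite mxE; move: (d _ _ _) (d _ _ _) (d _ _ _) (v 0 b) (w 0 j) => c1 c2 c3 c4 c5; ring.
Qed.

Lemma curvE x (Ux : U x) u v w : curv g x u v w =
  w *m \sum_a \sum_b (u 0 a * v 0 b) *: map_mx (sev (oU := oU) Ux) (Rm mcalc a b).
Proof.
pose C y (Uy : U y) b := map_mx (sev (oU := oU) Uy) (chr mcalc b).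
have nn (p q : vec) : nabla g (cst p) (nabla g (cst q) (cst w)) x =
    w *m \sum_a \sum_b (p 0 a * q 0 b) *:
      (map_mx (sev (oU := oU) Ux) (dmx mcalc a (chr mcalc b)) + C x Ux b *m C x Ux a).
  have ncst y : nabla g (cst q) (cst w) y = christoffel g y q w.
    by rewrite /nabla derive_cst add0r.
  rewrite {1}/nabla ncst [in X in _ + X](christoffelE Ux) [in X in _ + X](christoffelE Ux).
  (* The inner derivative is not a constant field. Near x its components agree with elements [f l]
     of the ring, so the derivations of the ring compute its derivative. *)
  have -> : 'D_p (nabla g (cst q) (cst w)) x = w *m \sum_a p 0 a *: \sum_b q 0 b *:
       map_mx (sev (oU := oU) Ux) (dmx mcalc a (chr mcalc b)).
    pose M : 'M[sfun oU]_n := \sum_b sfun_cst oU (q 0 b) *: chr mcalc b.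
    pose f l : sfun oU := \sum_k sfun_cst oU (w 0 k) * M k l.
    have fE y (Uy : U y) l : christoffel g y q w 0 l = sval (f l) y.
      rewrite christoffelE -[sval _ _]/(sev (oU := oU) Uy (f l)) rmorph_sum /= summxE.
      rewrite (eq_bigr (fun b => \sum_k w 0 k * (q 0 b * C y Uy b k l))); last first.
        move=> b _; rewrite !mxE mulr_sumr; apply: eq_bigr => k _; ring.
      transitivity (\sum_k \sum_b w 0 k * (q 0 b * C y Uy b k l)); first exact: exchange_big.
      apply: eq_bigr => k _ /=; rewrite rmorphM /= sev_cst -mulr_sumr.
      congr (_ * _); rewrite summxE rmorph_sum; apply: eq_bigr => b _ /=.
      by rewrite [in RHS]mxE rmorphM /= sev_cst mxE.
    have fl l : \forall y \near x, sval (f l) y = nabla g (cst q) (cst w) y 0 l.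
      by apply: nearU oU Ux _ => y Uy; rewrite ncst fE.
    have df l : differentiable (sval (f l)) x.
      exact: Ck_differentiable oU (sfun_smooth (f l) 1) Ux.
    rewrite derive_mx; last first.
      apply/derivable_mxP => i l; rewrite ord1; apply: near_eq_derivable (fl l) _.
      exact: diff_derivable.
    apply/rowP => l; rewrite mxE.
    rewrite -(near_eq_derive _ (fl l)) derive_linform // mulmx_sumr summxE.
    apply: eq_bigr => a _; rewrite -scalemxAr mxE mulrC; congr (_ * _).
    rewrite -(sev_pd a (f l) Ux) /f.
    rewrite mcalc_der_lin rmorph_sum mxE; apply: eq_bigr => k _; rewrite rmorphM /= sev_cst; congr (_ * _).
    rewrite /M summxE.
    rewrite (eq_bigr (fun b => sfun_cst oU (q 0 b) * chr mcalc b k l)); last by move=> b _; rewrite mxE.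
    rewrite mcalc_der_lin rmorph_sum summxE; apply: eq_bigr => b _.
    by rewrite rmorphM /= sev_cst !mxE.
  rewrite -[X in _ + X]/(\sum_a p 0 a *: ((\sum_b q 0 b *: (w *m C x Ux b)) *m C x Ux a)).
  rewrite mulmx_sumr [RHS]mulmx_sumr -big_split; apply: eq_bigr => a _ /=.
  rewrite -scalemxAr -scalerDr mulmx_sumr mulmx_suml -big_split /= scaler_sumr mulmx_sumr.
  apply: eq_bigr => b _ /=.
  by rewrite -!scalemxAr -!scalemxAl -scalerDr scalerA mulmxDr mulmxA.
rewrite /curv /curvature !nn.
have -> : lie_bracket (cst u) (cst v) = cst 0 :> (vec -> vec).
  by apply/funext => y; rewrite /lie_bracket !derive_cst subrr.
have -> : nabla g (cst 0) (cst w) x = 0.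
  rewrite /nabla derive_cst add0r (christoffelE Ux) big1 // => b _.
  by rewrite mxE scale0r.
rewrite subr0 -mulmxBr; congr (_ *m _).
rewrite [X in _ - X]exchange_big -sumrB; apply: eq_bigr => a _ /=.
rewrite -sumrB; apply: eq_bigr => b _ /=; rewrite [v 0 b * _]mulrC -scalerBr; congr (_ *: _).
rewrite /Rm map_mxD !map_mxB (map_mxM _ (chr mcalc b)) (map_mxM _ (chr mcalc a) (chr mcalc b)).
rewrite -[LHS]/(_ + C x Ux b *m C x Ux a - (_ + C x Ux a *m C x Ux b)).
rewrite -[RHS]/(_ - _ + (C x Ux b *m C x Ux a - C x Ux a *m C x Ux b)).
by rewrite opprD addrACA.
Qed.

End Chart.

Section ChartQuantities.
Context {R : realType} {n : nat} {U : set 'rV[R]_n} {g J : 'rV[R]_n -> 'M[R]_n}.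
Variable cd : chart_data U g J.
Local Notation D := (mcalc cd).
Local Notation Js := (sacs cd).

(** Here and below are t, the components of xi and the divergence of xi as real functions, equal to
    0 off the chart image. *)
Definition tq : 'rV[R]_n -> R := sval (tnorm D Js).
Definition xq a : 'rV[R]_n -> R := sval (xi D Js a).
Definition dq : 'rV[R]_n -> R := sval (divergence D Js).

End ChartQuantities.

Section Kahlerian.
Context {R : realType} {n : nat} {U : set 'rV[R]_n} {g J : 'rV[R]_n -> 'M[R]_n}.
Variable cd : chart_data U g J.
Local Notation vec := 'rV[R]_n.
Local Notation D := (mcalc cd).
Local Notation Js := (sacs cd).
Let oU := cd_open cd.
Variable lam : R.
Hypothesis orth : forall x, U x -> forall u v, bil (g x) (u *m J x) (v *m J x) = bil (g x) u v.
Hypothesis closed : forall x, U x -> forall u v w, ext_deriv (fundamental_form g J) x u v w = 0.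
Hypothesis ein : forall x, U x -> forall u v, ricci g x u v = lam * bil (g x) u v.

Let JJ : Js *m Js = - 1%:M.
Proof.
apply: sfun_mxP => x Ux; rewrite map_mxM sacsE (cd_sqr cd) //.
by rewrite map_mxN map_mx1.
Qed.

Let JgJ : Js *m met D *m Js^T = met D.
Proof.
apply: sfun_mxP => x Ux; rewrite !map_mxM -map_trmx sacsE smetE.
apply/matrixP => i j; rewrite -[LHS]bil_delta -[RHS]bil_delta -(orth Ux).
by rewrite /bil trmx_mul !mulmxA.
Qed.

Let Oentry x (Ux : U x) j k : sval ((Js *m met D) j k) x = fundamental_form g J x j k.
Proof.
rewrite -[LHS]/(sev Ux _).
by rewrite sev_mx map_mxM sacsE smetE.
Qed.

Let derive_Ov x (Ux : U x) v : 'D_v (fundamental_form g J) x =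
  \sum_a v 0 a *: map_mx (sev Ux) (dmx D a (Js *m met D)).
Proof.
have nO a b : \forall y \near x, sval ((Js *m met D) a b) y = fundamental_form g J y a b.
  by apply: nearU oU Ux _ => y Uy; exact: Oentry.
have df a b : differentiable (sval ((Js *m met D) a b)) x.
  exact: Ck_differentiable oU (sfun_smooth _ 1) Ux.
rewrite derive_mx; last first.
  by apply/derivable_mxP => a b; exact: near_eq_derivable (nO a b) (diff_derivable (df a b)).
apply/matrixP => i j; rewrite mxE -(near_eq_derive _ (nO i j)) derive_linform // summxE.
by apply: eq_bigr => a _; rewrite mxscaleE -sev_mx dmxE mulrC sev_pd.
Qed.

Let derive_O x (Ux : U x) i j k : 'D_(delta_mx 0 i) (fundamental_form g J) x j k =
  sev Ux (der D i ((Js *m met D) j k)).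
Proof.
have nO a b : \forall y \near x, sval ((Js *m met D) a b) y = fundamental_form g J y a b.
  by apply: nearU oU Ux _ => y Uy; exact: Oentry.
rewrite derive_mx; last first.
  apply/derivable_mxP => a b; apply: near_eq_derivable (nO a b) _.
  exact: pd_derivable.
by rewrite mxE -(near_eq_derive _ (nO j k)) sev_pd.
Qed.

Let dOm i j k : der D i ((Js *m met D) j k) + der D j ((Js *m met D) k i) +
  der D k ((Js *m met D) i j) = 0.
Proof.
apply: sfun_evP => x Ux; rewrite rmorph0.
have e a b c : sev Ux (der D a ((Js *m met D) b c)) =
    bil ('D_(delta_mx 0 a) (fundamental_form g J) x) (delta_mx 0 b) (delta_mx 0 c).
  by rewrite -(derive_O Ux a b c); exact: esym (bil_delta _ _ _).
refine (etrans (rmorphD (sev Ux) _ _) _).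
refine (etrans (f_equal2 +%R (etrans (rmorphD (sev Ux) _ _)
  (f_equal2 +%R (e i j k) (e j k i))) (e k i j)) _).
exact: (closed Ux).
Qed.

Local Notation E0 x := (frame (g x)).

Let E0P x : U x -> E0 x *m g x *m (E0 x)^T = 1%:M.
Proof. by move=> Ux; exact: (frameP (cd_sym cd Ux) (cd_pos cd Ux)). Qed.

Let E0tE0 x : U x -> (E0 x)^T *m E0 x = invmx (g x).
Proof.
move=> Ux; have h := E0P Ux; have gu := cd_unit cd Ux.
have h2 : (g x *m (E0 x)^T) *m E0 x = 1%:M by apply: mulmx1C; rewrite mulmxA.
by rewrite -[LHS]mul1mx -(mulVmx gu) -mulmxA (mulmxA (g x)) h2 mulmx1.
Qed.

(** The sum over the orthonormal frame is a contraction with the inverse metric, by [E0tE0];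
    skewness of the curvature turns it into the trace over a lower and an upper index used in the
    ring. *)
Let ricciE x (Ux : U x) a q : ricci g x (delta_mx 0 a) (delta_mx 0 q) =
  sev Ux (\sum_k Rm D k a q k).
Proof.
pose r b := map_mx (sev Ux) (Rm D a b).
have skewr b : (r b *m g x)^T = - (r b *m g x).
  have /skewP := skew_Rm D a b => /(congr1 (map_mx (sev Ux))).
  by rewrite map_mxN -map_trmx map_mxM smetE.
transitivity (\sum_b \sum_m (invmx (g x)) b m * (r b *m g x) m q).
  have e i : bil (g x) (curv g x (delta_mx 0 a) (row i (E0 x)) (row i (E0 x))) (delta_mx 0 q)
     = \sum_b \sum_m E0 x i b * E0 x i m * (r b *m g x) m q.
    rewrite (curvE cd Ux) (bigD1 a) //= [X in _ + X]big1 ?addr0; last first.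
      by move=> j ja; apply: big1 => b _; rewrite mxE (negbTE ja) andbF mul0r scale0r.
    rewrite mulmx_sumr /bil !mulmx_suml summxE; apply: eq_bigr => b _.
    rewrite trmx_delta -colE [LHS]mxE -scalemxAr -scalemxAl [LHS]mxE -mulmxA [X in _ * X]mxE mulr_sumr.
    by apply: eq_bigr => m _; rewrite ![delta_mx _ _ _ _]mxE ![row _ _ _ _]mxE !eqxx mul1r mulrA.
  rewrite /ricci (eq_bigr _ (fun i _ => e i)) exchange_big; apply: eq_bigr => b _ /=.
  rewrite exchange_big; apply: eq_bigr => m _ /=; rewrite -mulr_suml; congr (_ * _).
  by rewrite -E0tE0 // !mxE; apply: eq_bigr => i _; rewrite !mxE.
rewrite rmorph_sum; apply: eq_bigr => b _ /=.
have -> : sev Ux (Rm D b a q b) = - r b q b 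
  by rewrite RmN mxoppE; exact: etrans (rmorphN (sev Ux) _) (congr1 -%R (sev_mx Ux _ _ _)).
have sk m : (r b *m g x) m q = - (r b *m g x) q m.
  by have /matrixP/(_ q m) := skewr b; rewrite mxE => ->; rewrite mxE.
rewrite (eq_bigr (fun m => - ((r b *m g x) q m * invmx (g x) m b))); last first.
  move=> m _; rewrite sk mulrN mulrC; congr (- (_ * _)).
  have : (invmx (g x))^T = invmx (g x) by rewrite trmx_inv (cd_sym cd).
  by move=> /matrixP/(_ b m); rewrite mxE => ->.
rewrite sumrN; congr (- _).
have := mulmxK (cd_unit cd Ux) (r b) => /matrixP/(_ q b) <-; by rewrite [RHS]mxE.
Qed.

Local Notation lams := (sfun_cst oU lam).

Let ein' u v : \sum_k Rm D k u v k = lams * met D u v.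
Proof.
apply: sfun_evP => x Ux; rewrite -ricciE ein // rmorphM /= sev_cst bil_delta.
by rewrite sev_mx smetE.
Qed.

Let dlam i : der D i lams = 0. Proof. exact: sfun_pd_cst. Qed.

(** The frame chosen at x, as a matrix of constant functions; its inverse [Bc] is read off E g E^T =
    1. *)
Let Ec x : 'M[sfun oU]_n := map_mx (sfun_cst oU) (E0 x).
Let Bc x : 'M[sfun oU]_n := map_mx (sfun_cst oU) (g x *m (E0 x)^T).

Let EB x : U x -> Ec x *m Bc x = 1%:M.
Proof. by move=> Ux; rewrite /Ec /Bc -map_mxM mulmxA E0P // map_mx1. Qed.

Let BE x : U x -> Bc x *m Ec x = 1%:M.
Proof. by move=> Ux; exact/mulmx1C/EB. Qed.

Let dE x i j k : der D i (Ec x j k) = 0.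
Proof. by rewrite mxE; exact: sfun_pd_cst. Qed.

Let evc x (Ux : U x) (A : 'M[R]_n) : map_mx (sev Ux) (map_mx (sfun_cst oU) A) = A.
Proof. by apply/matrixP => i j; rewrite mxE mxE sev_cst. Qed.

Let evE x (Ux : U x) : map_mx (sev Ux) (Ec x *m met D *m (Ec x)^T) = 1%:M.
Proof. by rewrite !map_mxM -map_trmx evc smetE E0P. Qed.

Lemma sekigawa_chart x : U x ->
  5 * tq cd x ^+ 2 + 8 * n%:R * lam * tq cd x <= 4 * n%:R * dq cd x.
Proof.
move=> Ux; have := frame_div_ge (EB Ux) (BE Ux) (@dE x) JJ JgJ dOm ein' dlam (evE Ux).
by rewrite /= sev_cst.
Qed.

Lemma tq_ge0 x : U x -> 0 <= tq cd x.
Proof. by move=> Ux; exact: (frame_tnorm_ge0 (EB Ux) (BE Ux) (@dE x) JJ JgJ (evE Ux)). Qed.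

Lemma scalar_curvatureE x : U x -> scalar_curvature g x = n%:R * lam.
Proof.
move=> Ux; rewrite /scalar_curvature (eq_bigr (fun _ => lam)); last first.
  by move=> i _; rewrite ein // bil_rows E0P // mxE eqxx mulr1.
by rewrite sumr_const card_ord mulr_natl.
Qed.

Lemma star_scalar_curvatureE x : U x ->
  star_scalar_curvature g J x = n%:R * lam + tq cd x / 2.
Proof.
move=> Ux; have := frame_star (EB Ux) (BE Ux) (@dE x) JJ JgJ dOm ein' (evE Ux).
rewrite -[ev in _ = _ * ev + _]/(sev Ux lams) sev_cst => <-.
rewrite /star_scalar_curvature; congr (_ * _); apply: eq_bigr => j _; apply: eq_bigr => k _.
congr (_ * _); last first.
  rewrite !map_mxM evc sacsE evc /fundamental_form mulmxA.
  by rewrite bil_rows !mulmxA.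
apply: eq_bigr => i _; rewrite (curvE cd Ux) !map_mxM evc sacsE evc.
rewrite -!row_mul bil_rows mulmxA; congr ((_ *m _ *m _ *m _ *m _) _ _).
rewrite map_mx_sum; apply: eq_bigr => a _; rewrite map_mx_sum; apply: eq_bigr => b _.
have ec p q : sev Ux (Ec x p q) = E0 x p q by rewrite sev_mx evc.
rewrite ![row _ _ _ _]mxE -[RHS]/(map_mx (sev Ux) ((Ec x j a * Ec x i b) *: Rm D a b)) map_mxZ.
congr (_ *: _); exact: esym (etrans (rmorphM (sev Ux) _ _) (f_equal2 *%R (ec j a) (ec i b))).
Qed.

(** When t vanishes at x so does nabla J, and [dmx_lower] then expresses the derivatives of Omega by
    the Christoffel matrices alone. *)
Lemma parallel_chart x : U x -> tq cd x = 0 -> forall u v w,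
  nabla_form g (fundamental_form g J) x u v w = 0.
Proof.
move=> Ux t0 u v w.
have T0 a : map_mx (sev Ux) (Tt D Js a) = 0.
  exact: (frame_tnorm_eq0 (EB Ux) (BE Ux) (@dE x) JJ JgJ (evE Ux) a t0).
have nE p q : nabla g (cst p) (cst q) x = \sum_b p 0 b *: (q *m map_mx (sev Ux) (chr D b)).
  by rewrite /nabla derive_cst add0r (christoffelE cd Ux).
have OE : map_mx (sev Ux) (Js *m met D) = fundamental_form g J x by rewrite map_mxM sacsE smetE.
pose C a := map_mx (sev Ux) (chr D a).
have ME a : map_mx (sev Ux) (dmx D a (Js *m met D)) =
    C a *m fundamental_form g J x + fundamental_form g J x *m (C a)^T.
  rewrite (dmx_lower D a Js) !map_mxD (map_mxM _ (cov D a Js)) T0 mul0mx add0r.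
  by rewrite (map_mxM _ (chr D a)) (map_mxM _ (Js *m met D)) OE -map_trmx.
rewrite /nabla_form !nE (derive_Ov Ux) (eq_bigr _ (fun a _ => congr1 _ (ME a))).
pose T := \sum_a u 0 a *: C a.
have e1 (y : vec) : \sum_b u 0 b *: (y *m C b) = y *m T.
  by rewrite mulmx_sumr; apply: eq_bigr => b _; rewrite scalemxAr.
rewrite !e1; move: (fundamental_form g J x) => O.
have -> : \sum_a u 0 a *: (C a *m O + O *m (C a)^T) = T *m O + O *m T^T.
  rewrite /T linear_sum mulmx_suml mulmx_sumr -big_split; apply: eq_bigr => a _ /=.
  by rewrite scalerDr scalemxAl linearZ /= scalemxAr.
rewrite /bil mulmxDr mulmxDl trmx_mul !mulmxA mxaddE.
by move: (_ 0 0) (_ 0 0) => p q; rewrite addrAC addrK subrr.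
Qed.

End Kahlerian.

Lemma jacobian_pd {R : realType} {n m : nat} (phi : 'rV[R]_n -> 'rV[R]_m) x :
  (forall i, differentiable (fun y => phi y 0 i) x) ->
  'J phi x = \matrix_(a, i) pd a (fun y => phi y 0 i) x.
Proof.
move=> dphi; have dp := rV_differentiable dphi.
apply/row_matrixP => a; rewrite rowE -deriveEjacobian // derive_mx; last exact: diff_derivable.
by apply/rowP => i; rewrite !mxE.
Qed.

(** * Change of coordinates between charts *)

Section Pullback.
Context {R : realType} {n : nat}.
Local Notation vec := 'rV[R]_n.
Context {U U' : set vec} {g J g' J' : vec -> 'M[R]_n}.
Variables (cd : chart_data U g J) (cd' : chart_data U' g' J').
Variable phi : vec -> vec.
Hypothesis phiU : forall x, U x -> U' (phi x).
Hypothesis sphi : forall i, smooth_on U (fun x => phi x 0 i).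
Hypothesis g_phi : forall x, U x -> g x = 'J phi x *m g' (phi x) *m ('J phi x)^T.
Hypothesis J_phi : forall x, U x -> J x *m 'J phi x = 'J phi x *m J' (phi x).
Let oU := cd_open cd.
Let oU' := cd_open cd'.
Local Notation D := (mcalc cd).
Local Notation D' := (mcalc cd').

Let s_pull (f : sfun oU') : smooth_on U (fun x => sval f (phi x)).
Proof. by move=> k; apply: (Ck_comp oU oU' phiU) => [i|]; [exact: sphi|exact: sfun_smooth]. Qed.

Definition pull (f : sfun oU') : sfun oU := mks oU (s_pull f).

Let sev_pull f x (Ux : U x) : sev Ux (pull f) = sev (phiU Ux) f.
Proof. exact: clipE. Qed.

Let pull_zmod : zmod_morphism pull.
Proof.
move=> f h; apply: sfun_evP => x Ux; rewrite sev_pull.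
refine (etrans (rmorphB (sev (phiU Ux)) _ _) _).
by refine (etrans _ (esym (rmorphB (sev Ux) _ _))); rewrite /= !sev_pull.
Qed.

Let pull_mono : monoid_morphism pull.
Proof.
split=> [|f h]; apply: sfun_evP => x Ux; rewrite sev_pull.
  by rewrite (rmorph1 (sev (phiU Ux))) (rmorph1 (sev Ux)).
refine (etrans (rmorphM (sev (phiU Ux)) _ _) _).
by refine (etrans _ (esym (rmorphM (sev Ux) _ _))); rewrite /= !sev_pull.
Qed.

HB.instance Definition _ := GRing.isZmodMorphism.Build (sfun oU') (sfun oU) pull pull_zmod.
HB.instance Definition _ := GRing.isMonoidMorphism.Build (sfun oU') (sfun oU) pull pull_mono.

Let dphi x : U x -> forall i, differentiable (fun y => phi y 0 i) x.
Proof. by move=> Ux i; exact: Ck_differentiable oU (sphi i 1) Ux. Qed.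

Let A0 x : 'M[R]_n := \matrix_(a, i) pd a (fun y => phi y 0 i) x.

Let A0E x : U x -> 'J phi x = A0 x.
Proof. by move=> Ux; rewrite jacobian_pd //; exact: dphi. Qed.

Let sA0 i j : smooth_on U (fun x => A0 x i j).
Proof.
move=> k; apply: Ck_ext (Ck_derive i (sphi j k.+1)) => // x Ux.
by rewrite mxE.
Qed.

(** Invertibility of the Jacobian is deduced from the compatibility of the metrics, whose matrices
    are invertible. *)
Let A0_unit x : U x -> A0 x \in unitmx.
Proof.
move=> Ux; have := cd_unit cd Ux; rewrite g_phi // A0E // !unitmx_mul.
by move=> /andP[/andP[]].
Qed.

Let As := smx oU sA0.
Let Bs := smx oU (invmx_smooth oU sA0 A0_unit).

Let AB : As *m Bs = 1%:M.
Proof. by apply: sfun_mxP => x Ux; rewrite map_mxM !smxE map_mx1 mulmxV // A0_unit. Qed.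
Let BA : Bs *m As = 1%:M. Proof. exact: mulmx1C AB. Qed.

Let der_pull i (f : sfun oU') : der D i (pull f) = \sum_k As i k * pull (der D' k f).
Proof.
apply: sfun_evP => x Ux; rewrite [LHS](sev_pd i (pull f) Ux) (sval_mks oU _ _ Ux).
have df : differentiable (sval f) (phi x).
  exact: Ck_differentiable oU' (sfun_smooth f 1) (phiU Ux).
rewrite -[LHS]/(pd i (sval f \o phi) x) (pd_comp _ (dphi Ux) df).
rewrite (rmorph_sum (sev Ux)); apply: eq_bigr => k _.
refine (etrans _ (esym (rmorphM (sev Ux) _ _))).
have e1 : sev Ux (As i k) = pd i (fun y => phi y 0 k) x by rewrite sev_mx smxE mxE.
have e2 : sev Ux (pull (der D' k f)) = pd k (sval f) (phi x).
  by rewrite sev_pull; exact: sev_pd.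
by rewrite mulrC; exact: esym (f_equal2 *%R e1 e2).
Qed.

Let der_As i j k : der D i (As j k) = der D j (As i k).
Proof.
have e a : As a k = sfun_pd (oU := oU) a (mks oU (sphi k)).
  apply: sfun_evP => x Ux; rewrite sev_mx smxE mxE sev_pd; exact: esym (sval_mks oU _ _ Ux).
by rewrite !e; exact: sfun_pdC.
Qed.

Let pull_mx x (Ux : U x) (A : 'M[sfun oU']_n) :
  map_mx (sev Ux) (map_mx pull A) = map_mx (sev (phiU Ux)) A.
Proof. by apply/matrixP => i j; rewrite mxE mxE [RHS]mxE; exact: sev_pull. Qed.

Let met_As : met D = As *m map_mx pull (met D') *m As^T.
Proof.
apply: sfun_mxP => x Ux; rewrite !map_mxM -map_trmx pull_mx !smetE smxE -A0E //.
exact: g_phi.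
Qed.

Let acs_As : sacs cd *m As = As *m map_mx pull (sacs cd').
Proof.
apply: sfun_mxP => x Ux; rewrite !map_mxM pull_mx !sacsE smxE -A0E //.
exact: J_phi.
Qed.

Lemma tq_pull x : U x -> tq cd x = tq cd' (phi x).
Proof.
move=> Ux; rewrite -[LHS]/(sev Ux _) (tnorm_A AB BA der_pull der_As met_As acs_As).
exact: sev_pull.
Qed.

Lemma xq_pull x a : U x -> xq cd a x = \sum_i 'J phi x a i * xq cd' i (phi x).
Proof.
move=> Ux; rewrite -[LHS]/(sev Ux _) (xi_A AB BA der_pull der_As met_As acs_As).
rewrite (rmorph_sum (sev Ux)); apply: eq_bigr => k _.
refine (etrans (rmorphM (sev Ux) _ _) _).
have e1 : sev Ux (As a k) = 'J phi x a k by rewrite sev_mx smxE A0E.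
have e2 : sev Ux (pull (xi D' (sacs cd') k)) = xq cd' k (phi x) by exact: sev_pull.
by rewrite -e1 -e2.
Qed.

End Pullback.

(** * The divergence as a total derivative against the Riemannian density *)

Section Jacobi.
Context {F : comPzRingType} {n : nat} (D : calculus F n).
Local Notation d := (der D).

Lemma der_prod i (I : eqType) (r : seq I) (f : I -> F) : uniq r ->
  d i (\prod_(k <- r) f k) = \sum_(k <- r) d i (f k) * \prod_(l <- r | l != k) f l.
Proof.
elim: r => [_|a r IH /= /andP[ar ur]]; first by rewrite !big_nil der1.
rewrite !big_cons derM IH // eqxx mulr_sumr /=; congr (_ * _ + _).
  rewrite [RHS]big_seq_cond [LHS]big_seq; apply: eq_bigl => l.
  by case lr: (l \in r) => //=; rewrite (memPn ar).
rewrite [RHS]big_seq [LHS]big_seq; apply: eq_bigr => k kr.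
by rewrite big_cons eq_sym (memPn ar) // mulrCA.
Qed.

(** Jacobi's formula: the determinant is differentiated row by row, and each determinant is expanded
    along the differentiated row. *)
Lemma der_det i (A : 'M[F]_n) : d i (\det A) = \tr (dmx D i A *m \adj A).
Proof.
pose Ak (k : 'I_n) : 'M[F]_n := \matrix_(a, b) if a == k then d i (A k b) else A a b.
transitivity (\sum_k \det (Ak k)).
  rewrite /determinant der_sum exchange_big; apply: eq_bigr => s _ /=.
  rewrite derM (_ : d i ((-1) ^+ s) = 0) ?mul0r ?add0r; last first.
    by case: (odd_perm s); rewrite ?expr0 ?expr1 ?derN der1 ?oppr0.
  rewrite der_prod ?index_enum_uniq // mulr_sumr; apply: eq_bigr => k _.
  congr (_ * _); rewrite [RHS](bigD1 k) //= mxE eqxx; congr (_ * _).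
  by apply: eq_bigr => l lk; rewrite mxE (negbTE lk).
apply: eq_bigr => k _; rewrite (expand_det_row _ k) mxE; apply: eq_bigr => j _.
rewrite !mxE eqxx; congr (_ * (_ * \det _)).
by apply/matrixP => a b; rewrite !mxE eq_sym (negbTE (neq_lift _ _)).
Qed.

Lemma der_det_met i : d i (\det (met D)) = (\det (met D) * \tr (chr D i)) *+ 2.
Proof.
have Gg : imet D *m met D = 1%:M by exact: mulmx1C (met_inv D).
have adjE : \adj (met D) = \det (met D) *: imet D.
  by rewrite -[LHS]mul1mx -Gg -mulmxA mul_mx_adj mul_mx_scalar.
rewrite der_det adjE -scalemxAr mxtraceZ /dmx met_par mulmxDl mxtraceD.
rewrite -mulmxA met_inv mulmx1 mxtrace_mulC mulmxA Gg mul1mx mxtrace_tr.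
by rewrite -mulr2n mulrnAr.
Qed.

Definition xi_up (J : 'M[F]_n) i := \sum_j imet D i j * xi D J j.

(** With the index raised, all Christoffel terms but the trace cancel, and the trace is the
    logarithmic derivative of the density. *)
Lemma div_up (J : 'M[F]_n) :
  divergence D J = \sum_i (d i (xi_up J i) + \tr (chr D i) * xi_up J i).
Proof.
pose x j := xi D J j.
have dG i j : d i (imet D i j) = - (\sum_k chr D i k i * imet D k j + \sum_k imet D i k * chr D i k j).
  rewrite -dmxE der_imet mxoppE mxaddE; congr (- (_ + _)); rewrite mxE.
    by apply: eq_bigr => k _; rewrite mxE.
  by [].
have dxi i : d i (xi_up J i) = \sum_j (imet D i j * d i (x j) -
    (\sum_k chr D i k i * imet D k j) * x j - (\sum_k imet D i k * chr D i k j) * x j).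
  rewrite der_sum; apply: eq_bigr => j _; rewrite derM dG -/(x j).
  by move: (\sum_k _) (\sum_k _) => p q; ring.
have tr_part : \sum_i \sum_j (\sum_k chr D i k i * imet D k j) * x j = \sum_i \tr (chr D i) * xi_up J i.
  transitivity (\sum_i \sum_k chr D i k i * xi_up J k).
    apply: eq_bigr => i _; rewrite (eq_bigr (fun j => \sum_k chr D i k i * imet D k j * x j)).
      by rewrite exchange_big; apply: eq_bigr => k _; rewrite mulr_sumr; apply: eq_bigr => j _; rewrite mulrA.
    by move=> j _; rewrite mulr_suml.
  rewrite exchange_big; apply: eq_bigr => k _; rewrite -mulr_suml; congr (_ * _).
  by apply: eq_bigr => i _; rewrite chr_sym.
rewrite big_split -tr_part -big_split /=; apply: eq_bigr => i _.
rewrite dxi -big_split /=.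
rewrite [RHS](eq_bigr (fun j => imet D i j * d i (x j) - (\sum_k imet D i k * chr D i k j) * x j)); last first.
  by move=> j _; rewrite addrAC subrK.
rewrite [RHS]sumrB (eq_bigr (fun b => imet D i b * d i (x b) - imet D i b * \sum_c chr D i b c * x c)); last first.
  by move=> b _; rewrite mulrBr.
rewrite sumrB; congr (_ - _).
rewrite (eq_bigr (fun b => \sum_c imet D i b * (chr D i b c * x c))); last by move=> b _; rewrite mulr_sumr.
rewrite exchange_big; apply: eq_bigr => j _ /=; rewrite mulr_suml.
by apply: eq_bigr => k _; rewrite mulrA.
Qed.

End Jacobi.

Lemma pd_comp1 {R : realType} {n : nat} (h : R -> R) (f : 'rV[R]_n -> R) x a dh :
  differentiable f x -> is_derive (f x) 1 h dh ->
  derivable (h \o f) x (delta_mx 0 a) /\ pd a (h \o f) x = dh * pd a f x.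
Proof.
move=> df dh1; have dfh : differentiable h (f x) by apply/derivable1_diffP; case: dh1.
split; first exact/diff_derivable/differentiable_comp.
rewrite /pd deriveE; last exact: differentiable_comp.
rewrite diff_comp //= diff1E // -deriveE // derive1E.
by case: dh1 => _ ->; rewrite mulrC.
Qed.

Lemma posdef_det_gt0 {R : realType} n (B : 'M[R]_n) : B^T = B ->
  (forall u, u != 0 -> 0 < bil B u u) -> 0 < \det B.
Proof.
move=> sB pB; have [E hE] := posdef_frame sB pB.
have : \det E ^+ 2 * \det B = 1 by rewrite -(det1 R n) -hE !det_mulmx det_tr; ring.
move=> h; have : 0 < \det E ^+ 2 * \det B by rewrite h.
rewrite pmulr_rgt0 // lt_def sqr_ge0 andbT; apply/eqP => e0.
by move: h; rewrite e0 mul0r => /esym/eqP; rewrite oner_eq0.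
Qed.

Section Divergence.
Context {R : realType} {n : nat} {U : set 'rV[R]_n} {g J : 'rV[R]_n -> 'M[R]_n}.
Variable cd : chart_data U g J.
Local Notation vec := 'rV[R]_n.
Local Notation D := (mcalc cd).
Let oU := cd_open cd.

Definition xup i : vec -> R := sval (xi_up D (sacs cd) i).

Lemma xup_smooth i : smooth_on U (xup i).
Proof. exact: sfun_smooth. Qed.

Lemma tq_smooth : smooth_on U (tq cd).
Proof. exact: sfun_smooth. Qed.

Lemma xupE x i : U x -> xup i x = \sum_j invmx (g x) i j * xq cd j x.
Proof.
move=> Ux; rewrite -[LHS]/(sev Ux _) (rmorph_sum (sev Ux)); apply: eq_bigr => j _.
refine (etrans (rmorphM (sev Ux) _ _) _).
have e1 : sev Ux (imet D i j) = invmx (g x) i j by rewrite sev_mx sinvE.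
by rewrite -e1.
Qed.

Definition dens (x : vec) := Num.sqrt (\det (g x)).

Lemma det_gt0 x : U x -> 0 < \det (g x).
Proof. by move=> Ux; exact: posdef_det_gt0 (cd_sym cd Ux) (cd_pos cd Ux). Qed.

Lemma dens_gt0 x : U x -> 0 < dens x.
Proof. by move=> Ux; rewrite sqrtr_gt0 det_gt0. Qed.

Let ddet x (Ux : U x) : differentiable (fun y => \det (g y)) x.
Proof. exact: Ck_differentiable oU (det_smooth oU (cd_g cd) 1) Ux. Qed.

Let pd_dens_aux x a (Ux : U x) : derivable dens x (delta_mx 0 a) /\
  pd a dens x = (2 * dens x)^-1 * pd a (fun y => \det (g y)) x.
Proof. exact: (pd_comp1 a (ddet Ux) (is_derive1_sqrt (det_gt0 Ux))). Qed.

Let dens_cont x : U x -> {for x, continuous dens}.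
Proof.
move=> Ux; apply: (@continuous_comp _ _ _ (fun y => \det (g y)) Num.sqrt).
  exact: differentiable_continuous (ddet Ux).
exact: sqrt_continuous.
Qed.

Lemma dens_C1 : Ck_on 1 U dens.
Proof.
split=> // a; split=> [x Ux|]; first by case: (pd_dens_aux a Ux).
have k0 : Ck_on 0 U ((fun x => (2 * dens x)^-1) * pd a (fun y => \det (g y))).
  apply: Ck_mul => //; last exact: Ck_derive (det_smooth oU (cd_g cd) 1).
  apply: Ck_inv => //.
    by move=> x Ux; rewrite mulf_neq0 // gt_eqF // dens_gt0.
  apply: (@Ck_mul _ _ 0 U (cst 2) dens) => //; exact: Ck_cst.
apply: Ck_ext k0 => // x Ux; have [_ e] := pd_dens_aux a Ux; exact: esym e.
Qed.

Lemma pd_dens x a (Ux : U x) : pd a dens x = dens x * sev Ux (\tr (chr D a)).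
Proof.
have [_ ->] := pd_dens_aux a Ux.
have detE y (Uy : U y) : sev Uy (\det (met D)) = \det (g y).
  by rewrite -(det_map_mx (sev Uy)) smetE.
have -> : pd a (fun y => \det (g y)) x = sev Ux (der D a (\det (met D))).
  rewrite sev_pd; apply: (pd_eq oU) => // y Uy; exact: esym (detE y Uy).
rewrite der_det_met (rmorphMn (sev Ux)).
have e2 : sev Ux (\det (met D) * \tr (chr D a)) = dens x ^+ 2 * sev Ux (\tr (chr D a)).
  refine (etrans (rmorphM (sev Ux) _ _) _).
  have e : sev Ux (\det (met D)) = dens x ^+ 2 by rewrite detE sqr_sqrtr // ltW // det_gt0.
  by rewrite -e.
rewrite -[X in _ * (X *+ 2)]/(sev Ux _) e2.
have := dens_gt0 Ux; move: (dens x) (sev Ux (\tr (chr D a))) => w t w0.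
by field; rewrite gt_eqF.
Qed.

Lemma div_dens x : U x -> dens x * dq cd x = \sum_i pd i (dens * xup i) x.
Proof.
move=> Ux; rewrite -[dq cd x]/(sev Ux (divergence D (sacs cd))) div_up (rmorph_sum (sev Ux)) mulr_sumr.
apply: eq_bigr => i _.
have dd : derivable dens x (delta_mx 0 i) by exact: Ck_derivable dens_C1 Ux.
have dx : derivable (xup i) x (delta_mx 0 i) by exact: Ck_derivable (xup_smooth i 1) Ux.
have -> : pd i (dens * xup i) x =
    dens x * pd i (xup i) x + xup i x * (dens x * sev Ux (\tr (chr D i))).
  rewrite -(pd_dens i Ux); exact: deriveM.
have e3 : sev Ux (der D i (xi_up D (sacs cd) i) + \tr (chr D i) * xi_up D (sacs cd) i) =
    pd i (xup i) x + sev Ux (\tr (chr D i)) * xup i x.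
  refine (etrans (rmorphD (sev Ux) _ _) _).
  have e1 : sev Ux (der D i (xi_up D (sacs cd) i)) = pd i (xup i) x by exact: sev_pd.
  by rewrite -e1; congr (_ + _); exact: (rmorphM (sev Ux)).
rewrite -[X in _ * X = _]/(sev Ux _) e3.
by move: (pd i (xup i) x) (xup i x) (dens x) (sev Ux _) => o p q r; ring.
Qed.

End Divergence.

(** * Iterated integrals of continuous functions *)

Section Cons.
Context {R : realType}.
Local Notation leb := (@lebesgue_measure R).

Definition vcons (m : nat) (t : R) (x : 'rV[R]_m) : 'rV[R]_m.+1 := row_mx (const_mx t : 'rV_1) x.

Lemma vcons0 m t (x : 'rV[R]_m) : vcons t x 0 ord0 = t.
Proof.
have e : (ord0 : 'I_(1 + m)) = lshift m ord0 by exact/val_inj.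
by rewrite -[LHS]/(row_mx (const_mx t : 'rV_1) x 0 (ord0 : 'I_(1 + m))) e row_mxEl mxE.
Qed.

Lemma vconsS m t (x : 'rV[R]_m) j : vcons t x 0 (lift ord0 j) = x 0 j.
Proof.
have e : (lift ord0 j : 'I_(1 + m)) = rshift 1 j by exact/val_inj.
by rewrite -[LHS]/(row_mx (const_mx t : 'rV_1) x 0 (lift ord0 j : 'I_(1 + m))) e row_mxEr.
Qed.

Lemma ord_caseS m (i : 'I_m.+1) : i = ord0 \/ exists j, i = lift ord0 j.
Proof. by case: (unliftP ord0 i) => [j ->|->]; [right; exists j|left]. Qed.

Lemma vcons_norm m t (x : 'rV[R]_m) e : 0 <= e -> `|t| <= e -> `|x| <= e -> `|vcons t x| <= e.
Proof.
move=> e0 te xe; apply: norm_le_coord => // i.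
have [->|[j ->]] := ord_caseS i; rewrite ?vcons0 ?vconsS //.
exact: le_trans (coord_le_norm _ _) xe.
Qed.

Lemma vcons_norm0 m t (x : 'rV[R]_m) : `|t| <= `|vcons t x|.
Proof. by rewrite -{1}(vcons0 t x); exact: coord_le_norm. Qed.

Lemma vcons_normS m t (x : 'rV[R]_m) : `|x| <= `|vcons t x|.
Proof. by apply: norm_le_coord => // j; rewrite -(vconsS t x j); exact: coord_le_norm. Qed.

Lemma vconsB m t s (x y : 'rV[R]_m) : vcons t x - vcons s y = vcons (t - s) (x - y).
Proof.
apply/rowP => i; rewrite [LHS]mxE [X in _ + X]mxE.
by have [->|[j ->]] := ord_caseS i; rewrite ?vcons0 ?vconsS // [RHS]mxE [X in _ = _ + X]mxE.
Qed.

Lemma vcons_head_tail m (y : 'rV[R]_m.+1) : y = vcons (y 0 ord0) (\row_j y 0 (lift ord0 j)).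
Proof.
by apply/rowP => i; have [->|[j ->]] := ord_caseS i; rewrite ?vcons0 ?vconsS // mxE.
Qed.

Lemma vcons_continuous m : continuous (fun p : 'rV[R]_m * R => vcons p.2 p.1).
Proof.
move=> [x0 t0] /=; apply/cvgrPdist_le => e e0.
near=> p; rewrite vconsB; apply: vcons_norm; first exact: ltW.
  by near: p; apply: (@cvgrPdist_le _ _ _ _ _ _ _).1 => //; exact: cvg_snd.
by near: p; apply: (@cvgrPdist_le _ _ _ _ _ _ _).1 => //; exact: cvg_fst.
Unshelve. all: by end_near. Qed.

Lemma vcons_tail_continuous m t (x : 'rV[R]_m) : vcons t y @[y --> x] --> vcons t x.
Proof.
apply: (proj2 (@cvgrPdist_le _ _ _ (nbhs x) (@nbhs_filter _ x) (vcons t) (vcons t x))) => e e0.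
apply/nbhs_ballP; exists e => //= y.
rewrite -ball_normE /= => xy; rewrite vconsB subrr.
by apply: vcons_norm; [exact: ltW|rewrite normr0 ltW|exact: ltW].
Qed.

Lemma section_continuous m (f : 'rV[R]_m.+1 -> R) t : continuous f ->
  continuous (fun x => f (vcons t x)).
Proof.
move=> cf x; apply: (@continuous_comp _ _ _ (vcons t) f); last exact: cf.
exact: vcons_tail_continuous.
Qed.

Lemma box_compact m (r : R) : compact [set x : 'rV[R]_m | `|x| <= r].
Proof.
apply: bounded_closed_compact.
  exists r; split; first exact: num_real.
  by move=> s rs x /= xr; exact: le_trans xr (ltW rs).
rewrite (_ : [set _ | _] = (fun x : 'rV[R]_m => `|x|) @^-1` [set t | t <= r]) //.
by apply: closed_comp; [move=> x _; exact: norm_continuous|exact: closed_le].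
Qed.

(** Compactness of the cube makes the estimate uniform in x; this gives the continuity of inner
    integrals and differentiation under the integral sign. *)
Lemma section_uniform m (f : 'rV[R]_m.+1 -> R) r t0 e : 0 < e -> continuous f ->
  \forall t \near t0, forall x : 'rV[R]_m, `|x| <= r -> `|f (vcons t x) - f (vcons t0 x)| <= e.
Proof.
move=> e0 cf.
have /compact_near_coveringP := @box_compact m r.
move=> /(_ R (nbhs t0) (fun t x => `|f (vcons t x) - f (vcons t0 x)| <= e)); apply => x _.
have e20 : 0 < e / 2 by rewrite divr_gt0.
have c2 : {for (x, t0), continuous (fun p : 'rV[R]_m * R => f (vcons p.2 p.1))}.
  by apply: (@continuous_comp _ _ _ (fun p : 'rV[R]_m * R => vcons p.2 p.1) f); [exact: vcons_continuous|exact: cf].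
have /cvgrPdist_le/(_ _ e20) h1 := c2.
have h2 : \forall p \near (x, t0), `|f (vcons t0 x) - f (vcons t0 p.1)| <= e / 2.
  have h := proj1 (@cvgrPdist_le _ _ _ (nbhs x) (@nbhs_filter _ x) (fun y => f (vcons t0 y)) _) (@section_continuous m f t0 cf x) _ e20.
  exists ([set y | `|f (vcons t0 x) - f (vcons t0 y)| <= e / 2], setT).
    by split; [exact: h|exact: filterT].
  by move=> [a b] [].
have h3 : \forall p \near (x, t0), `|f (vcons p.2 p.1) - f (vcons t0 p.1)| <= e.
  apply: filterS2 h1 h2 => p k1 k2; rewrite [e]splitr.
  apply: le_trans (ler_distD (f (vcons t0 x)) _ _) _; apply: lerD => //.
  by rewrite distrC.
by [].
Qed.

(** A real-valued iterated integral over a cube. For a continuous integrand each inner integral is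
    continuous in the outer variable, so the properties needed follow by induction on the dimension,
    without exchanging integrals. *)
Fixpoint ibox (r : R) (m : nat) : ('rV[R]_m -> R) -> R :=
  match m with
  | 0 => fun f => f 0
  | m'.+1 => fun f => \int[leb]_(t in `[- r, r]) ibox r (fun x : 'rV[R]_m' => f (vcons t x))
  end.

Section Ibox.
Variable r : R.
Hypothesis r0 : 0 < r.

Let itv_integrable (G : R -> R) : continuous G -> leb.-integrable `[- r, r] (EFin \o G).
Proof.
move=> cG; apply: continuous_compact_integrable; first exact: segment_compact.
exact: continuous_subspaceT.
Qed.

Let leb_itv : leb `[- r, r]%classic = (r + r)%:E.
Proof. by rewrite lebesgue_measure_itv /= lte_fin gtrN // -EFinB opprK. Qed.

(** The four properties are proved together: in dimension m they give the continuity of the inner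
    integral, on which dimension m + 1 relies. *)
Let ibox_good m := [/\
  forall f g : 'rV[R]_m -> R, continuous f -> continuous g ->
    ibox r (fun x => f x + g x) = ibox r f + ibox r g,
  forall c (f : 'rV[R]_m -> R), continuous f -> ibox r (fun x => c * f x) = c * ibox r f,
  forall f g : 'rV[R]_m -> R, continuous f -> continuous g ->
    (forall x, `|x| <= r -> f x <= g x) -> ibox r f <= ibox r g &
  ibox r (fun _ : 'rV[R]_m => 1) = (r + r) ^+ m].

Let good_dist m (f g : 'rV[R]_m -> R) (e : R) : ibox_good m -> continuous f -> continuous g ->
  (forall x, `|x| <= r -> `|f x - g x| <= e) -> `|ibox r f - ibox r g| <= e * (r + r) ^+ m.
Proof.
move=> [gD gZ gle g1] cf cg fg.
have ce : continuous (fun _ : 'rV[R]_m => e) by exact: cst_continuous.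
have gc : ibox r (fun _ : 'rV[R]_m => e) = e * (r + r) ^+ m.
  rewrite -g1 -gZ; last exact: cst_continuous.
  by congr ibox; apply/funext => x; rewrite mulr1.
have cD (h : 'rV[R]_m -> R) : continuous h -> continuous (fun x => h x + e).
  by move=> ch x; exact: (@continuousD _ _ _ h (fun _ => e) x (ch x) (ce x)).
rewrite ler_distl -gc lerBlDr -!gD //; apply/andP; split; apply: gle => //; try exact: cD.
  by move=> x /fg; rewrite ler_distl => /andP[+ _]; rewrite lerBlDr.
by move=> x /fg; rewrite ler_distl => /andP[].
Qed.

Let good_continuous m (f : 'rV[R]_m.+1 -> R) : ibox_good m -> continuous f ->
  continuous (fun t => ibox r (fun x => f (vcons t x))).
Proof.
move=> gm cf t0; apply/cvgrPdist_le => e e0.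
have c0 : 0 < (r + r) ^+ m by rewrite exprn_gt0 // addr_gt0.
have e'0 : 0 < e / (r + r) ^+ m by rewrite divr_gt0.
apply: filterS (section_uniform r t0 e'0 cf) => t h.
rewrite distrC -[e](divfK (lt0r_neq0 c0)); apply: good_dist => //; exact: section_continuous.
Qed.

Let good m : ibox_good m.
Proof.
elim: m => [|m IH].
  split=> //= f g _ _ fg; apply: fg; rewrite normr0 ltW //.
have [gD gZ gle g1] := IH.
have ci (f : 'rV[R]_m.+1 -> R) : continuous f -> leb.-integrable `[- r, r] (EFin \o (fun t => ibox r (fun x => f (vcons t x)))).
  by move=> cf; apply: itv_integrable; exact: good_continuous.
have mI : measurable (`[- r, r]%classic : set R) by exact: measurable_itv.
split=> /=.
- move=> f g cf cg; rewrite -RintegralD //; try exact: ci.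
  by apply: eq_Rintegral => t _; rewrite gD //; exact: section_continuous.
- move=> c f cf; rewrite -RintegralZl //; last exact: ci.
  by apply: eq_Rintegral => t _; rewrite gZ //; exact: section_continuous.
- move=> f g cf cg fg; apply: le_Rintegral => //; try exact: ci.
  move=> t /=; rewrite in_itv /= => tr; apply: gle; try exact: section_continuous.
  by move=> x xr; apply: fg; apply: vcons_norm => //; [exact: ltW|rewrite ler_norml].
- rewrite g1 (Rintegral_cst leb mI) exprSr; congr (_ * _).
  rewrite -[RHS]/(fine (r + r)%:E); congr fine; exact: leb_itv.
Qed.

Lemma iboxD m (f g : 'rV[R]_m -> R) : continuous f -> continuous g ->
  ibox r (fun x => f x + g x) = ibox r f + ibox r g.
Proof. by have [h _ _ _] := good m; exact: h. Qed.

Lemma iboxZ m c (f : 'rV[R]_m -> R) : continuous f -> ibox r (fun x => c * f x) = c * ibox r f.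
Proof. by have [_ h _ _] := good m; exact: h. Qed.

Lemma ibox_le m (f g : 'rV[R]_m -> R) : continuous f -> continuous g ->
  (forall x, `|x| <= r -> f x <= g x) -> ibox r f <= ibox r g.
Proof. by have [_ _ h _] := good m; exact: h. Qed.

Lemma ibox1 m : ibox r (fun _ : 'rV[R]_m => 1) = (r + r) ^+ m.
Proof. by have [_ _ _ h] := good m. Qed.

Lemma ibox_dist m (f g : 'rV[R]_m -> R) e : continuous f -> continuous g ->
  (forall x, `|x| <= r -> `|f x - g x| <= e) -> `|ibox r f - ibox r g| <= e * (r + r) ^+ m.
Proof. exact: good_dist (good m). Qed.

Lemma ibox_continuous m (f : 'rV[R]_m.+1 -> R) : continuous f ->
  continuous (fun t => ibox r (fun x => f (vcons t x))).
Proof. exact: good_continuous (good m). Qed.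

Lemma ibox_ext m (f g : 'rV[R]_m -> R) : (forall x, `|x| <= r -> f x = g x) -> ibox r f = ibox r g.
Proof.
elim: m f g => [|m IH] f g fg /=; first by apply: fg; rewrite normr0 ltW.
apply: eq_Rintegral => t; rewrite inE /= in_itv /= => tr; apply: IH => x xr.
by apply: fg; apply: vcons_norm => //; [exact: ltW|rewrite ler_norml].
Qed.

Lemma ibox0 m : ibox r (fun _ : 'rV[R]_m => 0) = 0.
Proof.
have e : ibox r (fun x : 'rV[R]_m => 0 * 1) = 0 * ibox r (fun _ : 'rV[R]_m => 1).
  by apply: iboxZ; exact: cst_continuous.
by apply: etrans (etrans e (mul0r _)); apply: ibox_ext => x _; rewrite mul0r.
Qed.

Lemma ibox_ge0 m (f : 'rV[R]_m -> R) : continuous f -> (forall x, 0 <= f x) -> 0 <= ibox r f.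
Proof.
move=> cf f0; rewrite -(ibox0 m); apply: ibox_le => //; exact: cst_continuous.
Qed.

(** The support bound lets each integration over the line be restricted to the segment. *)
Lemma integral_rV_ibox m (f : 'rV[R]_m -> R) : continuous f -> (forall x, 0 <= f x) ->
  (forall x, r < `|x| -> f x = 0) -> integral_rV (fun x => (f x)%:E) = (ibox r f)%:E.
Proof.
elim: m f => [|m IH] f cf f0 fr //=.
have e t : integral_rV (fun x => (f (vcons t x))%:E) = (ibox r (fun x => f (vcons t x)))%:E.
  apply: IH => // [|x xr]; first exact: section_continuous.
  by apply: fr; exact: lt_le_trans xr (vcons_normS _ _).
apply: (@etrans _ _ (\int[leb]_t (ibox r (fun x => f (vcons t x)))%:E)%E).
  by apply: eq_integral => t _; exact: e.
have iI : leb.-integrable `[- r, r] (EFin \o (fun t => ibox r (fun x => f (vcons t x)))).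
  by apply: itv_integrable; exact: ibox_continuous.
rewrite /Rintegral fineK; last exact: integrable_fin_num.
rewrite [RHS]integral_mkcond; apply: eq_integral => t _; rewrite /patch.
case: ifPn => // /negP; rewrite inE /= in_itv /= -ler_norml => /negP; rewrite -ltNge => rt.
rewrite (_ : ibox _ _ = 0) // -(ibox0 m); congr ibox; apply/funext => x.
by apply: fr; exact: lt_le_trans rt (vcons_norm0 _ _).
Qed.

Lemma ibox_gt0 m (f : 'rV[R]_m -> R) x0 : continuous f -> (forall x, 0 <= f x) ->
  `|x0| < r -> 0 < f x0 -> 0 < ibox r f.
Proof.
elim: m f x0 => [|m IH] f x0 cf f0 xr fx /=; first by rewrite (_ : 0 = x0) //; apply/rowP => -[].
pose G t := ibox r (fun x => f (vcons t x)); pose t0 := x0 0 ord0.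
have cG : continuous G by exact: ibox_continuous.
have G0 t : 0 <= G t by apply: ibox_ge0 => //; exact: section_continuous.
have Gt0 : 0 < G t0.
  apply: (IH _ (\row_j x0 0 (lift ord0 j))) => //; first exact: section_continuous.
    by apply: le_lt_trans xr; rewrite [in leRHS](vcons_head_tail x0) vcons_normS.
  by rewrite -vcons_head_tail.
have G20 : 0 < G t0 / 2 by rewrite divr_gt0.
have tr : `|t0| < r by exact: le_lt_trans (coord_le_norm _ _) xr.
have [d d0 hd] : exists2 d : R, 0 < d & forall t, `|t0 - t| < d -> G t0 / 2 <= G t.
  have /cvgrPdist_le/(_ _ G20)/nbhs_ballP[d d0 hd] := cG t0; exists d => // t td.
  have := hd t; rewrite -ball_normE /= => /(_ td); rewrite ler_distl => /andP[_].
  by rewrite -lerBlDr; lra.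
(* The closed interval of radius [e] around [t0] lies both in the region where [G] exceeds half its
   value and in the segment of integration. *)
pose e := Order.min (d / 2) (r - `|t0|).
have e0 : 0 < e by rewrite lt_min divr_gt0 //= subr_gt0.
have e1 : e <= d / 2 by rewrite ge_min lexx.
have e2 : e <= r - `|t0| by rewrite ge_min lexx orbT.
have sub : `[t0 - e, t0 + e]%classic `<=` `[- r, r]%classic.
  move=> t /=; rewrite !in_itv /= => /andP[h1 h2].
  have := ler_norm t0; have := ler_norm (- t0); rewrite normrN => h3 h4.
  by apply/andP; split; lra.
have mJ : measurable (`[t0 - e, t0 + e]%classic : set R) by exact: measurable_itv.
have mI : measurable (`[- r, r]%classic : set R) by exact: measurable_itv.
have iG (A : R) B : leb.-integrable `[A, B] (EFin \o G).
  apply: continuous_compact_integrable; first exact: segment_compact.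
  exact: continuous_subspaceT.
have lJ : leb `[t0 - e, t0 + e]%classic = (e + e)%:E.
  rewrite lebesgue_measure_itv /= lte_fin ltrD2l gtrN // -EFinB; congr _%:E; lra.
have h1 : (G t0 / 2) * (e + e) <= \int[leb]_(t in `[t0 - e, t0 + e]) G t.
  have -> : (G t0 / 2) * (e + e) = \int[leb]_(t in `[t0 - e, t0 + e]) (G t0 / 2).
    rewrite (Rintegral_cst leb mJ); congr (_ * _).
    rewrite -[LHS]/(fine (e + e)%:E); congr fine; exact: esym lJ.
  apply: le_Rintegral => //; last first.
    move=> t /=; rewrite in_itv /= => /andP[k1 k2]; apply: hd.
    by rewrite ltr_distl; apply/andP; split; lra.
  apply: continuous_compact_integrable; first exact: segment_compact.
  by apply: continuous_subspaceT => ?; exact: cvg_cst.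
have h2 : \int[leb]_(t in `[t0 - e, t0 + e]) G t <= \int[leb]_(t in `[- r, r]) G t.
  rewrite /Rintegral fine_le ?integrable_fin_num //.
  apply: ge0_subset_integral => //.
    exact: measurable_int (iG _ _).
  by move=> t _; rewrite lee_fin.
apply: lt_le_trans (le_trans h1 h2); rewrite mulr_gt0 // addr_gt0 //.
Qed.

Let vcons_shift m t (x : 'rV[R]_m) (h : R) j :
  h *: delta_mx 0 (lift ord0 j) + vcons t x = vcons t (h *: delta_mx 0 j + x).
Proof.
apply/rowP => i; rewrite [LHS]mxE [X in X + _]mxE [delta_mx _ _ _ _]mxE.
have [->|[k ->]] := ord_caseS i; first by rewrite !vcons0 mulr0 add0r.
by rewrite !vconsS [RHS]mxE [in RHS]mxE [delta_mx _ _ _ _]mxE (inj_eq lift_inj).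
Qed.

Let vcons_shift0 m t (x : 'rV[R]_m) (h : R) :
  h *: delta_mx 0 ord0 + vcons t x = vcons (h + t) x.
Proof.
apply/rowP => i; rewrite [LHS]mxE [X in X + _]mxE [delta_mx _ _ _ _]mxE.
have [->|[k ->]] := ord_caseS i; first by rewrite !vcons0 mulr1.
by rewrite !vconsS mulr0 add0r.
Qed.

Let section_quot m (f : 'rV[R]_m.+1 -> R) t (x : 'rV[R]_m) j :
  (fun h : R => h^-1 *: (((fun x => f (vcons t x)) \o shift x) (h *: delta_mx 0 j) - f (vcons t x))) =
  (fun h : R => h^-1 *: ((f \o shift (vcons t x)) (h *: delta_mx 0 (lift ord0 j)) - f (vcons t x))).
Proof. by apply/funext => h /=; rewrite vcons_shift. Qed.

Let section_pd m (f : 'rV[R]_m.+1 -> R) t x j :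
  pd j (fun x => f (vcons t x)) x = pd (lift ord0 j) f (vcons t x).
Proof. by rewrite /pd /derive section_quot. Qed.

Let section_C1 m (f : 'rV[R]_m.+1 -> R) t : Ck_on 1 setT f -> Ck_on 1 setT (fun x => f (vcons t x)).
Proof.
move=> [cf df]; split=> [x _|j].
  by apply: section_continuous => y; exact: cf.
have [d1 [c1 _]] := df (lift ord0 j); split=> [x _|].
  by rewrite /derivable section_quot; exact: d1.
have e : 'D_(delta_mx 0 j) (fun x => f (vcons t x)) = (fun x => pd (lift ord0 j) f (vcons t x)).
  by apply/funext => x; exact: section_pd.
rewrite e; split=> // x _; apply: section_continuous => y; exact: c1.
Qed.

Let cD m (f g : 'rV[R]_m -> R) : continuous f -> continuous g -> continuous (fun x => f x + g x).
Proof. by move=> cf cg x; exact: (@continuousD _ _ _ f g x (cf x) (cg x)). Qed.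

Let cZ m c (f : 'rV[R]_m -> R) : continuous f -> continuous (fun x => c * f x).
Proof.
move=> cf x; exact: (@continuousM _ _ (fun _ => c) f x (@cst_continuous _ _ c x) (cf x)).
Qed.

(** For a later coordinate the induction applies to each section. For the first one the derivative
    is taken outside the inner integral, and the fundamental theorem of calculus leaves two boundary
    values, which vanish. *)
Lemma ibox_pd m (f : 'rV[R]_m -> R) a : Ck_on 1 setT f ->
  (forall x, r <= `|x| -> f x = 0) -> ibox r (pd a f) = 0.
Proof.
elim: m f a => [|m IH] f a C1 fr; first by case: a.
have cf : continuous f by move=> x; exact: (Ck_continuous C1).
have [->|[j ->]] := ord_caseS a; last first.
  rewrite /= (eq_Rintegral leb (g := fun _ => 0)); last first.
    move=> t _; rewrite -[RHS](IH (fun x => f (vcons t x)) j); last first.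
    - by move=> x xr; apply: fr; exact: le_trans xr (vcons_normS _ _).
    - exact: section_C1.
    by congr ibox; apply/funext => x; rewrite section_pd.
  by rewrite Rintegral_cst ?mul0r //; exact: measurable_itv.
pose G t := ibox r (fun x => f (vcons t x)).
pose G' t := ibox r (fun x => pd ord0 f (vcons t x)).
have cpd : continuous (pd ord0 f) by move=> x; exact: (Ck_continuous (Ck_derive ord0 C1)).
have cG' : continuous G' by exact: ibox_continuous.
have dG (t : R) : is_derive t 1 G (G' t).
  (* Each difference quotient is a value of the partial derivative at an intermediate point, by
     [line_MVT], and [section_uniform] bounds the error uniformly in the inner variable. *)
  have key : h^-1 *: ((G \o shift t) (h *: 1) - G t) @[h --> (0 : R)^'] --> G' t.
    apply/cvgrPdist_le => e e0.
    have c0 : 0 < (r + r) ^+ m by rewrite exprn_gt0 // addr_gt0.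
    have e'0 : 0 < e / (r + r) ^+ m by rewrite divr_gt0.
    have /nbhs_ballP[d d0 hd] := section_uniform r t e'0 cpd.
    apply/nbhs_ballP; exists d => //= h; rewrite -ball_normE /= sub0r normrN => hd' h0.
    have -> : h *: (1 : R) = h by exact: mulr1.
    have -> : h^-1 *: (G (h + t) - G t) = ibox r (fun x => h^-1 * (f (vcons (h + t) x) + -1 * f (vcons t x))).
      rewrite iboxZ; last by apply: cD; [|apply: cZ]; exact: section_continuous.
      rewrite iboxD; [|exact: section_continuous|by apply: cZ; exact: section_continuous].
      by rewrite iboxZ ?mulN1r //; exact: section_continuous.
    rewrite -[e](divfK (lt0r_neq0 c0)); apply: ibox_dist.
    - exact: section_continuous.
    - by apply: cZ; apply: cD; [|apply: cZ]; exact: section_continuous.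
    move=> x xr.
    have [|s sh es] := @line_MVT R _ f (vcons t x) (delta_mx 0 ord0) h.
      by move=> s _; exact: (Ck_derivable C1).
    rewrite -vcons_shift0 mulN1r.
    have -> : h^-1 * (f (h *: delta_mx 0 ord0 + vcons t x) - f (vcons t x)) = pd ord0 f (vcons (s + t) x).
      by rewrite [h *: _ + _]addrC es mulKf // /pd -vcons_shift0 [s *: _ + _]addrC.
    rewrite distrC; apply: hd => //; rewrite -ball_normE /= opprD addrCA subrr addr0 normrN.
    exact: le_lt_trans sh hd'.
  split; first by apply/cvg_ex; exists (G' t).
  exact: cvg_lim.
have Gr t : `|t| = r -> G t = 0.
  move=> tr; rewrite /G -(ibox0 m); congr ibox; apply/funext => x.
  by apply: fr; rewrite -tr vcons_norm0.
have cG : continuous G by exact: ibox_continuous.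
have rr : - r < r by rewrite gtrN.
have := @continuous_FTC2 R G' G (- r) r rr (continuous_subspaceT cG').
move=> h; rewrite /= /Rintegral [X in fine X]h ?Gr ?normrN ?gtr0_norm //.
- by rewrite subee.
- split=> [t _||]; first by case: (dG t).
  + by apply: cvg_at_right_filter; exact: cG.
  + by apply: cvg_at_left_filter; exact: cG.
- by move=> t _; rewrite derive1E; case: (dG t).
Qed.

End Ibox.
End Cons.

(** * Monotonicity of iterated integrals *)

Section IntegralMonotone.
Context {R : realType}.

(** The integral of a nonnegative function is a supremum over simple functions below it, so it is
    monotone with no measurability hypothesis. The inner integrals of indicators are handled in this
    way. *)
Lemma integral_le_nomeas d (T : measurableType d) (mu : {measure set T -> \bar R}) (f g : T -> \bar R) :
  (forall x, (0 <= f x)%E) -> (forall x, (f x <= g x)%E) ->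
  (\int[mu]_x f x <= \int[mu]_x g x)%E.
Proof.
move=> f0 fg; rewrite !ge0_integralTE //; last by move=> x; exact: le_trans (f0 x) (fg x).
by apply: ereal_sup_le => _ [h hf <-]; exists h => // x; exact: le_trans (hf x) (fg x).
Qed.

Lemma integral_rV_ge0 m (f : 'rV[R]_m -> \bar R) : (forall x, (0 <= f x)%E) -> (0 <= integral_rV f)%E.
Proof.
elim: m f => [|m IH] f f0 /=; first exact: f0.
by apply: integral_ge0 => t _; exact: IH.
Qed.

Lemma integral_rV_le m (f g : 'rV[R]_m -> \bar R) : (forall x, (0 <= f x)%E) ->
  (forall x, (f x <= g x)%E) -> (integral_rV f <= integral_rV g)%E.
Proof.
elim: m f g => [|m IH] f g f0 fg /=; first exact: fg.
by apply: integral_le_nomeas => t; [exact: integral_rV_ge0|exact: IH].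
Qed.

Lemma integral_rV_fin m (f : 'rV[R]_m -> R) (r c : R) : 0 < r -> (forall x, 0 <= f x) ->
  (forall x, f x <= c) -> (forall x, r < `|x| -> f x = 0) ->
  (integral_rV (fun x => (f x)%:E) < +oo)%E.
Proof.
move=> r0 f0 fc fr; have c0 : 0 <= c := le_trans (f0 0) (fc 0).
(* A continuous majorant, equal to c on the cube of radius r and to 0 beyond radius r + 1. *)
pose psi (x : 'rV[R]_m) := c * Num.max 0 (Num.min 1 (r + 1 - `|x|)).
have cpsi : continuous psi.
  have cn : continuous (fun x : 'rV[R]_m => r + 1 - `|x|).
    move=> x; apply: (@continuousB _ _ _ (fun _ => r + 1) (fun x => `|x|) x); first exact: cst_continuous.
    exact: norm_continuous.
  move=> x; apply: (@continuousM _ _ (fun _ => c) (fun x : 'rV[R]_m => Num.max 0 (Num.min 1 (r + 1 - `|x|))) x); first exact: cst_continuous.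
  apply: (@continuous_max _ _ (fun _ => 0) (fun x : 'rV[R]_m => Num.min 1 (r + 1 - `|x|))); first exact: cst_continuous.
  apply: (@continuous_min _ _ (fun _ => 1) (fun x : 'rV[R]_m => r + 1 - `|x|)); first exact: cst_continuous.
  exact: cn.
have p0 x : 0 <= psi x by rewrite mulr_ge0 // le_max lexx.
have r10 : 0 < r + 1 by rewrite addr_gt0.
apply: (@le_lt_trans _ _ (integral_rV (fun x => (psi x)%:E))).
  apply: integral_rV_le => x; rewrite lee_fin //.
  have [rx|xr] := ltP r `|x|; first by rewrite fr.
  rewrite /psi (min_idPl _) ?(max_idPr _) ?mulr1 //; lra.
rewrite (integral_rV_ibox r10 cpsi p0) ?ltry // => x xr.
rewrite /psi (max_idPl _) ?mulr0 // ge_min; apply/orP; right; lra.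
Qed.

End IntegralMonotone.

Section ZeroExtension.
Context {R : realType} {n : nat}.
Local Notation vec := 'rV[R]_n.

(** K is compact, hence closed, so near any point the extension is f or zero. *)
Lemma clip_Ck k (U K : set vec) (f : vec -> R) : open U -> compact K -> K `<=` U ->
  (forall x, U x -> ~ K x -> f x = 0) -> Ck_on k U f -> Ck_on k setT (@clip _ _ U f).
Proof.
move=> oU cK KU f0 kf; apply: Ck_local => x _; have [Ux|nUx] := pselect (U x).
  exists U; first by split.
  by apply: Ck_ext kf => // y Uy; rewrite clipE.
have oK : open (~` K) by apply: closed_openC; apply: compact_closed cK; exact: norm_hausdorff.
exists (~` K); first by split=> // /KU.
apply: (@Ck_ext _ _ _ k _ (cst (0 : R))) => //; last exact: Ck_cst.
move=> y nKy; rewrite /clip; case: asboolP => // Uy; exact: esym (f0 _ Uy nKy).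
Qed.

End ZeroExtension.

(** * Comparison of functionals through superlevel sets *)

Section LayerCake.
Context {R : realType}.

(** The slice of y between c and c + e, rescaled to [0, 1]. It is continuous in y and lies between
    the indicators of y >= c + e and of y > c. *)
Definition clamp (c e y : R) := Num.min 1 (Num.max 0 ((y - c) / e)).

Lemma clamp_ge0 c e y : 0 <= clamp c e y.
Proof. by rewrite le_min ler01 le_max lexx. Qed.

Lemma clamp_le1 c e y : clamp c e y <= 1. Proof. by rewrite ge_min lexx. Qed.

Lemma clamp_eq0 c e y : 0 < e -> y <= c -> clamp c e y = 0.
Proof.
move=> e0 yc; have h : (y - c) / e <= 0 by rewrite pmulr_lle0 ?invr_gt0 // subr_le0.
by rewrite /clamp (max_idPl h) (min_idPr ler01).
Qed.

Lemma clamp_eq1 c e y : 0 < e -> c + e <= y -> clamp c e y = 1.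
Proof.
move=> e0 yc; have h : 1 <= (y - c) / e by rewrite ler_pdivlMr // mul1r lerBrDl.
by rewrite /clamp (max_idPr (le_trans ler01 h)) (min_idPl h).
Qed.

Lemma clamp_mid c e y : 0 < e -> c <= y -> y <= c + e -> e * clamp c e y = y - c.
Proof.
move=> e0 cy yc; have h0 : 0 <= (y - c) / e by rewrite divr_ge0 ?subr_ge0 // ltW.
have h1 : (y - c) / e <= 1 by rewrite ler_pdivrMr // mul1r lerBlDl.
by rewrite /clamp (max_idPr h0) (min_idPr h1) mulrC divfK // gt_eqF.
Qed.

Lemma clamp_sum e y K : 0 < e -> 0 <= y -> y <= K%:R * e ->
  \sum_(k < K) e * clamp (k%:R * e) e y = y.
Proof.
move=> e0 y0; suff h : \sum_(k < K) e * clamp (k%:R * e) e y = Num.min y (K%:R * e).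
  by move=> yK; rewrite h (min_idPl yK).
elim: K => [|K IH]; first by rewrite big_ord0 mul0r (min_idPr y0).
rewrite big_ord_recr /= IH -natr1 mulrDl mul1r.
have [h1|h1] := leP y (K%:R * e).
  by rewrite clamp_eq0 // mulr0 addr0 (min_idPl _) //; lra.
have [h2|h2] := leP y (K%:R * e + e).
  rewrite clamp_mid ?(ltW h1) //; lra.
by rewrite clamp_eq1 ?(ltW h2) // mulr1.
Qed.

(** F is cut into slices of height e. With v(c) the volume where F > c, the slice at c + e is at
    most v(c + e) for [L1] and the slice at c is at least v(c + e) for [L2], so the sums compare
    after a shift by one slice. *)
Lemma layer_le (T : Type) (L1 L2 : (T -> R) -> R) (F : T -> R) (v : R -> R) (B C : R) :
  (forall p, 0 <= F p) -> (forall p, F p <= B) ->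
  (forall e K, 0 < e -> (forall p, F p <= K%:R * e) ->
     L1 F = \sum_(k < K) e * L1 (fun p => clamp (k%:R * e) e (F p))) ->
  (forall e K, 0 < e -> (forall p, F p <= K%:R * e) ->
     L2 F = \sum_(k < K) e * L2 (fun p => clamp (k%:R * e) e (F p))) ->
  (forall c e, 0 <= c -> 0 < e -> L1 (fun p => clamp c e (F p)) <= v c) ->
  (forall c e, 0 <= c -> 0 < e -> v (c + e) <= L2 (fun p => clamp c e (F p))) ->
  (forall e, 0 < e -> L1 (fun p => clamp 0 e (F p)) <= C) ->
  (forall c e, 0 <= c -> 0 < e -> 0 <= L2 (fun p => clamp c e (F p))) -> 0 <= C ->
  L1 F <= L2 F.
Proof.
move=> F0 FB s1 s2 v1 v2 hC L20 C0; apply/ler_addgt0Pl => eps eps0.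
(* The lowest slice of [L1] has no partner; it costs at most e C, which this choice keeps below
   [eps]. *)
pose e := eps / (C + 1); have e0 : 0 < e by rewrite divr_gt0 // ltr_wpDl.
have [K hK] : exists K : nat, B <= K%:R * e.
  exists (Num.truncn (B / e)).+1; rewrite -ler_pdivrMr //; exact/ltW/truncnS_gt.
have FK p : F p <= K.+1%:R * e.
  by apply: le_trans (FB p) (le_trans hK _); rewrite ler_pM2r // ler_nat.
rewrite (s1 e K.+1 e0 FK) (s2 e K.+1 e0 FK) big_ord_recl big_ord_recr /= mul0r.
have h1 : e * L1 (fun p => clamp 0 e (F p)) <= eps.
  apply: le_trans (_ : e * C <= _); first by rewrite ler_pM2l // hC.
  rewrite /e mulrAC ler_pdivrMr ?ltr_wpDl // ler_pM2l //; lra.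
have h2 : \sum_(k < K) e * L1 (fun p => clamp ((bump 0 k)%:R * e) e (F p)) <=
          \sum_(k < K) e * L2 (fun p => clamp (k%:R * e) e (F p)).
  apply: ler_sum => k _; rewrite ler_pM2l //.
  have k0 : 0 <= k%:R * e by rewrite mulr_ge0 // ltW.
  apply: le_trans (v1 _ _ _ e0) _; first by rewrite mulr_ge0 // ltW.
  have -> : (bump 0 k)%:R * e = k%:R * e + e by rewrite /bump /= -nat1r mulrDl mul1r addrC.
  exact: v2.
apply: lerD => //; apply: le_trans h2 _; rewrite lerDl mulr_ge0 ?(ltW e0) // L20 // mulr_ge0 // ltW //.
Qed.

End LayerCake.

(** * Integration on the manifold *)

Section LinearSum.
Context {R : realType} {T : Type} (P : (T -> R) -> Prop) (L : (T -> R) -> R).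
Hypothesis PD : forall f g, P f -> P g -> P (fun x => f x + g x).
Hypothesis PZ : forall c f, P f -> P (fun x => c * f x).
Hypothesis P0 : P (fun _ => 0).
Hypothesis LD : forall f g, P f -> P g -> L (fun x => f x + g x) = L f + L g.
Hypothesis LZ : forall c f, P f -> L (fun x => c * f x) = c * L f.
Hypothesis L0 : L (fun _ => 0) = 0.

Lemma lin_sum (I : Type) (r : seq I) (G : I -> T -> R) : (forall k, P (G k)) ->
  P (fun x => \sum_(k <- r) G k x) /\ L (fun x => \sum_(k <- r) G k x) = \sum_(k <- r) L (G k).
Proof.
move=> PG; elim: r => [|k r [IH1 IH2]].
  by rewrite big_nil (_ : (fun _ => _) = (fun _ => 0)) //; apply/funext => x; rewrite big_nil.
rewrite big_cons (_ : (fun _ => _) = (fun x => G k x + \sum_(l <- r) G l x)); last first.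
  by apply/funext => x; rewrite big_cons.
by split; [exact: PD|rewrite LD // IH2].
Qed.

Lemma lin_clamp_sum (F : T -> R) e K : 0 < e -> (forall p, 0 <= F p) ->
  (forall p, F p <= K%:R * e) -> (forall c, 0 <= c -> P (fun p => clamp c e (F p))) ->
  L F = \sum_(k < K) e * L (fun p => clamp (k%:R * e) e (F p)).
Proof.
move=> e0 F0 FK PC.
have Pk (k : 'I_K) : P (fun p => clamp (k%:R * e) e (F p)) by apply: PC; rewrite mulr_ge0 // ltW.
have [_ e1] := lin_sum (index_enum 'I_K) (fun k => PZ e (Pk k)).
rewrite -(eq_bigr _ (fun k _ => LZ e (Pk k))) -[RHS]e1.
by congr L; apply/funext => p; rewrite clamp_sum.
Qed.

End LinearSum.

Lemma continuous_near_eq_top {T : topologicalType} {R : realType} (f g : T -> R) (x : T) :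
  (\forall y \near x, f y = g y) -> {for x, continuous f} -> {for x, continuous g}.
Proof.
move=> fg cf; rewrite /prop_for /continuous_at -(nbhs_singleton fg).
exact: (cvg_trans (near_eq_cvg fg) cf).
Qed.

Section Manifold.
Context {R : realType} {n : nat} {N : ptopologicalType} {M : smooth_manifold R n N}.
Local Notation vec := 'rV[R]_n.
Implicit Types (i j : atlas M) (p q : N) (x : vec).
Local Notation U := (@chart_image R n N M).

Lemma open_U i : open (U i). Proof. exact: image_open. Qed.

Lemma chart_in i p : dom i p -> U i (chart i p). Proof. by move=> ip; exists p. Qed.

Lemma param_in i x : U i x -> dom i (param i x).
Proof. by case=> p ip <-; rewrite chartK. Qed.

Lemma paramK i x : U i x -> chart i (param i x) = x.
Proof. by case=> p ip <-; rewrite chartK. Qed.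

Lemma open_param_preim i (O : set N) : open O -> open [set x | U i x /\ O (param i x)].
Proof.
move=> oO; rewrite openE => x [ix Ox]; apply: filterI.
  exact: (nearU (@open_U i) ix (fun y iy => iy)).
by apply: (param_continuous ix); exact: open_nbhs_nbhs.
Qed.

Lemma overlapE i j : overlap i j = [set x | U i x /\ dom j (param i x)].
Proof.
apply/seteqP; split=> [_ [p [ip jp] <-]|x [ix jx]]; first by split; [exact: chart_in|rewrite chartK].
by exists (param i x); [split=> //; exact: param_in|exact: paramK].
Qed.

Lemma overlap_open i j : open (overlap i j).
Proof. by rewrite overlapE; apply: open_param_preim; exact: dom_open. Qed.

Lemma transition_in i j x : overlap i j x -> U j (transition i j x).
Proof. by rewrite overlapE => -[_ jx]; exact: chart_in. Qed.

Lemma param_transition i j x : overlap i j x -> param j (transition i j x) = param i x.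
Proof. by rewrite overlapE => -[_ jx]; rewrite /transition /= chartK. Qed.

Definition C1M (f : N -> R) := forall i, Ck_on 1 (U i) (fun x => f (param i x)).

Lemma charts_continuous (f : N -> R) :
  (forall i x, U i x -> {for x, continuous (fun x => f (param i x))}) -> continuous f.
Proof.
move=> cf p; pose i := chart_at M p; have ip : dom i p := mem_chart_at M p.
apply: (@continuous_near_eq_top _ _ (fun q => f (param i (chart i q)))).
  by apply: filterS (open_nbhs_nbhs (conj (dom_open i) ip)) => q iq; rewrite chartK.
apply: (@continuous_comp _ _ _ (chart i) (fun x => f (param i x))); first exact: chart_continuous.
exact: cf (chart_in ip).
Qed.

Lemma C1M_continuous f : C1M f -> continuous f.
Proof. by move=> cf; apply: charts_continuous => i x ix; exact: Ck_continuous (cf i) ix. Qed.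

Lemma C1M_cst c : C1M (fun _ => c).
Proof. by move=> i; apply: (Ck_cst 1 c); exact: open_U. Qed.

Lemma C1MD f g : C1M f -> C1M g -> C1M (fun p => f p + g p).
Proof. by move=> cf cg i; apply: (Ck_add (@open_U i) (cf i) (cg i)). Qed.

Lemma C1MM f g : C1M f -> C1M g -> C1M (fun p => f p * g p).
Proof. by move=> cf cg i; apply: (Ck_mul (@open_U i) (cf i) (cg i)). Qed.

Lemma C1MV f : (forall p, f p != 0) -> C1M f -> C1M (fun p => (f p)^-1).
Proof. by move=> f0 cf i; apply: (Ck_inv (@open_U i)) (cf i). Qed.

Lemma C1M_sum I (r : seq I) (f : I -> N -> R) : (forall k, C1M (f k)) -> C1M (fun p => \sum_(k <- r) f k p).
Proof.
move=> cf; elim: r => [|k r IH].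
  rewrite (_ : (fun p => _) = fun _ => 0); first exact: C1M_cst.
  by apply/funext => p; rewrite big_nil.
rewrite (_ : (fun p => _) = fun p => f k p + \sum_(k <- r) f k p); first exact: C1MD.
by apply/funext => p; rewrite big_cons.
Qed.

Lemma compact_preim_closed i (K : set vec) : compact K -> K `<=` U i ->
  closed [set p | dom i p /\ K (chart i p)].
Proof.
move=> cK KU.
have -> : [set p | dom i p /\ K (chart i p)] = param i @` K.
  apply/seteqP; split=> [p [ip Kp]|_ [x Kx <-]]; first by exists (chart i p) => //; rewrite chartK.
  by have ix := KU _ Kx; split; [exact: param_in|rewrite paramK].
apply: compact_closed; first exact: manifold_hausdorff M.
apply: continuous_compact cK; apply: continuous_in_subspaceT => x.
by rewrite inE => /KU; exact: param_continuous.
Qed.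

Variable h : riemannian_metric M.
Variable J : almost_complex_structure M.

Lemma cdM i : chart_data (U i) (h i) (J i).
Proof.
have oU := @open_U i; split=> //.
- by move=> a b k; exact: Ck_entry oU (metric_smooth h i k).
- exact: metric_sym.
- exact: metric_pos.
- by move=> a b k; exact: Ck_entry oU (acs_smooth J i k).
- exact: acs_sqr.
Qed.

Definition wt i x := Num.sqrt (\det (h i x)).

Lemma wt_gt0 i x : U i x -> 0 < wt i x. Proof. exact: dens_gt0 (cdM i) x. Qed.

Lemma wt_ge0 i x : 0 <= wt i x. Proof. exact: sqrtr_ge0. Qed.

Lemma wt_C1 i : Ck_on 1 (U i) (wt i). Proof. exact: dens_C1 (cdM i). Qed.

Definition supp_in i (K : set vec) (F : N -> R) := forall p, F p != 0 -> dom i p /\ K (chart i p).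

Definition ext i (F : N -> R) : vec -> R := @clip _ _ (U i) (fun x => wt i x * F (param i x)).

Section OneChart.
Variables (i : atlas M) (K : set vec) (r : R).
Hypotheses (cK : compact K) (KU : K `<=` U i) (r0 : 0 < r) (Kr : forall x, K x -> `|x| < r).
Implicit Type F : N -> R.

Definition adm F := continuous F /\ supp_in i K F.

Lemma ext_off F x : supp_in i K F -> ~ K x -> ext i F x = 0.
Proof.
move=> sF nK; rewrite /ext /clip; case: asboolP => // ix.
have [->|F0] := eqVneq (F (param i x)) 0; first by rewrite mulr0.
by have [_] := sF _ F0; rewrite paramK.
Qed.

Lemma ext_offr F x : supp_in i K F -> r <= `|x| -> ext i F x = 0.
Proof. by move=> sF rx; apply: ext_off => // /Kr; rewrite ltNge rx. Qed.

Lemma ext_Ck k F : Ck_on k (U i) (fun x => wt i x * F (param i x)) -> supp_in i K F ->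
  Ck_on k setT (ext i F).
Proof.
move=> kF sF; apply: clip_Ck cK KU _ kF; first exact: open_U.
by move=> x ix nK; have := ext_off sF nK; rewrite /ext clipE.
Qed.

Lemma ext_continuous F : adm F -> continuous (ext i F).
Proof.
move=> [cF sF] x; apply: (@Ck_continuous _ _ _ 0 setT) => //; apply: ext_Ck => //; split=> // y iy.
apply: (@continuousM _ _ (wt i) (fun x => F (param i x))); first exact: Ck_continuous (wt_C1 i) iy.
by apply: (@continuous_comp _ _ _ (param i) F); [exact: param_continuous|exact: cF].
Qed.

Lemma adm0 : adm (fun _ => 0).
Proof. by split; [exact: cst_continuous|move=> p; rewrite eqxx]. Qed.

Lemma admD f g : adm f -> adm g -> adm (fun p => f p + g p).
Proof.
move=> [cf sf] [cg sg]; split=> [p|p fg]; first exact: (@continuousD _ _ _ f g p (cf p) (cg p)).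
have [f0|/sf//] := eqVneq (f p) 0; apply: sg; apply: contra_neq fg => ->.
by rewrite f0 addr0.
Qed.

Lemma admM (f g : N -> R) : continuous g -> adm f -> adm (fun p => g p * f p).
Proof.
move=> cg [cf sf]; split=> [p|p fg]; first exact: (@continuousM _ _ g f p (cg p) (cf p)).
by apply: sf; apply: contra_neq fg => ->; rewrite mulr0.
Qed.

Lemma admZ c f : adm f -> adm (fun p => c * f p).
Proof. by apply: admM; exact: cst_continuous. Qed.

Lemma clamp_continuous c e F : continuous F -> continuous (fun p => clamp c e (F p)).
Proof.
move=> cF p.
have c1 : {for p, continuous (fun p => (F p - c) / e)}.
  apply: (@continuousM _ _ (fun p => F p - c) (fun _ => e^-1) p); last exact: cst_continuous.
  by apply: (@continuousB _ _ _ F (fun _ => c) p); [exact: cF|exact: cst_continuous].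
apply: (@continuous_min _ _ (fun _ => 1) (fun p => Num.max 0 ((F p - c) / e))); first exact: cst_continuous.
by apply: (@continuous_max _ _ (fun _ => 0) (fun p => (F p - c) / e)); first exact: cst_continuous.
Qed.

Lemma adm_clamp c e F : 0 < e -> 0 <= c -> adm F -> adm (fun p => clamp c e (F p)).
Proof.
move=> e0 c0 [cF sF]; split=> [|p]; first exact: clamp_continuous.
by move=> h1; apply: sF; apply: contra_neq h1 => ->; rewrite clamp_eq0.
Qed.

(** The integral of F computed in the chart against the Riemannian density; [iN_ilin] identifies it
    with the integral against the volume. *)
Definition ilin F := ibox r (ext i F).

Lemma ilinD f g : adm f -> adm g -> ilin (fun p => f p + g p) = ilin f + ilin g.
Proof.
move=> af ag; rewrite -iboxD //; try exact: ext_continuous.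
congr ibox; apply/funext => x; rewrite /ext /clip; case: asboolP => _; by rewrite ?addr0 // mulrDr.
Qed.

Lemma ilinZ c f : adm f -> ilin (fun p => c * f p) = c * ilin f.
Proof.
move=> af; rewrite -iboxZ //; last exact: ext_continuous.
congr ibox; apply/funext => x; rewrite /ext /clip; case: asboolP => _; by rewrite ?mulr0 // mulrCA.
Qed.

Lemma ilin0 : ilin (fun _ => 0) = 0.
Proof.
apply: etrans (ibox0 r0 n); congr ibox; apply/funext => x; rewrite /ext /clip; case: asboolP => // _.
by rewrite mulr0.
Qed.

Lemma ext_ge0 F x : (forall p, 0 <= F p) -> 0 <= ext i F x.
Proof. by move=> F0; rewrite /ext /clip; case: asboolP => // _; rewrite mulr_ge0 ?wt_ge0. Qed.

Lemma ilin_ge0 F : adm F -> (forall p, 0 <= F p) -> 0 <= ilin F.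
Proof. by move=> aF F0; apply: ibox_ge0 => //; [exact: ext_continuous|move=> x; exact: ext_ge0]. Qed.

Lemma ilin_gt0 F p : adm F -> (forall p, 0 <= F p) -> 0 < F p -> 0 < ilin F.
Proof.
move=> aF F0 Fp; have [ip Kp] := (aF.2 p (lt0r_neq0 Fp)).
apply: (@ibox_gt0 _ _ r0 _ _ (chart i p)).
- exact: ext_continuous.
- by move=> x; exact: ext_ge0.
- exact: Kr.
- by rewrite /ext clipE ?chartK ?mulr_gt0 ?wt_gt0 //; exact: chart_in.
Qed.

Lemma wt_bound : exists2 c, 0 <= c & forall x, K x -> wt i x <= c.
Proof.
have cw : compact (wt i @` K).
  apply: continuous_compact cK; apply: continuous_in_subspaceT => x.
  by rewrite inE => /KU ix; exact: Ck_continuous (wt_C1 i) ix.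
have [b [_ hb]] := compact_bounded cw.
exists (`|b| + 1); first by rewrite addr_ge0.
move=> x Kx; apply: le_trans (ler_norm _) _.
apply: (hb (`|b| + 1)); last by exists x.
by apply: le_lt_trans (ler_norm b) _; rewrite ltrDl.
Qed.

Lemma ilin_bound : exists2 C, 0 <= C & forall F, adm F -> (forall p, 0 <= F p <= 1) -> ilin F <= C.
Proof.
have [c c0 hc] := wt_bound; exists (c * (r + r) ^+ n).
  by rewrite mulr_ge0 // exprn_ge0 // addr_ge0 // ltW.
move=> F aF F01; rewrite -(ibox1 r0) -iboxZ //; last exact: cst_continuous.
apply: ibox_le => //; [exact: ext_continuous|exact: cst_continuous|move=> x _].
rewrite mulr1; have [Kx|nK] := pselect (K x); last by rewrite ext_off //; exact: aF.2.
rewrite /ext clipE; last exact: KU.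
have /andP[F0 F1] := F01 (param i x).
by apply: le_trans (hc x Kx); rewrite ler_piMr // wt_ge0.
Qed.

Local Notation T := (g_sigma_algebraType (@open N)).
Variable vol : {measure set T -> \bar R}.
Hypothesis rv : riemannian_volume h vol.

Lemma vol_fin_chart (A : set T) : measurable A -> A `<=` dom i ->
  (forall p, A p -> K (chart i p)) -> (vol A < +oo)%E.
Proof.
move=> mA Ai AK; rewrite (rv mA Ai); have [c c0 hc] := wt_bound.
apply: (@integral_rV_fin _ _ _ r c) => //.
- move=> x; rewrite indicE; case: (boolP (x \in _)); last by rewrite mulr0.
  by rewrite inE mulr1 => -[p /AK Kp <-]; exact: hc.
- move=> x rx; rewrite indicE; case: (boolP (x \in _)); last by rewrite mulr0.
  by rewrite inE => -[p /AK/Kr + px]; rewrite px ltNge ltW.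
Qed.

Hypothesis vfin : (vol setT < +oo)%E.
Hypothesis cN : compact [set: N].

Lemma open_mT (A : set N) : open A -> measurable (A : set T).
Proof. by move=> oA; apply: sub_sigma_algebra. Qed.

Lemma continuous_mT F : continuous F -> measurable_fun setT (F : T -> R).
Proof.
move=> cF; apply: (measurability _ (measurable_realfun.RGenOInfty.measurableE R)).
move=> _ [_ [x ->] <-]; rewrite setTI; apply: open_mT.
have -> : F @^-1` `]x, +oo[ = F @^-1` [set t | x < t].
  by apply/seteqP; split=> p /=; rewrite in_itv /= andbT.
by apply: open_comp; [move=> p _; exact: cF|exact: open_gt].
Qed.

Lemma continuous_bound F : continuous F -> exists B, forall p, `|F p| <= B.
Proof.
move=> cF; have : compact (F @` setT).
  by apply: continuous_compact cN; exact: continuous_subspaceT.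
move=> /compact_bounded[b [_ hb]]; exists (`|b| + 1) => p.
apply: (hb (`|b| + 1)); last by exists p.
by apply: le_lt_trans (ler_norm b) _; rewrite ltrDl.
Qed.

Lemma continuous_int F : continuous F -> vol.-integrable setT (EFin \o (F : T -> R)).
Proof.
move=> cF; apply: measurable_bounded_integrable => //; first exact: continuous_mT.
have [B hB] := continuous_bound cF; exists B; split; first exact: num_real.
by move=> s Bs p _; exact: le_trans (hB p) (ltW Bs).
Qed.

Definition iN F : R := \int[vol]_(p in [set: T]) F p.

Lemma iND (f g : N -> R) : continuous f -> continuous g -> iN (fun p => f p + g p) = iN f + iN g.
Proof. by move=> cf cg; apply: RintegralD => //; exact: continuous_int. Qed.

Lemma iNZ c (f : N -> R) : continuous f -> iN (fun p => c * f p) = c * iN f.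
Proof. by move=> cf; apply: RintegralZl => //; exact: continuous_int. Qed.

Lemma iN_le (f g : N -> R) : continuous f -> continuous g -> (forall p, f p <= g p) -> iN f <= iN g.
Proof. by move=> cf cg fg; apply: le_Rintegral => //; exact: continuous_int. Qed.

Lemma iN_cst c : iN (fun _ => c) = c * fine (vol setT).
Proof. exact: Rintegral_cst. Qed.

Let v F c := fine (vol [set p | c < F p]).

Let oset F c : continuous F -> open [set p | c < F p].
Proof. by move=> cF; apply: (@open_comp _ _ F [set t | c < t]); [move=> p _; exact: cF|exact: open_gt]. Qed.

Let vset_fin F c : continuous F -> vol [set p | c < F p] \is a fin_num.
Proof.
move=> cF; rewrite ge0_fin_numE //; apply: le_lt_trans vfin.
have mA : measurable ([set p | c < F p] : set T) by exact: (open_mT (@oset F _ cF)).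
by apply: le_measure; rewrite ?inE.
Qed.

Let iN_fin F : continuous F -> (\int[vol]_(p in [set: T]) (F p)%:E)%E \is a fin_num.
Proof. by move=> cF; apply: integrable_fin_num => //; exact: continuous_int. Qed.

Let iN_v1 F c e : continuous F -> 0 < e -> iN (fun p => clamp c e (F p)) <= v F c.
Proof.
move=> cF e0; have cc := clamp_continuous (c := c) (e := e) cF.
rewrite /iN /Rintegral /v; apply: fine_le; [exact: iN_fin|exact: vset_fin|].
have mA : measurable ([set p | c < F p] : set T) by exact: (open_mT (@oset F _ cF)).
rewrite -[X in (_ <= vol X)%E]setIT -(integral_indic vol measurableT mA).
apply: integral_le_nomeas => p; rewrite lee_fin ?clamp_ge0 //.
rewrite indicE; case: (boolP (p \in _)) => [_|]; first exact: clamp_le1.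
by rewrite notin_setE /= => /negP; rewrite -leNgt => h1; rewrite clamp_eq0.
Qed.

Let iN_v2 F c e : continuous F -> 0 < e -> v F (c + e) <= iN (fun p => clamp c e (F p)).
Proof.
move=> cF e0; have cc := clamp_continuous (c := c) (e := e) cF.
rewrite /iN /Rintegral /v; apply: fine_le; [exact: vset_fin|exact: iN_fin|].
have mA : measurable ([set p | c + e < F p] : set T) by exact: (open_mT (@oset F _ cF)).
rewrite -[X in (vol X <= _)%E]setIT -(integral_indic vol measurableT mA).
apply: integral_le_nomeas => p; rewrite lee_fin ?indicE //.
case: (boolP (p \in _)) => [|_]; last exact: clamp_ge0.
by rewrite inE /= => h1; rewrite clamp_eq1 // ltW.
Qed.

Let ilinE F : adm F -> (forall p, 0 <= F p) ->
  integral_rV (fun x => (ext i F x)%:E) = (ilin F)%:E.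
Proof.
move=> aF F0; apply: integral_rV_ibox => //; [exact: ext_continuous|by move=> x; exact: ext_ge0|].
by move=> x rx; apply: ext_offr; [exact: aF.2|exact: ltW].
Qed.

(** At a level c >= 0 the superlevel set of an admissible function lies in the chart domain, so the
    defining property of the volume applies to it. *)
Let volE F c : adm F -> 0 <= c -> vol [set p | c < F p] =
  integral_rV (fun x => (wt i x * \1_(chart i @` [set p | c < F p]) x)%:E).
Proof.
move=> [cF sF] c0; apply: rv; first exact: (open_mT (@oset F c cF)).
by move=> p /= cp; have [] := sF p (lt0r_neq0 (le_lt_trans c0 cp)).
Qed.

Let img F c x : adm F -> 0 <= c -> U i x ->
  \1_(chart i @` [set p | c < F p]) x = (c < F (param i x))%R%:R :> R.
Proof.
move=> [cF sF] c0 ix; rewrite indicE; congr (nat_of_bool _)%:R; apply/idP/idP.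
  rewrite inE => -[p cp px]; rewrite -px chartK //.
  by have [] := sF p (lt0r_neq0 (le_lt_trans c0 cp)).
by move=> h1; rewrite inE; exists (param i x) => //; exact: paramK.
Qed.

Let img0 F c x : adm F -> 0 <= c -> ~ U i x -> \1_(chart i @` [set p | c < F p]) x = 0 :> R.
Proof.
move=> [cF sF] c0 ix; rewrite indicE (_ : (x \in _) = false) //; apply/negbTE; rewrite notin_setE.
move=> -[p cp px]; apply: ix; rewrite -px; apply: chart_in.
by have [] := sF p (lt0r_neq0 (le_lt_trans c0 cp)).
Qed.

Let ilin_v1 F c e : adm F -> 0 <= c -> 0 < e -> ilin (fun p => clamp c e (F p)) <= v F c.
Proof.
move=> aF c0 e0; have ac := adm_clamp e0 c0 aF.
rewrite -lee_fin -ilinE //; last by move=> p; exact: clamp_ge0.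
rewrite fineK; last exact: vset_fin aF.1.
rewrite (volE aF c0); apply: integral_rV_le => x; rewrite lee_fin.
  by apply: ext_ge0 => p; exact: clamp_ge0.
have [ix|ix] := pselect (U i x); last by rewrite img0 // mulr0 /ext /clip asboolF.
rewrite (img aF c0 ix) /ext clipE // ler_wpM2l ?wt_ge0 //.
by have [h1|h1] := ltP c (F (param i x)); [exact: clamp_le1|rewrite clamp_eq0].
Qed.

Let ilin_v2 F c e : adm F -> 0 <= c -> 0 < e -> v F (c + e) <= ilin (fun p => clamp c e (F p)).
Proof.
move=> aF c0 e0; have ac := adm_clamp e0 c0 aF.
have ce : 0 <= c + e by rewrite addr_ge0 // ltW.
rewrite -lee_fin -[X in (_ <= X)%E]ilinE //; last by move=> p; exact: clamp_ge0.
rewrite fineK; last exact: vset_fin aF.1.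
rewrite (volE aF ce); apply: integral_rV_le => x; rewrite lee_fin.
  by rewrite mulr_ge0 ?wt_ge0 // indicE.
have [ix|ix] := pselect (U i x); last first.
  by rewrite img0 // mulr0; apply: ext_ge0 => p; exact: clamp_ge0.
rewrite (img aF ce ix) /ext clipE // ler_wpM2l ?wt_ge0 //.
by have [h1|h1] := ltP (c + e) (F (param i x)); [rewrite clamp_eq1 // ltW|exact: clamp_ge0].
Qed.

(** Both functionals squeeze the slices of F between volumes of the same superlevel sets, and
    [layer_le] applies in both directions. *)
Lemma iN_ilin_ge0 F : adm F -> (forall p, 0 <= F p) -> iN F = ilin F.
Proof.
move=> aF F0; have [B hB] := continuous_bound aF.1.
have FB p : F p <= B by exact: le_trans (ler_norm _) (hB p).
have [C C0 hC] := ilin_bound.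
have cc c e : continuous (fun p => clamp c e (F p)) by exact: clamp_continuous aF.1.
have s1 e K' : 0 < e -> (forall p, F p <= K'%:R * e) ->
    iN F = \sum_(k < K') e * iN (fun p => clamp (k%:R * e) e (F p)).
  move=> e0 FK; apply: (@lin_clamp_sum _ _ (fun f => continuous f)) => //.
  - by move=> f g cf cg p; exact: (@continuousD _ _ _ f g p (cf p) (cg p)).
  - by move=> c f cf p; exact: (@continuousM _ _ (fun _ => c) f p (@cst_continuous _ _ c p) (cf p)).
  - exact: cst_continuous.
  - exact: iND.
  - exact: iNZ.
  - by rewrite iN_cst mul0r.
have s2 e K' : 0 < e -> (forall p, F p <= K'%:R * e) ->
    ilin F = \sum_(k < K') e * ilin (fun p => clamp (k%:R * e) e (F p)).
  move=> e0 FK; apply: (@lin_clamp_sum _ _ adm) => //.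
  - exact: admD.
  - exact: admZ.
  - exact: adm0.
  - exact: ilinD.
  - exact: ilinZ.
  - exact: ilin0.
  - by move=> c c0; exact: adm_clamp.
have V0 : 0 <= fine (vol setT) by exact: fine_ge0.
apply/eqP; rewrite eq_le; apply/andP; split.
- apply: (@layer_le _ _ iN ilin F (v F) B (fine (vol setT))) => //.
  + by move=> c e c0 e0; exact: iN_v1 aF.1 e0.
  + by move=> c e c0 e0; exact: ilin_v2.
  + move=> e e0; rewrite -[leRHS]mul1r -iN_cst; apply: iN_le => //; first exact: cst_continuous.
    by move=> p; exact: clamp_le1.
  + by move=> c e c0 e0; apply: ilin_ge0; [exact: adm_clamp|move=> p; exact: clamp_ge0].
- apply: (@layer_le _ _ ilin iN F (v F) B C) => //.
  + by move=> c e c0 e0; exact: ilin_v1.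
  + by move=> c e c0 e0; exact: iN_v2 aF.1 e0.
  + move=> e e0; apply: hC; first exact: adm_clamp.
    by move=> p; rewrite clamp_ge0 clamp_le1.
  + by move=> c e c0 e0; apply: Rintegral_ge0 => p _; exact: clamp_ge0.
Qed.

(** F is the difference of two nonnegative admissible functions, max(0, F) and max(0, F) - F. *)
Lemma iN_ilin F : adm F -> iN F = ilin F.
Proof.
move=> aF.
pose P p := Num.max 0 (F p).
have cP : continuous P.
  move=> p; apply: (@continuous_max _ _ (fun _ => 0) F); [exact: cst_continuous|exact: aF.1].
have aP : adm P.
  by split=> // p P0; apply: aF.2; apply: contra_neq P0 => F0; rewrite /P F0 maxxx.
have aQ : adm (fun p => P p + -1 * F p) by apply: admD => //; exact: admZ.
have P0 p : 0 <= P p by rewrite le_max lexx.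
have Q0 p : 0 <= P p + -1 * F p by rewrite mulN1r subr_ge0 le_max lexx orbT.
have e1 : iN F = iN P + -1 * iN (fun p => P p + -1 * F p).
  rewrite iND // ?iNZ //; [|exact: aF.1|]; last by apply: (admZ (-1) aF).1.
  by ring.
rewrite e1 iN_ilin_ge0 // iN_ilin_ge0 // ilinD ?ilinZ //; last exact: admZ.
by ring.
Qed.

End OneChart.
End Manifold.

(** * Cutoff functions and partitions of unity *)

Section Bump.
Context {R : realType} {n : nat}.
Local Notation vec := 'rV[R]_n.
Variables (c : vec) (r : R).
Hypothesis r0 : 0 < r.

(** The square of the positive part is of class C^1, which is all the regularity that integration by
    parts requires of a cutoff. *)
Let pos2 (s : R) : R := Num.max 0 s ^+ 2.

Let pos2_taylor (s u : R) : `|pos2 (u + s) - pos2 s - 2 * Num.max 0 s * u| <= `|u| ^+ 2.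
Proof.
rewrite /pos2 real_normK ?num_real // ler_norml.
by have [h1|h1] := leP 0 (u + s); have [h2|h2] := leP 0 s; apply/andP; split; nra.
Qed.

Let is_derive_pos2 (s : R) : is_derive s 1 pos2 (2 * Num.max 0 s).
Proof.
have key : h^-1 *: ((pos2 \o shift s) (h *: 1) - pos2 s) @[h --> (0 : R)^'] --> 2 * Num.max 0 s.
  apply/cvgrPdist_le => e e0; apply/nbhs_ballP; exists e => //= h.
  rewrite -ball_normE /= sub0r normrN => he h0.
  have -> : h *: (1 : R) = h by exact: mulr1.
  rewrite distrC; have -> : h^-1 *: (pos2 (h + s) - pos2 s) - 2 * Num.max 0 s =
      h^-1 * (pos2 (h + s) - pos2 s - 2 * Num.max 0 s * h).
    by rewrite -[_ *: _]/(_ * _) [RHS]mulrBr [h^-1 * (_ * h)]mulrC mulfK.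
  rewrite normrM normfV ler_pdivrMl ?normr_gt0 //.
  apply: le_trans (pos2_taylor s h) _; rewrite expr2 ler_wpM2l //; exact: ltW.
split; first by apply/cvg_ex; eexists; exact: key.
exact: cvg_lim.
Qed.

Let q (x : vec) : R := r ^+ 2 - \sum_a (x 0 a - c 0 a) ^+ 2.

Let q_Ck k : Ck_on k setT q.
Proof.
have oT : open [set: vec] by exact: openT.
have k1 a : Ck_on k setT (fun x : vec => x 0 a - c 0 a).
  by apply: (Ck_add oT (Ck_coord k a) (Ck_cst k (- c 0 a) oT)).
have k2 a : Ck_on k setT (fun x : vec => (x 0 a - c 0 a) ^+ 2) by exact: (Ck_mul oT (k1 a) (k1 a)).
have k3 : Ck_on k setT (\sum_a (fun x : vec => (x 0 a - c 0 a) ^+ 2)).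
  by apply: Ck_sum.
apply: (@Ck_ext _ _ _ k setT (cst (r ^+ 2) + - \sum_a (fun x : vec => (x 0 a - c 0 a) ^+ 2))) => //.
  by move=> x _; rewrite /q -[LHS]/(r ^+ 2 - (\sum_a (fun x : vec => (x 0 a - c 0 a) ^+ 2)) x) fct_sumE.
by apply: Ck_add => //; [exact: Ck_cst|exact: Ck_opp].
Qed.

Definition bump (x : vec) : R := pos2 (q x).

Lemma bump_ge0 x : 0 <= bump x. Proof. exact: sqr_ge0. Qed.

Lemma bump_center : 0 < bump c.
Proof.
rewrite /bump /pos2 /q big1 ?subr0; last by move=> a _; rewrite subrr expr0n.
by rewrite (max_idPr _) ?exprn_gt0 // exprn_ge0 // ltW.
Qed.

Lemma bump_supp x : bump x != 0 -> `|x - c| <= r.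
Proof.
move=> bx; have qx : 0 < q x.
  by rewrite ltNge; apply: contra bx => qx; rewrite /bump /pos2 (max_idPl qx) expr0n.
apply: norm_le_coord; first exact: ltW.
move=> a; rewrite !mxE; rewrite -(ler_pXn2r (n := 2)) ?nnegrE ?(ltW r0) //.
rewrite real_normK ?num_real //; move: qx; rewrite subr_gt0 => /ltW; apply: le_trans.
by rewrite (bigD1 a) //= lerDl sumr_ge0 // => b _; exact: sqr_ge0.
Qed.

Lemma bump_C1 : Ck_on 1 setT bump.
Proof.
have oT : open [set: vec] by exact: openT.
have dq x : differentiable q x by exact: Ck_differentiable oT (q_Ck 1) I.
have h x a := pd_comp1 a (dq x) (is_derive_pos2 (q x)).
have cq : continuous q by move=> x; exact: differentiable_continuous (dq x).
have db x : differentiable bump x.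
  apply: differentiable_comp => //; apply/derivable1_diffP; by case: (is_derive_pos2 (q x)).
split=> [x _|a]; first exact: differentiable_continuous (db x).
split=> [x _|]; first by case: (h x a).
have -> : 'D_(delta_mx 0 a) bump = (fun x => 2 * Num.max 0 (q x)) * pd a q.
  by apply/funext => x; have [_ e] := h x a; exact: e.
apply: Ck_mul => //; last exact: Ck_derive (q_Ck 1).
split=> // x _; apply: (@continuousM _ _ (fun _ => 2) (fun x => Num.max 0 (q x))); first exact: cst_continuous.
by apply: (@continuous_max _ _ (fun _ => 0) q); [exact: cst_continuous|exact: cq].
Qed.

End Bump.

Section Partition.
Context {R : realType} {n : nat} {N : ptopologicalType} {M : smooth_manifold R n N}.
Local Notation vec := 'rV[R]_n.
Local Notation U := (@chart_image R n N M).

Definition chart_support (i : atlas M) (K : set vec) (r : R) :=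
  [/\ compact K, K `<=` U i, 0 < r & forall x, K x -> `|x| < r].

Lemma bump_exists p : exists t : (N -> R) * (set vec * R),
  [/\ chart_support (chart_at M p) t.2.1 t.2.2, C1M (M := M) t.1, forall q, 0 <= t.1 q, 0 < t.1 p &
    supp_in (chart_at M p) t.2.1 t.1].
Proof.
pose i := chart_at M p; have ip : dom i p := mem_chart_at M p.
pose c := chart i p; have Uc : U i c by exact: chart_in.
have /nbhs_ballP[d /= d0 hd] : nbhs c (U i) by exact: (nearU (@open_U _ _ _ M i) Uc (fun y iy => iy)).
pose r := d / 2; have r0 : 0 < r by rewrite divr_gt0.
pose K := [set x : vec | `|x - c| <= r].
have KU : K `<=` U i.
  move=> x /= xr; apply: hd; rewrite -ball_normE /= distrC; apply: le_lt_trans xr _.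
  by rewrite /r ltr_pdivrMr // mulr_natr mulr2n ltrDl.
have Kb x : K x -> `|x| < r + `|c| + 1.
  move=> /= xr; rewrite -[x](subrK c); apply: le_lt_trans (ler_normD _ _) _.
  by apply: (@le_lt_trans _ _ (r + `|c|)); [exact: lerD|rewrite ltrDl].
have cK : compact K.
  apply: bounded_closed_compact.
    exists (r + `|c| + 1); split; first exact: num_real.
    by move=> s rs x /Kb xr; exact: le_trans (ltW xr) (ltW rs).
  rewrite (_ : K = (fun x : vec => `|x - c|) @^-1` [set t | t <= r]) //.
  apply: closed_comp; last exact: closed_le.
  move=> x _; apply: (@continuous_comp _ _ _ (fun x : vec => x - c) (fun x : vec => `|x|)).
    by apply: (@continuousB _ _ _ id (fun _ => c) x); [exact: id|exact: cst_continuous].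
  exact: norm_continuous.
pose b q := if `[< dom i q >] then bump c r (chart i q) else 0.
have b0 q : 0 <= b q by rewrite /b; case: asboolP => // _; exact: bump_ge0.
have sb : supp_in i K b.
  move=> q; rewrite /b; case: asboolP => [iq bq|]; last by rewrite eqxx.
  by split=> //; exact: bump_supp bq.
have r1 : 0 < r + `|c| + 1 by rewrite ltr_wpDl // addr_ge0 // ltW.
exists (b, (K, r + `|c| + 1)); split=> //=; last first.
  by rewrite /b asboolT //; exact: bump_center.
(* On the overlap with chart i the function is the bump composed with a transition; at the other
   points the complement of the closed set S is a neighbourhood on which it vanishes. *)
move=> j; apply: Ck_local => x Ux; have [ix|nix] := pselect (dom i (param j x)).
  exists (overlap j i); first by split; [exact: overlap_open|rewrite overlapE].
  apply: (@Ck_ext _ _ _ 1 _ (bump c r \o transition j i)); first exact: overlap_open.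
    by move=> y; rewrite overlapE => -[Uy iy]; rewrite /b asboolT.
  apply: (Ck_comp (V := setT) (@overlap_open _ _ _ M j i) openT) => //; last exact: bump_C1.
  move=> a; exact: Ck_entry (@overlap_open _ _ _ M j i) (transition_smooth j i 1).
pose S := [set q | dom i q /\ K (chart i q)].
have cS : closed S by exact: compact_preim_closed cK KU.
have oV : open [set y | U j y /\ (~` S) (param j y)].
  by apply: open_param_preim; exact: closed_openC.
exists [set y | U j y /\ (~` S) (param j y)].
  by split=> //; split=> // -[/nix].
apply: (@Ck_ext _ _ _ 1 _ (cst (0 : R))) => //; last exact: Ck_cst.
move=> y [Uy nS]; have [->//|by0] := eqVneq (b (param j y)) 0.
by exfalso; apply: nS; exact: sb by0.
Qed.

Hypothesis cN : compact [set: N].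

Lemma partition_of_unity : exists (D : seq N) (chi : N -> N -> R) (K : N -> set vec) (r : N -> R),
  (forall p, [/\ chart_support (chart_at M p) (K p) (r p), C1M (M := M) (chi p),
     forall q, 0 <= chi p q & supp_in (chart_at M p) (K p) (chi p)]) /\
  forall q, \sum_(p <- D) chi p q = 1.
Proof.
have [F hF] := choice bump_exists.
pose b p := (F p).1.
have bC p : C1M (M := M) (b p) by case: (hF p).
have b0 p q : 0 <= b p q by have [_ _ h0 _ _] := hF p; exact: h0.
have ob p : open [set q | 0 < b p q].
  apply: (@open_comp _ _ (b p) [set t | 0 < t]); last exact: open_gt.
  by move=> q _; exact: C1M_continuous (bC p) q.
move: cN; rewrite compact_cover => /(_ N setT (fun p => [set q | 0 < b p q])) [|q _|D _ hD].
- by move=> p _; exact: ob.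
- by exists q => //; have [_ _ _ h0 _] := hF q; exact: h0.
pose Ds : seq N := finmap.enum_fset D.
pose S q := \sum_(p <- Ds) b p q.
have S0 q : 0 < S q.
  have [p pD bp] := hD q I; have pDs : p \in Ds by exact: pD.
  rewrite /S (big_rem p) //=.
  by apply: ltr_pwDl => //; exact: sumr_ge0.
exists Ds, (fun p q => (S q)^-1 * b p q), (fun p => (F p).2.1), (fun p => (F p).2.2).
split=> [p|q]; last by rewrite -mulr_sumr mulVf // gt_eqF.
have [cs _ _ _ sp] := hF p; split=> //.
- apply: C1MM => //; apply: C1MV => [q|]; first by rewrite gt_eqF.
  by apply: C1M_sum.
- by move=> q; rewrite mulr_ge0 // invr_ge0 ltW.
- by move=> q h1; apply: sp; apply: contra_neq h1 => h2; rewrite [b p q]h2 mulr0.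
Qed.

Local Notation T := (g_sigma_algebraType (@open N)).
Variable h : riemannian_metric M.
Variable J : almost_complex_structure M.
Variable vol : {measure set T -> \bar R}.
Hypothesis rv : riemannian_volume h vol.

(** Finitely many sets where some [chi p] is positive cover N, and each has finite volume because
    the density is bounded on a compact set. *)
Lemma volume_fin : (vol setT < +oo)%E.
Proof.
have [D [chi [K [r [hchi chi1]]]]] := partition_of_unity.
have oA p : open [set q | 0 < chi p q].
  have [_ cp _ _] := hchi p; apply: (@open_comp _ _ (chi p) [set t | 0 < t]); last exact: open_gt.
  by move=> q _; exact: C1M_continuous cp q.
have mA p : measurable ([set q | 0 < chi p q] : set T) by exact: (open_mT (oA p)).
have Afin p : (vol [set q | (0 < chi p q)%R] < +oo)%E.
  have [[cK KU r0 Kr] _ _ sp] := hchi p.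
  apply: (vol_fin_chart J cK KU r0 Kr rv) => // q /= qp; by have [] := sp q (lt0r_neq0 qp).
(* Generalising to measurable sets covered by the pieces of a list allows an induction that removes
   one piece at a time. *)
suff H (s : seq N) (A : set T) : measurable A ->
    (forall q, A q -> exists2 p, p \in s & 0 < chi p q) -> (vol A < +oo)%E.
  apply: (H D) => // q _; apply: contrapT => nq.
  have : \sum_(p <- D) chi p q = 0.
    apply: big1_seq => p /= pD; apply/eqP; rewrite eq_le; have [_ _ -> _] := hchi p.
    by rewrite andbT leNgt; apply/negP => h1; apply: nq; exists p.
  by rewrite chi1 => /eqP; rewrite oner_eq0.
elim: s A => [|p s IH] A mA' hA.
  rewrite (_ : A = set0) ?measure0 //; apply/seteqP; split=> // q /hA[].
  by [].
rewrite (measureDI vol mA' (mA p)); apply: lte_add_pinfty.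
  apply: IH; first exact: measurableD.
  move=> q [Aq nq]; have [p' + h1] := hA q Aq; rewrite inE => /orP[/eqP e|]; last by exists p'.
  by exfalso; apply: nq; rewrite /= -e.
apply: le_lt_trans (Afin p); apply: le_measure; rewrite ?inE //; first exact: measurableI.
Qed.

(** Multiplying by a bump around p gives a positive integral inside one chart; the bump is bounded,
    so f itself has a positive integral. *)
Lemma iN_gt0 (f : N -> R) p : continuous f -> (forall q, 0 <= f q) -> 0 < f p -> 0 < iN vol f.
Proof.
move=> cf f0 fp.
have [[b [K r]] /= [[cK KU r0 Kr] bC b0 bp sb]] := bump_exists p.
have cb := C1M_continuous bC.
have af : adm (M := M) (chart_at M p) K (fun q => f q * b q) by apply: admM.
have [B hB] := continuous_bound cN cb.
have h1 : 0 < iN vol (fun q => f q * b q).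
  rewrite (iN_ilin J cK KU r0 Kr rv volume_fin cN af).
  have pos q : 0 <= f q * b q by rewrite mulr_ge0.
  have pos1 : 0 < f p * b p by rewrite mulr_gt0.
  exact: (ilin_gt0 h J cK KU r0 Kr af pos pos1).
have h2 : iN vol (fun q => f q * b q) <= B * iN vol f.
  rewrite -(iNZ volume_fin cN _ cf); apply: (iN_le volume_fin cN); first exact: af.1.
    by move=> q; exact: (@continuousM _ _ (fun _ => B) f q (@cst_continuous _ _ B q) (cf q)).
  by move=> q; rewrite mulrC ler_wpM2r // (le_trans (ler_norm _)).
have h3 : 0 < B * iN vol f := lt_le_trans h1 h2.
have B0 : 0 <= B by exact: le_trans (normr_ge0 _) (hB p).
have Bp : 0 < B.
  by rewrite lt_def B0 andbT; apply/eqP => B00; move: h3; rewrite B00 mul0r ltxx.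
by move: h3; rewrite pmulr_rgt0.
Qed.

End Partition.

(** * The divergence theorem *)

Lemma jacobian_id {R : realType} {n : nat} (x : 'rV[R]_n) : 'J id x = 1%:M.
Proof.
apply/row_matrixP => a; rewrite !rowE mulmx1 -deriveEjacobian ?derive_id //.
Qed.

Lemma pd_sum {R : realType} {n : nat} (I : Type) (s : seq I) (f : I -> 'rV[R]_n -> R) a x :
  (forall k, derivable (f k) x (delta_mx 0 a)) ->
  derivable (fun y => \sum_(k <- s) f k y) x (delta_mx 0 a) /\
  pd a (fun y => \sum_(k <- s) f k y) x = \sum_(k <- s) pd a (f k) x.
Proof.
move=> df; elim: s => [|k s [IH1 IH2]].
  rewrite big_nil (_ : (fun _ => _) = cst 0); last by apply/funext => y; rewrite big_nil.
  by split; [exact: derivable_cst|rewrite /pd derive_cst].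
rewrite big_cons (_ : (fun _ => _) = f k + (fun y => \sum_(l <- s) f l y)); last first.
  by apply/funext => y; rewrite big_cons.
split; first exact: derivableD.
by rewrite -IH2 {1}/pd deriveD.
Qed.

(** * Global functions from chart expressions, and integration by parts *)

Section ChartChange.
Context {R : realType} {n : nat} {N : ptopologicalType} {M : smooth_manifold R n N}.
Variables (h : riemannian_metric M) (J : almost_complex_structure M).
Local Notation vec := 'rV[R]_n.
Local Notation U := (@chart_image R n N M).
Local Notation cd := (cdM h J).
Local Notation tr := (transition (M := M)).

Let overlap_sub i j : overlap (M := M) i j `<=` U i.
Proof. by move=> x; rewrite overlapE => -[]. Qed.

(** The two charts are compared through the data restricted to the overlap: it is pulled back from
    chart i by the identity and from chart j by the transition. *)
Let cdO i j : chart_data (overlap i j) (h i) (J i).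
Proof.
have c := cd i; split.
- exact: overlap_open.
- by move=> a b k; apply: Ck_sub (@overlap_sub i j) _; exact: (cd_g c).
- by move=> x /overlap_sub; exact: (cd_sym c).
- by move=> x /overlap_sub; exact: (cd_pos c).
- by move=> a b k; apply: Ck_sub (@overlap_sub i j) _; exact: (cd_J c).
- by move=> x /overlap_sub; exact: (cd_sqr c).
Qed.

Let sid i j a : smooth_on (overlap (M := M) i j) (fun x => id x 0 a).
Proof. by move=> k; apply: Ck_sub (Ck_coord k a). Qed.

Let g_id i j x : overlap i j x -> h i x = 'J id x *m h i (id x) *m ('J id x)^T.
Proof. by move=> _; rewrite jacobian_id mul1mx trmx1 mulmx1. Qed.

Let J_id i j x : overlap i j x -> J i x *m 'J id x = 'J id x *m J i (id x).
Proof. by move=> _; rewrite jacobian_id mul1mx mulmx1. Qed.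

Let str i j a : smooth_on (overlap i j) (fun x => tr i j x 0 a).
Proof. by move=> k; exact: Ck_entry (@overlap_open _ _ _ M i j) (transition_smooth i j k). Qed.

Lemma tq_change i j x : overlap i j x -> tq (cd i) x = tq (cd j) (tr i j x).
Proof.
move=> ox; rewrite -(tq_pull (cdO i j) (cd i) (@overlap_sub i j) (@sid i j) (@g_id i j) (@J_id i j) ox).
apply: (tq_pull (cdO i j) (cd j)) => //.
- exact: transition_in.
- by move=> y; exact: metric_compat.
- by move=> y; exact: acs_compat.
Qed.

Lemma xq_change i j x a : overlap i j x ->
  xq (cd i) a x = \sum_k 'J (tr i j) x a k * xq (cd j) k (tr i j x).
Proof.
move=> ox.
have e := xq_pull (cdO i j) (cd i) (@overlap_sub i j) (@sid i j) (@g_id i j) (@J_id i j) a ox.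
rewrite jacobian_id (bigD1 a) //= [X in _ + X]big1 ?addr0 in e; last first.
  by move=> k ka; rewrite mxE eq_sym (negbTE ka) mul0r.
rewrite mxE eqxx mul1r in e; rewrite -e.
apply: (xq_pull (cdO i j) (cd j)) => //.
- exact: transition_in.
- by move=> y; exact: metric_compat.
- by move=> y; exact: acs_compat.
Qed.

Definition glue (f : atlas M -> vec -> R) (p : N) : R := f (chart_at M p) (chart (chart_at M p) p).

Lemma glueE (f : atlas M -> vec -> R) i x :
  (forall i j x, overlap i j x -> f i x = f j (tr i j x)) -> U i x -> glue f (param i x) = f i x.
Proof.
move=> imet ix; rewrite /glue (imet i (chart_at M (param i x))) //.
by rewrite overlapE; split=> //; exact: mem_chart_at.
Qed.

Lemma glue_continuous (f : atlas M -> vec -> R) :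
  (forall i j x, overlap i j x -> f i x = f j (tr i j x)) ->
  (forall i, Ck_on 0 (U i) (f i)) -> continuous (glue f).
Proof.
move=> imet cf; apply: (@charts_continuous _ _ _ M) => i x ix.
apply: continuous_near_eq (Ck_continuous (cf i) ix).
by apply: nearU (@open_U _ _ _ M i) ix _ => y iy; rewrite glueE.
Qed.

(** The derivative of u along the vector field dual to xi. *)
Definition grad_xi (u : N -> R) i (x : vec) : R :=
  \sum_a xup (cd i) a x * pd a (fun y => u (param i y)) x.

Let grad_bil u i x : U i x -> grad_xi u i x =
  bil (invmx (h i x)) (\row_a pd a (fun y => u (param i y)) x) (\row_a xq (cd i) a x).
Proof.
move=> ix; rewrite bilE; apply: eq_bigr => a _; rewrite (xupE (cd i)) // mulr_suml.
by apply: eq_bigr => b _; rewrite !mxE; move: (xq _ _ _) (pd _ _ _) => p q; ring.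
Qed.

(** The differential of u and the covector xi both transform by the Jacobian, and the inverse metric
    in the opposite way, so their pairing is invariant. *)
Lemma grad_xi_change u i j x : C1M (M := M) u -> overlap i j x ->
  grad_xi u i x = grad_xi u j (tr i j x).
Proof.
move=> cu ox; have ix := overlap_sub ox; have jx := transition_in ox.
have oO := @overlap_open _ _ _ M i j.
pose A := 'J (tr i j) x.
have dtr a : differentiable (fun y => tr i j y 0 a) x by exact: Ck_differentiable oO (str i j a 1) ox.
have e1 : (\row_a pd a (fun y => u (param i y)) x : vec) =
    (\row_a pd a (fun y => u (param j y)) (tr i j x)) *m A^T.
  apply/rowP => a; rewrite mxE.
  have -> : pd a (fun y => u (param i y)) x = pd a ((fun y => u (param j y)) \o tr i j) x.
    apply: near_eq_derive; apply: nearU oO ox _ => y oy; rewrite /= param_transition //.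
  rewrite pd_comp //; last exact: Ck_differentiable (@open_U _ _ _ M j) (cu j) jx.
  rewrite mxE; apply: eq_bigr => k _; rewrite mxE mxE /A jacobian_pd // mxE //.
have e2 : (\row_a xq (cd i) a x : vec) = (\row_a xq (cd j) a (tr i j x)) *m A^T.
  apply/rowP => a; rewrite mxE (xq_change a ox) mxE; apply: eq_bigr => k _.
  by rewrite !mxE mulrC.
have e3 : A^T *m invmx (h i x) *m A = invmx (h j (tr i j x)).
  have gu := cd_unit (cd i) ix; have gu0 := gu; have gj := cd_unit (cd j) jx.
  have gE : h i x = A *m h j (tr i j x) *m A^T := metric_compat h ox.
  move: gu; rewrite gE !unitmx_mul => /andP[/andP[uA _] uAt].
  apply: (can_inj (mulKmx gj)); rewrite mulmxV //.
  apply: (can_inj (mulKmx uA)); rewrite mulmx1 !mulmxA -gE mulmxV ?mul1mx //.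
rewrite !grad_bil // e1 e2 -e3 /bil trmx_mul trmxK !mulmxA //.
Qed.

Lemma grad_xi_C0 u i : C1M (M := M) u -> Ck_on 0 (U i) (grad_xi u i).
Proof.
move=> cu; apply: (@Ck_ext _ _ _ 0 _ (\sum_a xup (cd i) a * pd a (fun y => u (param i y)))) => //.
- exact: open_U.
- by move=> x _; rewrite fct_sumE.
apply: Ck_sum => [|a _]; first exact: open_U.
apply: Ck_mul; [exact: open_U|exact: xup_smooth|exact: Ck_derive (cu i)].
Qed.

(** Only t and the derivatives of functions along xi are made global; the divergence of xi is
    integrated inside charts. *)
Definition tN : N -> R := glue (fun i => tq (cd i)).
Definition cN (u : N -> R) : N -> R := glue (grad_xi u).

Lemma tN_param i x : U i x -> tN (param i x) = tq (cd i) x.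
Proof. by apply: glueE => *; exact: tq_change. Qed.

Lemma cN_param u i x : C1M (M := M) u -> U i x -> cN u (param i x) = grad_xi u i x.
Proof. by move=> cu; apply: glueE => *; exact: grad_xi_change. Qed.

Lemma tN_continuous : continuous tN.
Proof. by apply: glue_continuous => [*|i]; [exact: tq_change|exact: tq_smooth]. Qed.

Lemma cN_continuous u : C1M (M := M) u -> continuous (cN u).
Proof. by move=> cu; apply: glue_continuous => [*|i]; [exact: grad_xi_change|exact: grad_xi_C0]. Qed.

(** The sum is the derivative along xi of the constant function 1. *)
Lemma cN_sum (I : Type) (s : seq I) (f : I -> N -> R) p : (forall k, C1M (M := M) (f k)) ->
  (forall q, \sum_(k <- s) f k q = 1) -> \sum_(k <- s) cN (f k) p = 0.
Proof.
move=> cf f1; pose i := chart_at M p; pose x := chart i p.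
have ix : U i x by exact: chart_in (mem_chart_at M p).
rewrite -[LHS]/(\sum_(k <- s) \sum_a xup (cd i) a x * pd a (fun y => f k (param i y)) x).
rewrite exchange_big; apply: big1 => a _ /=; rewrite -mulr_sumr.
have [_ <-] := @pd_sum R n I s (fun k y => f k (param i y)) a x (fun k => Ck_derivable (cf k i) ix).
rewrite (_ : (fun y => _) = cst 1); last by apply/funext => y; rewrite f1.
by rewrite /pd derive_cst mulr0.
Qed.

Section Divergence.
Variables (i : atlas M) (K : set vec) (r : R) (chi : N -> R).
Hypothesis cs : chart_support i K r.
Hypothesis chi_C1 : C1M (M := M) chi.
Hypothesis chi_supp : supp_in i K chi.

Lemma cN_supp : supp_in i K (cN chi).
Proof.
have [cK KU _ _] := cs.
move=> p cp; apply: contrapT => nS; move/eqP: cp; apply.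
pose j := chart_at M p; pose x := chart j p.
have jp : dom j p := mem_chart_at M p; have jx : U j x by exact: chart_in.
pose S := [set q | dom i q /\ K (chart i q)].
have cS : closed S by exact: compact_preim_closed cK KU.
have oV : open [set y | U j y /\ (~` S) (param j y)] by apply: open_param_preim; exact: closed_openC.
have Vx : [set y | U j y /\ (~` S) (param j y)] x by split=> //; rewrite /x chartK.
rewrite -[LHS]/(\sum_a xup (cd j) a x * pd a (fun y => chi (param j y)) x) big1 // => a _.
rewrite (_ : pd _ _ _ = 0) ?mulr0 // -[RHS](derive_cst (0 : R) x (delta_mx 0 a : vec)).
apply: near_eq_derive; apply: nearU oV Vx _ => y [_ nSy].
by have [//|/chi_supp/nSy] := eqVneq (chi (param j y)) 0.
Qed.

Let w := wt h i.
Let chix x := chi (param i x).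

Lemma clip_div_continuous :
  continuous (@clip _ _ (U i) (fun x => w x * chix x * dq (cd i) x)).
Proof.
have [cK KU _ _] := cs; have oU := @open_U _ _ _ M i.
move=> x; apply: (@Ck_continuous _ _ _ 0 setT) => //.
apply: (clip_Ck oU cK KU) => [y iy nK|].
  have [->|/chi_supp[_]] := eqVneq (chix y) 0; first by rewrite mulr0 mul0r.
  by rewrite paramK.
apply: (Ck_mul oU (Ck_mul oU (Ck_S (wt_C1 h J i)) (Ck_S (chi_C1 i)))).
exact: (sfun_smooth (divergence (mcalc (cd i)) (sacs (cd i))) 0).
Qed.

(** The total derivative of density times xi times chi integrates to zero by [ibox_pd]. By
    [div_dens] it is the density times chi div xi plus the derivative of chi along xi. *)
Lemma divergence_chart :
  ibox r (@clip _ _ (U i) (fun x => w x * chix x * dq (cd i) x)) = - ilin h i r (cN chi).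
Proof.
have [cK KU r0 Kr] := cs; have oU := @open_U _ _ _ M i.
have chi0 x : U i x -> ~ K x -> chix x = 0.
  move=> ix nK; have [//|/chi_supp[_]] := eqVneq (chix x) 0; by rewrite paramK.
pose f a x := w x * xup (cd i) a x * chix x.
have f_C1 a : Ck_on 1 (U i) (f a).
  by apply: (Ck_mul oU (Ck_mul oU (wt_C1 h J i) (xup_smooth (cd i) a 1)) (chi_C1 i)).
pose phi a := @clip _ _ (U i) (f a).
have phi_C1 a : Ck_on 1 setT (phi a).
  by apply: (clip_Ck oU cK KU _ (f_C1 a)) => x ix nK; rewrite /f chi0 ?mulr0.
have phi0 a x : ~ K x -> phi a x = 0.
  by move=> nK; rewrite /phi /clip; case: asboolP => // ix; rewrite /f chi0 ?mulr0.
have i0 a : ibox r (pd a (phi a)) = 0.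
  apply: ibox_pd => // x xr; apply: phi0 => /Kr; by rewrite ltNge xr.
have aC : adm (M := M) i K (cN chi) by split; [exact: cN_continuous|exact: cN_supp].
have cC := ext_continuous (h := h) J cK KU aC.
pose F := @clip _ _ (U i) (fun x => w x * chix x * dq (cd i) x).
have cF : continuous F by exact: clip_div_continuous.
have key x : \sum_a pd a (phi a) x = F x + ext h i (cN chi) x.
  have [ix|nix] := pselect (U i x); last first.
    rewrite /F /ext /clip !asboolF // addr0 big1 // => a _.
    have nK : (~` K) x by move=> /KU.
    have oK : open (~` K) by apply: closed_openC; apply: compact_closed cK; exact: norm_hausdorff.
    rewrite -[RHS](derive_cst (0 : R) x (delta_mx 0 a : vec)).
    by apply: near_eq_derive; apply: nearU oK nK _ => y; exact: phi0.
  rewrite /F /ext !clipE // cN_param // /grad_xi.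
  have e a : pd a (phi a) x = chix x * pd a (dens (g := h i) * xup (cd i) a) x +
      w x * (xup (cd i) a x * pd a (fun y => chi (param i y)) x).
    rewrite (pd_eq oU (g := (dens (g := h i) * xup (cd i) a) * chix)) //; last first.
      by move=> y iy; rewrite /phi clipE.
    have d1 : derivable (dens (g := h i) * xup (cd i) a) x (delta_mx 0 a).
      exact: Ck_derivable (Ck_mul oU (wt_C1 h J i) (xup_smooth (cd i) a 1)) ix.
    have d2 : derivable chix x (delta_mx 0 a) by exact: Ck_derivable (chi_C1 i) ix.
    rewrite {1}/pd deriveM // addrC mulrA; congr (_ + _).
  rewrite (eq_bigr _ (fun a _ => e a)) big_split /= -!mulr_sumr -(div_dens (cd i) ix).
  by congr (_ + _); rewrite mulrCA -mulrA; congr (_ * _); rewrite mulrC.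
have : ibox r (fun x => \sum_a pd a (phi a) x) = 0.
  have [_ ->] := @lin_sum R vec (fun f => continuous f) (@ibox R r n)
    (fun f g cf cg x => @continuousD _ _ _ f g x (cf x) (cg x)) (@cst_continuous _ _ 0)
    (fun f g cf cg => iboxD r0 cf cg) (ibox0 r0 n) _ (index_enum 'I_n) (fun a => pd a (phi a))
    (fun a x => Ck_continuous (Ck_derive a (phi_C1 a)) I).
  by apply: big1 => a _; exact: i0.
rewrite (_ : (fun x => _) = (fun x => F x + ext h i (cN chi) x)); last first.
  by apply/funext => x; exact: key.
by rewrite iboxD // => /eqP; rewrite addr_eq0 => /eqP.
Qed.

End Divergence.
End ChartChange.

(** * The mean of t and the final inequalities *)

Theorem theorem4p3 (R : realType) (n : nat) (N : ptopologicalType)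
    (M : smooth_manifold R n N)
    (h : riemannian_metric M) (J : almost_complex_structure M)
    (vol : {measure set (g_sigma_algebraType (@open N)) -> \bar R}) :
  compact [set: N] ->
  almost_kahler h J ->
  einstein h ->
  ~ kahler h J ->
  riemannian_volume h vol ->
  let V := fine (vol [set: N]) in
  let avg := V^-1 * \int[vol]_(p in [set: N]) star_scal h J p in
  exists s : R, [/\ forall p : N, scal h p = s,
    s < avg, avg <= 5^-1 * s & 5^-1 * s < 0].
Proof.
move=> cptN ak [lam ein] nK rv V avg; have [orth closed] := ak.
have vfin : (vol setT < +oo)%E by apply: (volume_fin cptN J rv).
pose t := tN h J; pose s := n%:R * lam.
have ct : continuous t by exact: tN_continuous.
have tE p : t p = tq (cdM h J (chart_at M p)) (chart (chart_at M p) p) by [].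
have in_chart p : chart_image (chart_at M p) (chart (chart_at M p) p).
  exact: chart_in (mem_chart_at M p).
have t0 p : 0 <= t p by rewrite tE; exact: (tq_ge0 (cdM h J _) (orth _) (in_chart p)).
(* If t vanished everywhere, Omega would be parallel in every chart. *)
have [p0 tp0] : exists p, 0 < t p.
  apply: contrapT => np; apply: nK; split=> // i x ix u v w.
  apply: (@parallel_chart _ _ _ _ _ (cdM h J i) (orth i) x ix).
  rewrite -tN_param //; apply/eqP; rewrite eq_le t0 andbT leNgt; apply/negP => tp.
  by apply: np; exists (param i x).
have mulc (f g : N -> R) : continuous f -> continuous g -> continuous (fun p => f p * g p).
  by move=> cf cg p; exact: (@continuousM _ _ f g p (cf p) (cg p)).
have addc (f g : N -> R) : continuous f -> continuous g -> continuous (fun p => f p + g p).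
  by move=> cf cg p; exact: (@continuousD _ _ _ f g p (cf p) (cg p)).
have cstc (c : R) : continuous (fun _ : N => c) by exact: cst_continuous.
have iD := iND vfin cptN; have iZ := iNZ vfin cptN.
pose T1 := iN vol t; pose T2 := iN vol (fun p => t p * t p).
have ctt := mulc _ _ ct ct.
have T10 : 0 < T1 by exact: (iN_gt0 cptN J rv ct t0 tp0).
have V0 : 0 < V.
  by rewrite -[V]mul1r -iN_cst; apply: (iN_gt0 cptN J rv (p := p0)).
(* The pointwise inequality is integrated against each function of a partition of unity. Integration
   by parts replaces the divergence by the derivatives of these functions along xi, whose sum is
   zero. *)
have key : 5 * T2 + 8 * s * T1 <= 0.
  pose G p := 5 * (t p * t p) + 8 * s * t p.
  have cG : continuous G by apply: addc; apply: mulc.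
  have -> : 5 * T2 + 8 * s * T1 = iN vol G.
    by rewrite iD ?iZ //; apply: mulc.
  have [D [chi [K [r [hchi chi1]]]]] := partition_of_unity cptN (M := M).
  have chiC k : C1M (M := M) (chi k) by case: (hchi k).
  have chic k : continuous (chi k) by exact: C1M_continuous (chiC k).
  have local k : iN vol (fun p => G p * chi k p) <= - (4 * n%:R) * iN vol (cN h J (chi k)).
    have [cs _ chi0 sp] := hchi k; have [cK KU r0 Kr] := cs.
    have aG : adm (M := M) (chart_at M k) (K k) (fun p => G p * chi k p) by apply: admM.
    have aC : adm (M := M) (chart_at M k) (K k) (cN h J (chi k)).
      by split; [exact: cN_continuous|exact: cN_supp cs sp].
    rewrite (iN_ilin J cK KU r0 Kr rv vfin cptN aG) (iN_ilin J cK KU r0 Kr rv vfin cptN aC).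
    rewrite mulNr -mulrN -(divergence_chart h J cs (chiC k) sp) -iboxZ //; last first.
      exact: clip_div_continuous cs (chiC k) sp.
    have cE := ext_continuous (h := h) J cK KU aG.
    have cF := clip_div_continuous (h := h) (J := J) cs (chiC k) sp.
    rewrite /ilin; apply: (ibox_le r0 cE) => //.
      by move=> x; exact: (@continuousM _ _ (fun _ => 4 * n%:R) _ x (@cst_continuous _ _ _ x) (cF x)).
    move=> x _; rewrite /ext /clip; case: asboolP => [ix|]; last by rewrite mulr0.
    have hG : G (param (chart_at M k) x) <= 4 * n%:R * dq (cdM h J (chart_at M k)) x.
      rewrite /G /t tN_param // -expr2 /s.
      have := sekigawa_chart (cdM h J (chart_at M k)) (orth _) (closed _) (ein _) ix.
      by rewrite -!mulrA.
    have w0 := wt_ge0 h (chart_at M k) x; have c0 := chi0 (param (chart_at M k) x).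
    move: (mulr_ge0 w0 c0) hG.
    move: (wt _ _ _) (chi _ _) (dq _ _) (G _) (4 * n%:R) => w c d g k4 wc gd.
    have -> : w * (g * c) = w * c * g by ring.
    have -> : k4 * (w * c * d) = w * c * (k4 * d) by ring.
    exact: ler_wpM2l.
  have [_ e1] := @lin_sum R N (fun f => continuous f) (iN vol) addc (cstc 0) iD
    (etrans (iN_cst vol 0) (mul0r _)) N D (fun k p => G p * chi k p) (fun k => mulc _ _ cG (chic k)).
  have [_ e2] := @lin_sum R N (fun f => continuous f) (iN vol) addc (cstc 0) iD
    (etrans (iN_cst vol 0) (mul0r _)) N D (fun k => cN h J (chi k)) (fun k => cN_continuous (chiC k)).
  rewrite (_ : G = fun p => \sum_(k <- D) G p * chi k p); last first.
    by apply/funext => p; rewrite -mulr_sumr chi1 mulr1.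
  rewrite e1; apply: le_trans (ler_sum _ (fun k _ => local k)) _.
  rewrite -mulr_sumr -e2 (_ : (fun p => _) = fun _ => 0) ?iN_cst ?mul0r ?mulr0 //.
  by apply/funext => p; exact: (cN_sum h J p chiC chi1).
pose a := T1 / V; have a0 : 0 < a by rewrite divr_gt0.
have T1E : T1 = a * V by rewrite divfK // gt_eqF.
(* With [a] the mean of t, the variance of t is nonnegative. *)
have CS : a * T1 <= T2.
  have : 0 <= iN vol (fun p => (t p - a) * (t p - a)).
    by apply: Rintegral_ge0 => p _; rewrite -expr2 sqr_ge0.
  rewrite (_ : (fun p => _) = fun p => t p * t p + (- 2 * a * t p + a * a)); last first.
    by apply/funext => p; ring.
  have c1 : continuous (fun p => - 2 * a * t p) by apply: mulc.
  rewrite iD //; last exact: addc.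
  rewrite iD // (iZ (- 2 * a) t ct) (iN_cst vol (a * a)) => h1.
  have h2 : 0 <= T2 + (- 2 * a * (a * V) + a * a * V) by rewrite -{1}T1E; exact: h1.
  rewrite T1E -subr_ge0; apply: le_trans h2 _; rewrite le_eqVlt; apply/orP; left; apply/eqP.
  by ring.
have a_le : 5 * a + 8 * s <= 0.
  rewrite -(pmulr_lle0 _ T10); apply: le_trans key; rewrite mulrDl lerD2r -mulrA ler_pM2l //.
have avgE : avg = s + a / 2.
  rewrite /avg (_ : \int[vol]_(p in [set: N]) star_scal h J p = s * V + 2^-1 * T1).
    by rewrite mulrDr [s * V]mulrC mulKf ?gt_eqF // mulrCA /a; congr (_ + _); rewrite mulrC [T1 / V]mulrC.
  rewrite -iN_cst -iZ // -iD //; last exact: mulc.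
  congr iN; apply/funext => p; rewrite /star_scal.
  rewrite (star_scalar_curvatureE (cdM h J (chart_at M p)) (orth _) (closed _) (ein _) (in_chart p)).
  by rewrite -(tE p) [2^-1 * _]mulrC.
(* From 5 a + 8 s <= 0 and a > 0 follow s < 0 and s + a / 2 <= s - 4 s / 5 = s / 5. *)
exists s; split.
- by move=> p; exact: (scalar_curvatureE (cdM h J (chart_at M p)) (ein _) (in_chart p)).
- rewrite avgE; lra.
- rewrite avgE; lra.
- lra.
Qed.
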